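(* Let $\mathcal{H},\mathcal{G}$ be Hilbert spaces and let $\mathcal{A}:\mathcal{D}(\mathcal{A})\subset\mathcal{H}\to\mathcal{H}$ and $\mathcal{B}:\mathcal{D}(\mathcal{B})\subset\mathcal{H}\to\mathcal{G}$ be linear operators satisfying conditions (A) and (B) stated in the context, with $T_0\ge 0$ the constant from (B). Let $T>T_0$, $M\in H^2(0,T)$, and $\sigma\in C^1[0,T]$ with $\sigma(0)\ne0$. Let $\{\phi_n\}_{n=1}^\infty\subset\mathcal{H}$ be an orthonormal basis of $\mathcal{H}$ consisting of eigenfunctions of $\mathcal{A}$. Then there exists a sequence $\{\theta_n\}_{n=1}^\infty\subset L^2([0,T];\mathcal{G})$ such that for every $f\in\mathcal{H}$, $$f=\sum_{n=1}^\infty\phi_n\,\langle\mathcal{B}u',\theta_n\rangle_{L^2([0,T];\mathcal{G})},$$ where $u:[0,T]\to\mathcal{H}$ is the solution of $$u''(t)+\mathcal{A}u(t)=\int_0^t M(t-s)\,\mathcal{A}u(s)\,ds+\sigma(t)f,\quad t\in[0,T],\qquad u(0)=0,\quad u'(0)=0.$$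
   Context: Condition (A): $\mathcal{A}:\mathcal{D}(\mathcal{A})\subset\mathcal{H}\to\mathcal{H}$ is self-adjoint, closed with dense range, has compact resolvent, and is semibounded: there is $c>0$ with $\langle\mathcal{A}u,u\rangle\ge -c\|u\|^2$ for all $u\in\mathcal{D}(\mathcal{A})$. $\mathcal{H}^1$ denotes the completion of $\mathcal{D}(\mathcal{A})$ in the norm $\|x\|_1^2:=\|x\|^2+\||\mathcal{A}|^{1/2}x\|^2$. Existence of the eigenbasis $\{\phi_n\}$ follows from (A). Condition (B): $\mathcal{B}:\mathcal{D}(\mathcal{B})\subset\mathcal{H}\to\mathcal{G}$ is closed with dense range, and there exists $T_0\ge0$ such that for any $T>T_0$ there exists $C>0$ such that for all $(w_0,w_1)\in\mathcal{H}^1\times\mathcal{H}$ the solution $w$ of $w''(t)+\mathcal{A}w(t)=0$ on $[0,T]$, $w(0)=w_0$, $w'(0)=w_1$, satisfies $$C^{-1}\|(w_0,w_1)\|_{\mathcal{H}^1\times\mathcal{H}}\le\|\mathcal{B}w\|_{L^2([0,T];\mathcal{G})}\le C\|(w_0,w_1)\|_{\mathcal{H}^1\times\mathcal{H}}.$$ Here $\mathcal{B}w$ is the function $t\mapsto\mathcal{B}w(t)$ and $\mathcal{B}u'$ is $t\mapsto\mathcal{B}(u'(t))$. The inner product of $L^2([0,T];\mathcal{G})$ is linear in the first argument; the series converges in $\mathcal{H}$. Write $\mathcal{A}\phi_n=\mu_n\phi_n$; the $\phi_n$ lie in $\mathcal{D}(\mathcal{B})$ (implicit in (B)). Solutions are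 understood by expansion in this basis (separation of variables): $u=\sum_n y_n\phi_n$ where the scalar function $y_n=\langle u,\phi_n\rangle$ solves $y_n''+\mu_n y_n=\mu_n\int_0^t M(t-s)y_n(s)\,ds+\sigma(t)\langle f,\phi_n\rangle$ with $y_n(0)=y_n'(0)=0$ (and analogously, with $M=0$, $\sigma=0$ and initial data $\langle w_0,\phi_n\rangle,\langle w_1,\phi_n\rangle$, for $w$ in (B)). *)

(* Defs.v *)
From HB Require Import structures.
From mathcomp Require Import all_boot all_order all_algebra.
From mathcomp Require Import complex.
From mathcomp Require Import all_classical all_reals all_analysis.
From mathcomp Require Import sesquilinear.

Set Implicit Arguments.
Unset Strict Implicit.
Unset Printing Implicit Defensive.
Import Order.TTheory GRing.Theory Num.Theory.
Import numFieldNormedType.Exports.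

Local Open Scope classical_set_scope.
Local Open Scope ring_scope.

(* Hilbert spaces are taken over [scalars R s], which is R or R[i]; both cases
   are treated at once. *)
Variant scalar_kind := RealScalars | ComplexScalars.

Definition scalars (R : realType) (s : scalar_kind) : numFieldType :=
  match s with
  | RealScalars => R
  | ComplexScalars => complex R
  end.

Definition conjS (R : realType) (s : scalar_kind) :
    {rmorphism scalars R s -> scalars R s} :=
  match s with
  | RealScalars => idfun : {rmorphism R -> R}
  | ComplexScalars =>
      @conjc R
        : {rmorphism complex R -> complex R}
  end.

Definition reS (R : realType) (s : scalar_kind) : scalars R s -> R :=
  match s with
  | RealScalars => fun x => x
  | ComplexScalars => @complex.Re R
  end.

Definition imS (R : realType) (s : scalar_kind) : scalars R s -> R :=
  match s with
  | RealScalars => fun=> 0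
  | ComplexScalars => @complex.Im R
  end.

(* a + i b; the imaginary part is dropped over the reals *)
Definition mkS (R : realType) (s : scalar_kind) (a b : R) : scalars R s :=
  match s with
  | RealScalars => a
  | ComplexScalars => Complex a b
  end.

Definition ofR (R : realType) (s : scalar_kind) (a : R) : scalars R s :=
  mkS s a 0.

(* The norm of a normed module over [scalars R s] is [scalars R s]-valued. *)
Definition rnorm (R : realType) (s : scalar_kind)
  (V : normedModType (scalars R s)) (x : V) : R := reS `|x|.

(* [inner] is linear in its first argument. *)
Record hilbert (R : realType) (s : scalar_kind) := Hilbert {
  hilbert_sort :> completeNormedModType (scalars R s);
  inner : {dot hilbert_sort for conjS R s};
  norm_inner : forall x : hilbert_sort, `|x| ^+ 2 = inner x x
}.

(* Values of [op_fun] outside [dom] are irrelevant. *)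
Record linop (K : numFieldType) (H G : normedModType K) := LinOp {
  dom : set H;
  op_fun :> H -> G;
  dom0 : dom 0;
  dom_lin : forall (a : K) (x y : H), dom x -> dom y -> dom (a *: x + y);
  op_lin : forall (a : K) (x y : H), dom x -> dom y ->
    op_fun (a *: x + y) = a *: op_fun x + op_fun y
}.

Section Operators.
Variables (K : numFieldType) (H G : normedModType K).

Definition closed_op (A : linop H G) :=
  closed [set p : H * G | dom A p.1 /\ A p.1 = p.2].

Definition dense_range (A : linop H G) := dense (A @` dom A).

Definition compact_map (L : H -> H) :=
  forall S : set H, bounded_set S -> compact (closure (L @` S)).

Definition compact_resolvent (A : linop H H) :=
  exists (lam : K) (L : H -> H),
    [/\ forall x, dom A (L x) /\ A (L x) - lam *: L x = x,
        forall x, dom A x -> L (A x - lam *: x) = x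
      & compact_map L].

End Operators.

Section HilbertOperators.
Variables (R : realType) (s : scalar_kind) (H : hilbert R s).
Local Notation K := (scalars R s).
Local Notation "<< x , y >>" := (inner H x y).

(* A is densely defined and coincides, domains included, with its adjoint *)
Definition selfadjoint (A : linop H H) :=
  dense (dom A) /\
  forall v w : H,
    (dom A v /\ A v = w) <-> (forall x, dom A x -> << A x, v >> = << x, w >>).

(* For complex scalars the order also asserts that << A x, x >> is real, which
   holds for a self-adjoint A. *)
Definition semibounded (A : linop H H) :=
  exists2 c : K, 0 < c & forall x, dom A x -> - c * `|x| ^+ 2 <= << A x, x >>.

Definition condA (A : linop H H) :=
  [/\ selfadjoint A, closed_op A, dense_range A, compact_resolvent A
    & semibounded A].

Definition orthonormal_basis (phi : nat -> H) :=
  (forall m n, << phi m, phi n >> = (m == n)%:R) /\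
  (forall x, series (fun n => << x, phi n >> *: phi n) @ \oo --> x).

Definition eigenpairs (A : linop H H) (mu : nat -> K) (phi : nat -> H) :=
  forall n, dom A (phi n) /\ A (phi n) = mu n *: phi n.

(* |A|^(1/2) x by functional calculus in the eigenbasis; the series converges
   for every x in the domain of A *)
Definition abs_sqrt (mu : nat -> K) (phi : nat -> H) (x : H) : H :=
  lim (series (fun n =>
    (ofR s (Num.sqrt (rnorm (mu n : K^o))) * << x, phi n >>) *: phi n) @ \oo).

Definition norm1 (mu : nat -> K) (phi : nat -> H) (x : H) : R :=
  Num.sqrt (rnorm x ^+ 2 + rnorm (abs_sqrt mu phi x) ^+ 2).

(* The completion H^1 of (dom A, norm1), realized inside H: [H1_norm A mu phi x r]
   says that x is in H^1 with norm r, i.e. x is the limit in H of a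
   norm1-Cauchy sequence of dom A along which norm1 tends to r. *)
Definition H1_norm (A : linop H H) (mu : nat -> K) (phi : nat -> H)
    (x : H) (r : R) :=
  exists v : nat -> H,
    [/\ forall k, dom A (v k),
        forall e : R, 0 < e -> exists N, forall k l, (N <= k)%N -> (N <= l)%N ->
          norm1 mu phi (v k - v l) < e,
        v @ \oo --> x
      & norm1 mu phi (v k) @[k --> \oo] --> r].

End HilbertOperators.

(* Derivative at t, relative to [0, T], of f with values in a normed module
   over [scalars R s]; one-sided at the end points. The derivative of the library
   would require R itself as the field of scalars. *)
Definition is_deriv_on (R : realType) (s : scalar_kind)
    (V : normedModType (scalars R s)) (T : R) (f : R -> V) (t : R) (l : V) :=
  (ofR s h^-1 *: (f (t + h) - f t))
    @[h --> within [set h | 0 <= t + h <= T] 0^'] --> l.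

Section Integrals.
Variables (R : realType) (s : scalar_kind).
Local Notation K := (scalars R s).
Local Notation leb := (@lebesgue_measure R).

Definition integralS (D : set R) (h : R -> K) : K :=
  mkS s (\int[leb]_(t in D) reS (h t)) (\int[leb]_(t in D) imS (h t)).

(* Bochner measurability on [0, T] (in its everywhere, rather than almost
   everywhere, form: this only restricts the choice of representatives) *)
Definition strongly_measurable (V : normedModType K) (T : R) (g : R -> V) :=
  exists g_ : nat -> R -> V,
    (forall k, finite_set (range (g_ k)) /\
       forall v, measurable (g_ k @^-1` [set v])) /\
    (forall t : R, 0 <= t <= T -> g_ k t @[k --> \oo] --> g t).

Definition L2 (V : normedModType K) (T : R) (g : R -> V) :=
  strongly_measurable T g /\
  (\int[leb]_(t in `[0%R, T]%classic) (rnorm (g t) ^+ 2)%:E < +oo)%E.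

Definition L2norm (V : normedModType K) (T : R) (g : R -> V) : R :=
  Num.sqrt (\int[leb]_(t in `[0, T]%classic) rnorm (g t) ^+ 2).

Definition L2inner (G : hilbert R s) (T : R) (g h : R -> G) : K :=
  integralS `[0, T]%classic (fun t => inner G (g t) (h t)).

(* The function t |-> B (v t) is defined almost everywhere on [0, T] and g
   represents it in L^2([0, T]; G). *)
Definition L2_image (H G : hilbert R s) (B : linop H G) (T : R)
    (v : R -> H) (g : R -> G) :=
  L2 T g /\
  {ae leb, forall t : R, 0 <= t <= T -> dom B (v t) /\ g t = B (v t)}.

(* C^1 functions on the line with compact support in (0, T) *)
Definition test_function (T : R) (psi : R -> R) :=
  [/\ forall t, derivable psi t 1, continuous (derive1 psi)
    & exists a b : R, [/\ 0 < a, b < T & forall t, ~~ (a <= t <= b) -> psi t = 0]].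

Definition weak_deriv (T : R) (M dM : R -> K) :=
  forall psi, test_function T psi ->
    integralS `[0, T]%classic (fun t => ofR s (derive1 psi t) * M t) =
    - integralS `[0, T]%classic (fun t => ofR s (psi t) * dM t).

Definition Sobolev2 (T : R) (M : R -> K) :=
  exists dM ddM : R -> K,
    [/\ @L2 K^o T M, @L2 K^o T dM, @L2 K^o T ddM,
        weak_deriv T M dM & weak_deriv T dM ddM].

Definition C1_on (T : R) (f : R -> K) :=
  exists df : R -> K,
    (forall t : R, 0 <= t <= T -> @is_deriv_on R s K^o T f t (df t)) /\
    {within `[0, T]%classic, continuous (df : R -> K^o)}.

(* y'' + m y = m (M * y) + F on [0, T], y(0) = a, y'(0) = b *)
Definition scalar_solution (T : R) (m : K) (M F : R -> K) (a b : K)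
    (y : R -> K) :=
  exists dy ddy : R -> K,
    [/\ forall t : R, 0 <= t <= T -> @is_deriv_on R s K^o T y t (dy t),
        forall t : R, 0 <= t <= T -> @is_deriv_on R s K^o T dy t (ddy t),
        forall t : R, 0 <= t <= T ->
          ddy t + m * y t =
          m * integralS `[0, t]%classic (fun r => M (t - r) * y r) + F t,
        y 0 = a
      & dy 0 = b].

(* u'' + A u = \int_0^t M (t - r) A u(r) dr + sigma f, u(0) = u0, u'(0) = u1,
   understood by expansion in the eigenbasis phi of A *)
Definition solution (H : hilbert R s) (mu : nat -> K) (phi : nat -> H) (T : R)
    (M sigma : R -> K) (f u0 u1 : H) (u : R -> H) :=
  forall n, scalar_solution T (mu n) M (fun t => sigma t * inner H f (phi n))
    (inner H u0 (phi n)) (inner H u1 (phi n)) (fun t => inner H (u t) (phi n)).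

Definition condB (H G : hilbert R s) (A : linop H H) (mu : nat -> K)
    (phi : nat -> H) (B : linop H G) (T0 : R) :=
  [/\ closed_op B, dense_range B
    & forall T, T0 < T -> exists2 C : R, 0 < C &
      forall (w0 w1 : H) (r : R) (w : R -> H),
        H1_norm A mu phi w0 r ->
        solution mu phi T (fun=> 0) (fun=> 0) 0 w0 w1 w ->
        exists2 Bw : R -> G, L2_image B T w Bw &
          C^-1 * Num.sqrt (r ^+ 2 + rnorm w1 ^+ 2) <= L2norm T Bw
            <= C * Num.sqrt (r ^+ 2 + rnorm w1 ^+ 2)].

End Integrals.

(* Main.v *)
(* Write f_n = <f, phi_n>. Then <u, phi_n> = f_n Y_n, where Y_n solves
   Y'' + mu_n Y = mu_n M * Y + sigma with zero initial data, and one has to find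
   theta_n biorthogonal to the functions Y_n' B phi_n. Let S_n be the solution of
   S'' + mu_n S = 0, S(0) = 0, S'(0) = 1. In the algebra of convolution operators
   on [0, T] the element delta - M has an inverse square root
   sum_j binom(2j, j) 4^(-j) M^{*j}, and the memory equation becomes the equation of
   S_n with d/dt replaced by d/dt + a + (convolution operator). This gives
   Y_n' = alpha S_n + V S_n, where alpha(t) = sigma(0) exp(-a t) does not vanish and
   the Volterra operator V does not depend on n. By Gronwall's lemma the norms of
   sum_n f_n Y_n' B phi_n and of sum_n f_n S_n B phi_n in L^2([0, T]; G) are
   equivalent; the second sum is B w for the wave w with w(0) = 0, w'(0) = f, so (B)
   makes both equivalent to the norm of f. Hence (Y_n' B phi_n) is a Riesz sequence;
   its biorthogonal sequence is the L^2 limit of the solutions of the finite Gram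
   systems. *)
From HB Require Import structures.
From mathcomp Require Import all_boot all_order all_algebra.
From mathcomp Require Import complex.
From mathcomp Require Import all_classical all_reals all_analysis.
From mathcomp Require Import measurable_realfun sesquilinear.
From mathcomp Require Import ring lra.
Require Import Defs.

Set Implicit Arguments.
Unset Strict Implicit.
Unset Printing Implicit Defensive.
Import Order.TTheory GRing.Theory Num.Theory.
Import numFieldNormedType.Exports.

Local Open Scope classical_set_scope.
Local Open Scope ring_scope.

(** * Convolution of continuous real functions *)

Section RealConvolution.
Variable R : realType.
Local Notation leb := (@lebesgue_measure R).
Implicit Types f g h : R -> R.

Definition reflect_at (t : R) : measurableTypeR R -> measurableTypeR R :=
  fun x => t - x.

Lemma measurable_reflect_at t : measurable_fun setT (reflect_at t).
Proof. exact: measurable_funB. Qed.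

HB.instance Definition _ t :=
  isMeasurableFun.Build _ _ _ _ (reflect_at t) (measurable_reflect_at t).

Lemma lebesgue_measure_reflect (t : R) (A : set R) : measurable A ->
  pushforward leb (reflect_at t) A = leb A.
Proof.
move=> mA; apply/esym/lebesgue_measure_unique => //= _ [[a b]] _ <-.
rewrite /pushforward.
have -> : reflect_at t @^-1` [set` `]a, b]] = `[t - b, t - a[%classic.
  apply/seteqP; split => x /=; rewrite /reflect_at !in_itv/= => /andP[h1 h2];
    apply/andP; split; lra.
rewrite !lebesgue_measure_itv/= !lte_fin.
by rewrite ltrD2l ltrN2 -!EFinD; congr (if _ then _%:E else _); ring.
Qed.

Lemma integral_reflect (t : R) (f : R -> \bar R) : leb.-integrable setT f ->
  leb.-integrable setT (f \o reflect_at t) /\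
  (\int[leb]_x f (reflect_at t x) = \int[leb]_x f x)%E.
Proof.
move=> fi.
have mf : measurable_fun setT f by case/integrableP : fi.
have E (g : R -> \bar R) : (\int[leb]_x g x = \int[pushforward leb (reflect_at t)]_x g x)%E.
  by apply: eq_measure_integral => A mA _; exact/esym/lebesgue_measure_reflect.
have fri : leb.-integrable setT (f \o reflect_at t).
  apply/integrableP; split; first exact: (measurableT_comp mf (measurable_reflect_at t)).
  have : (\int[leb]_x `|f x| < +oo)%E by case/integrableP : fi.
  by rewrite E ge0_integral_pushforward//; exact: measurableT_comp.
by split => //; rewrite [RHS]E integral_pushforward.
Qed.

Lemma integral_translate (t : R) (f : R -> \bar R) : leb.-integrable setT f ->
  leb.-integrable setT (fun x : R => f (x - t)) /\
  (\int[leb]_x f ((x : R) - t)%R = \int[leb]_x f x)%E.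
Proof.
move=> fi; have [fi0 <-] := integral_reflect 0 fi.
have [fit <-] := integral_reflect t fi0.
have <- : (f \o reflect_at 0) \o reflect_at t = fun x => f (x - t).
  by apply/funext => x; rewrite /= /reflect_at; congr f; ring.
by [].
Qed.

Lemma ae_reflect (t : R) (P : set R) :
  {ae leb, forall x, P x} -> {ae leb, forall x, P (t - x)}.
Proof.
move=> [N [mN N0 PN]]; exists (reflect_at t @^-1` N); split.
- by rewrite -[X in measurable X]setTI; exact: measurable_reflect_at.
- by rewrite -N0; exact: lebesgue_measure_reflect.
- by move=> x /= Px; apply: PN.
Qed.

Lemma continuous_integrable f (a b : R) :
  continuous f -> leb.-integrable `[a, b] (EFin \o f).
Proof.
move=> cf; apply: continuous_compact_integrable; first exact: segment_compact.
exact: continuous_subspaceT.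
Qed.

Lemma continuous_bounded f (a b : R) : continuous f ->
  exists2 m : R, 0 <= m & forall x, a <= x <= b -> `|f x| <= m.
Proof.
move=> cf; have [ab|ba] := leP a b; last first.
  by exists 0 => // x /andP[? ?]; exfalso; lra.
have [|c _ cm] := @EVT_max R (fun x => `|f x|) a b ab.
  apply: continuous_subspaceT => x; apply: continuous_comp; first exact: cf.
  exact: norm_continuous.
exists `|f c|; first exact: normr_ge0.
by move=> x xab; apply: cm; rewrite in_itv.
Qed.

(* f restricted to the half-line and extended by 0, so that convolutions become
   integrals over the whole line *)
Definition cutp f (x : R) : R := if 0 <= x then f x else 0.

Lemma measurable_cutp f : continuous f -> measurable_fun setT (cutp f).
Proof.
move=> cf; apply: measurable_fun_ifT => //.
  exact: measurable_fun_ler.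
exact: continuous_measurable_fun.
Qed.

Definition rconv f g (t : R) : R := \int[leb]_(r in `[0, t]) (f (t - r) * g r).

Lemma continuous_reflect f (t : R) : continuous f -> continuous (fun r => f (t - r)).
Proof.
move=> cf x; apply: continuous_comp; last exact: cf.
by apply: continuousB; [exact: cst_continuous|].
Qed.

Lemma continuous_reflectM f g (t : R) :
  continuous f -> continuous g -> continuous (fun r => f (t - r) * g r).
Proof.
move=> cf cg x; apply: continuousM; last exact: cg.
exact: continuous_reflect.
Qed.

Lemma cutp_patch f g (t : R) :
  (fun r => cutp f (t - r) * cutp g r) =
  (fun r => f (t - r) * g r) \_ `[0, t].
Proof.
apply/funext => r; rewrite /cutp patchE; case: ifPn => ht; case: ifPn => hr.
- by rewrite ifT// inE /= in_itv/= hr; lra.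
- rewrite mulr0 ifF//; apply/negP; rewrite inE /= in_itv/= => /andP[]; by rewrite (negbTE hr).
- rewrite mul0r ifF//; apply/negP; rewrite inE /= in_itv/= => /andP[]; lra.
- by rewrite mul0r ifF//; apply/negP; rewrite inE /= in_itv/= => /andP[]; lra.
Qed.

Lemma rconvE f g t : rconv f g t = \int[leb]_r (cutp f (t - r) * cutp g r).
Proof. by rewrite cutp_patch /rconv Rintegral_mkcond. Qed.

Lemma integrable_cutp f g t : continuous f -> continuous g ->
  leb.-integrable setT (EFin \o (fun r => cutp f (t - r) * cutp g r)).
Proof.
move=> cf cg; rewrite cutp_patch -restrict_EFin.
apply/integrable_restrict => //; rewrite setTI.
by apply: continuous_integrable; exact: continuous_reflectM.
Qed.

Lemma cutp_rconv f g t : cutp (rconv f g) t = rconv f g t.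
Proof.
by rewrite /cutp; case: ifPn => // t0; rewrite /rconv set_itv_ge ?Rintegral_set0.

Qed.

Lemma rconvC f g : continuous f -> continuous g -> rconv f g = rconv g f.
Proof.
move=> cf cg; apply/funext => t; rewrite !rconvE.
have [_ e] := integral_reflect t (integrable_cutp t cg cf).
rewrite /Rintegral -e; congr fine; apply: eq_integral => r _ /=.
rewrite /reflect_at mulrC; congr ((cutp g _ * _)%:E); ring.
Qed.

Lemma rconvA f g h : continuous f -> continuous g -> continuous h ->
  continuous (rconv f g) -> continuous (rconv g h) ->
  rconv f (rconv g h) = rconv (rconv f g) h.
Proof.
move=> cf cg ch cfg cgh; apply/funext => t; rewrite !rconvE.
pose F (p : measurableTypeR R * measurableTypeR R) := (cutp f (t - p.1) * cutp g (p.1 - p.2) * cutp h p.2)%:E.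
have [mf mf0 hf] := continuous_bounded 0 t cf.
have [mg mg0 hg] := continuous_bounded 0 t cg.
have [mh mh0 hh] := continuous_bounded 0 t ch.
have mF : measurable_fun setT F.
  apply/measurable_EFinP; apply: measurable_funM; first apply: measurable_funM.
  - apply: (measurableT_comp (measurable_cutp cf)).
    by apply: measurable_funB.
  - apply: (measurableT_comp (measurable_cutp cg)).
    by apply: measurable_funB.
  - exact: (measurableT_comp (measurable_cutp ch)).
have FE r s : (`|F (r, s)| <= (mf * mg * mh * \1_(`[0, t]) r * \1_(`[0, t]) s)%:E)%E.
  rewrite /F /= lee_fin /cutp !normrM.
  case: ifPn => h1; last by rewrite normr0 !mul0r !mulr_ge0.
  case: ifPn => h2; last by rewrite normr0 mulr0 !mul0r !mulr_ge0.
  case: ifPn => h3; last by rewrite normr0 mulr0 !mulr_ge0.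
  rewrite !indicE !mem_set /=; [|rewrite in_itv/=; lra|rewrite in_itv/=; lra].
  rewrite !mulr1; apply: ler_pM => //; last by apply: hh; lra.
  by apply: ler_pM => //; [apply: hf|apply: hg]; lra.
have [_ iF] := @integrable12ltyP _ _ (measurableTypeR R) (measurableTypeR R) R
  leb leb F mF.
have {}iF := iF _; have /iF {}iF : (\int[leb]_x \int[leb]_y `|F (x, y)| < +oo)%E.
  have mI : measurable (`[0, t]%classic : set R) by [].
  pose c := fine (leb `[0%R, t]).
  have cE : leb `[0%R, t] = c%:E.
    rewrite /c fineK//= lebesgue_measure_itv/=; case: ifP => // _.
  have c0 : 0 <= c by rewrite fine_ge0.
  have mind (k : R) : measurable_fun setT (fun x : R => (k * \1_(`[0, t]) x)%:E).
    by apply/measurable_EFinP; apply: measurable_funM.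
  have iind (k : R) : 0 <= k -> (\int[leb]_x (k * \1_(`[0, t]) x)%:E = (k * c)%:E)%E.
    move=> k0; under eq_integral do rewrite EFinM.
    rewrite ge0_integralZl//; last exact/measurable_EFinP.
      by rewrite EFinM -cE; congr (_ * _)%E; rewrite integral_indic ?setIT.
  have mi (k r : R) : 0 <= k -> 0 <= k * \1_(`[0, t]%classic : set R) r by move=> k0; rewrite mulr_ge0.
  have mabs : measurable_fun setT (fun x => \int[leb]_y `|F (x, y)|)%E.
    apply: (measurable_fun_fubini_tonelli_F (abse \o F)) => //=.
    exact: measurableT_comp.
  apply: (@le_lt_trans _ _ (\int[leb]_x ((mf * mg * mh * c) * \1_(`[0, t]) x)%:E)%E); last first.
    by rewrite iind ?ltry// !mulr_ge0.
  apply: ge0_le_integral => //.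
  - by move=> x _; apply: integral_ge0.
  - exact: mind.
  move=> r _; rewrite mulrAC -iind ?mi ?mulr_ge0//.
  apply: ge0_le_integral => //.
  - by apply: measurableT_comp => //; exact: (measurableT_comp mF (measurable_pair1 r)).
  - exact: mind.
have FubE := Fubini iF.
transitivity (fine (\int[leb]_r \int[leb]_s F (r, s))%E).
  rewrite /Rintegral; congr fine; apply: eq_integral => r _ /=.
  rewrite /F /= cutp_rconv rconvE EFinM /Rintegral fineK; last first.
    exact/integrable_fin_num/integrable_cutp.
  rewrite -integralZl//; last exact: integrable_cutp.
  by apply: eq_integral => s _ /=; rewrite -EFinM mulrA.
rewrite FubE /Rintegral; congr fine; apply: eq_integral => s _ /=.
rewrite /F /= cutp_rconv rconvE mulrC EFinM /Rintegral fineK; last first.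
  exact/integrable_fin_num/integrable_cutp.
have [it <-] := integral_translate s (integrable_cutp (t - s) cf cg).
rewrite -integralZl//.
apply: eq_integral => r _ /=; rewrite -EFinM; congr (_%:E); rewrite [RHS]mulrC; congr (cutp f _ * _ * _); ring.
Qed.

Lemma integral_itv_continuous g (a : R) : 
  (forall b, leb.-integrable `[a, b] (EFin \o g)) -> forall t, a < t ->
  {for t, continuous (fun t : R => \int[leb]_(r in `[a, t]) g r)}.
Proof.
move=> gi t at0.
have ab : a <= t + 1 by lra.
have := parameterized_integral_continuous ab (gi (t + 1)).
move=> /continuous_within_itvP H.
have /H [+ _ _] : a < t + 1 by lra.
by apply; rewrite in_itv/=; lra.
Qed.

Lemma rconv1_continuous g : continuous g ->
  continuous (fun t : R => \int[leb]_(r in `[0, t]) g r).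
Proof.
move=> cg t.
pose a := Num.min 0 t - 1.
have m1 : Num.min 0 t <= t by rewrite ge_min lexx orbT.
have m2 : Num.min 0 t <= 0 by rewrite ge_min lexx.
have at0 : a < t by rewrite /a; lra.
have a0 : a < 0 by rewrite /a; lra.
have ci b : leb.-integrable `[a, b] (EFin \o cutp g).
  have [m m0 hm] := continuous_bounded 0 b cg.
  apply: (@le_integrable _ _ _ _ _ _ _ (EFin \o cst m)) => //.
  - by apply/measurable_EFinP; apply: measurable_funTS; exact: measurable_cutp.
  - move=> x /=; rewrite in_itv /= => xab; rewrite lee_fin /cutp (ger0_norm m0).
    case: ifPn => x0; first by apply: hm; lra.
    by rewrite normr0.
  - by apply: continuous_integrable; exact: cst_continuous.
have := integral_itv_continuous ci at0.
rewrite (_ : (fun t => _) = (fun t : R => \int[leb]_(r in `[0, t]) g r))//.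
apply/funext => u; rewrite Rintegral_mkcond [RHS]Rintegral_mkcond; congr (Rintegral _ _ _).
apply/funext => r; rewrite !patchE /cutp !mem_setE !in_itv/=.
case: (leP 0 r) => h1 /=; case: (leP r u) => h2; rewrite ?andbF ?andbT//; last by case: ifP.
by rewrite ifT//; lra.
Qed.

Lemma rconv_continuous f g : continuous f -> continuous g ->
  continuous (rconv f g).
Proof.
move=> cf cg t.
pose f0 x := f x - f 0.
have cf0 : continuous f0 by move=> x; apply: continuousB; [exact: cf|exact: cst_continuous].
have E : rconv f g = (fun t => f 0 * (\int[leb]_(r in `[0, t]) g r)) \+ rconv f0 g.
  apply/funext => u /=.
  have ig : leb.-integrable `[0, u] (EFin \o g) by exact: continuous_integrable.
  rewrite -RintegralZl// -RintegralD//.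
  - by apply: eq_Rintegral => r _; rewrite /f0; ring.
  - apply: continuous_integrable => x; apply: continuousM; [exact: cst_continuous|exact: cg].
  - apply: continuous_integrable; exact: continuous_reflectM.
rewrite E; apply: continuousD.
  by apply: continuousM; [exact: cst_continuous|exact: rconv1_continuous].
have ccut : continuous (cutp f0).
  have -> : cutp f0 = fun x => f0 (Num.max 0 x).
    apply/funext => x; rewrite /cutp; case: (leP 0 x) => //.
    by rewrite /f0 subrr.
  move=> x; apply: continuous_comp; last exact: cf0.
  by apply: continuous_max; [exact: cst_continuous|].
have -> : rconv f0 g = fun t : R => \int[leb]_r (cutp f0 (t - r) * cutp g r).
  by apply/funext => u; rewrite rconvE.
have [m m0 hm] := continuous_bounded 0 (t + 1) cf0.
have [n n0 hn] := continuous_bounded 0 (t + 1) cg.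
have ccr (r : R) : continuous (fun x : R => cutp f0 (x - r) * cutp g r).
  move=> x; apply: (@continuousM R R (fun x => cutp f0 (x - r)) (cst (cutp g r))); last exact: cst_continuous.
  apply: (@continuous_comp R R R (fun x => x - r)); last exact: ccut.
  by apply: continuousB; [|exact: cst_continuous].
apply: (@continuity_under_integral R _ _ leb (fun t r => cutp f0 (t - r) * cutp g r)
  setT _ (t - 1) (t + 1) _ _ (fun r => m * n * \1_(`[0, t + 1]) r)) => //.
- by move=> x _; exact: integrable_cutp.
- by apply/aeW => r _ x _; exact: ccr.
- under [X in integrable _ _ X]eq_fun do rewrite /= EFinM.
  apply: integrableZl => //; exact: integrable_indic_itv.
- move=> x; rewrite /= in_itv/= => xt; apply/aeW => r _.
  rewrite /cutp normrM.
  case: ifPn => h1; last by rewrite normr0 mul0r !mulr_ge0.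
  case: ifPn => h2; last by rewrite normr0 mulr0 !mulr_ge0.
  rewrite indicE mem_set /=; last by rewrite in_itv/=; lra.
  by rewrite mulr1; apply: ler_pM => //; [apply: hm|apply: hn]; lra.
- by rewrite inE /= in_itv/=; lra.
Qed.

End RealConvolution.

(** * Real or complex scalars *)

Section Scalars.
Variables (R : realType) (s : scalar_kind).
Local Notation K := (scalars R s).
Implicit Types x y : K.

Definition absS x : R := reS `|x|.

Lemma scalars_ext x y : reS x = reS y -> imS x = imS y -> x = y.
Proof. by case: s x y => //= -[a b] [c d] /= -> ->. Qed.

Lemma reSD x y : reS (x + y) = reS x + reS y.
Proof. by case: s x y => //= -[a b] [c d]. Qed.

Lemma imSD x y : imS (x + y) = imS x + imS y.
Proof. by case: s x y => //= [x y|[a b] [c d]//]; rewrite addr0. Qed.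

Lemma reSN x : reS (- x) = - reS x.
Proof. by case: s x => //= -[a b]. Qed.

Lemma imSN x : imS (- x) = - imS x.
Proof. by case: s x => //= [x|[a b]//]; rewrite oppr0. Qed.

Lemma reSM x y : reS (x * y) = reS x * reS y - imS x * imS y.
Proof. by case: s x y => //= [x y|[a b] [c d]//]; rewrite mulr0 subr0. Qed.

Lemma imSM x y : imS (x * y) = reS x * imS y + imS x * reS y.
Proof. by case: s x y => //= [x y|[a b] [c d]//]; rewrite mulr0 mul0r addr0. Qed.

Lemma reS_ofR (a : R) : reS (ofR s a) = a.
Proof. by case: s. Qed.

Lemma imS_ofR (a : R) : imS (ofR s a) = 0.
Proof. by case: s. Qed.

Lemma reS_mkS (a b : R) : reS (mkS s a b) = a.
Proof. by case: s. Qed.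

(* the factor is 0 over the reals and 1 over the complex numbers *)
Lemma imS_mkS (a b : R) : imS (mkS s a b) = imS (mkS s 0 1) * b.
Proof. by case: s => /=; rewrite ?mul0r ?mul1r. Qed.

Lemma imS_i : imS (mkS s 0 1 : K) = 1 \/ forall x, imS x = 0.
Proof. by case: s => /=; [right|left]. Qed.

Lemma reS_ofRM (a : R) x : reS (ofR s a * x) = a * reS x.
Proof. by rewrite reSM reS_ofR imS_ofR mul0r subr0. Qed.

Lemma imS_ofRM (a : R) x : imS (ofR s a * x) = a * imS x.
Proof. by rewrite imSM reS_ofR imS_ofR mul0r addr0. Qed.

Lemma ofR_is_zmod_morphism : zmod_morphism (@ofR R s).
Proof.
by move=> a b; apply: scalars_ext; rewrite ?(reSD, imSD, reSN, imSN, reS_ofR, imS_ofR) ?subrr.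
Qed.

Lemma ofR_is_monoid_morphism : monoid_morphism (@ofR R s).
Proof.
split; first by case: s.
by move=> a b; apply: scalars_ext; rewrite ?(reSM, imSM, reS_ofR, imS_ofR); ring.
Qed.

HB.instance Definition _ := GRing.isZmodMorphism.Build R K (@ofR R s) ofR_is_zmod_morphism.
HB.instance Definition _ := GRing.isMonoidMorphism.Build R K (@ofR R s) ofR_is_monoid_morphism.

Lemma reS_is_zmod_morphism : zmod_morphism (@reS R s).
Proof. by move=> x y; rewrite reSD reSN. Qed.

Lemma imS_is_zmod_morphism : zmod_morphism (@imS R s).
Proof. by move=> x y; rewrite imSD imSN. Qed.

HB.instance Definition _ := GRing.isZmodMorphism.Build K R (@reS R s) reS_is_zmod_morphism.
HB.instance Definition _ := GRing.isZmodMorphism.Build K R (@imS R s) imS_is_zmod_morphism.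

Lemma reS1 : reS (1 : K) = 1. Proof. by case: s. Qed.
Lemma imS1 : imS (1 : K) = 0. Proof. by case: s. Qed.

Lemma reS_conj x : reS (conjS R s x) = reS x.
Proof. by case: s x => //= -[a b]. Qed.

Lemma imS_conj x : imS (conjS R s x) = - imS x.
Proof. by case: s x => //= [x|[a b]//]; rewrite oppr0. Qed.

Lemma ge0_ofR x : 0 <= x -> x = ofR s (reS x) /\ 0 <= reS x.
Proof.
case: s x => //= -[a b]; rewrite lecE /= => /andP[/eqP -> a0].
by split.
Qed.

Lemma ofR_ge0 (a : R) : (0 <= ofR s a) = (0 <= a).
Proof. by case: s => //=; rewrite lecE /= eqxx. Qed.

Lemma ofR_le (a b : R) : (ofR s a <= ofR s b) = (a <= b).
Proof. by rewrite -subr_ge0 -rmorphB ofR_ge0 subr_ge0. Qed.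

Lemma ofR_lt (a b : R) : (ofR s a < ofR s b) = (a < b).
Proof. by case: s => //=; rewrite ltcE /= eqxx. Qed.

Lemma ofR_rnorm (V : normedModType K) (v : V) : `|v| = ofR s (rnorm v).
Proof. by have [] := ge0_ofR (normr_ge0 v). Qed.

Lemma normS x : `|x| = ofR s (absS x).
Proof. by have [] := ge0_ofR (normr_ge0 x). Qed.

Lemma rnormE x : @rnorm R s K^o x = absS x.
Proof. by []. Qed.

Section rnorm.
Variable V : normedModType K.
Implicit Types u v : V.

Lemma rnorm_ge0 v : 0 <= rnorm v.
Proof. by have [] := ge0_ofR (normr_ge0 v). Qed.

Lemma ler_rnormD u v : rnorm (u + v) <= rnorm u + rnorm v.
Proof. by have := ler_normD u v; rewrite !ofR_rnorm -rmorphD ofR_le. Qed.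

Lemma rnormN v : rnorm (- v) = rnorm v.
Proof. by rewrite /rnorm normrN. Qed.

Lemma rnorm0 : rnorm (0 : V) = 0.
Proof. by rewrite /rnorm normr0 raddf0. Qed.

Lemma rnorm_eq0 v : rnorm v = 0 -> v = 0.
Proof. by move=> v0; apply/eqP; rewrite -normr_eq0 ofR_rnorm v0 rmorph0. Qed.

Lemma rnormZ x v : rnorm (x *: v) = absS x * rnorm v.
Proof.
by apply: (can_inj reS_ofR); rewrite -ofR_rnorm normrZ normS ofR_rnorm -rmorphM.
Qed.

Lemma rdistC u v : rnorm (u - v) = rnorm (v - u).
Proof. by rewrite -rnormN opprB. Qed.

Lemma ler_rnorm_sum (I : Type) (r : seq I) (F : I -> V) :
  rnorm (\sum_(i <- r) F i) <= \sum_(i <- r) rnorm (F i).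
Proof.
elim/big_ind2 : _ => [|a b c d h1 h2|//]; first by rewrite rnorm0.
by apply: le_trans (ler_rnormD _ _) _; apply: lerD.
Qed.

Lemma rnorm_cvgP (T : Type) (F : set_system T) {FF : Filter F} (f : T -> V) l :
  f @ F --> l <-> forall e : R, 0 < e -> \forall x \near F, rnorm (l - f x) < e.
Proof.
split.
  move=> /cvgrPdist_lt h e e0.
  have /h : 0 < ofR s e by rewrite -(rmorph0 (@ofR R s)) ofR_lt.
  by apply: filterS => x; rewrite ofR_rnorm ofR_lt.
move=> h; apply/cvgrPdist_lt => e e0.
have [ee re0] := ge0_ofR (ltW e0).
have : 0 < reS e by rewrite -ofR_lt -ee rmorph0.
by move=> /h; apply: filterS => x; rewrite ofR_rnorm {2}ee ofR_lt.
Qed.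

Lemma ler_rdist u v : `|rnorm u - rnorm v| <= rnorm (u - v).
Proof.
have h1 := ler_rnormD (u - v) v; have h2 := ler_rnormD (v - u) u.
rewrite !subrK in h1 h2; rewrite ler_norml (rdistC v) in h2 *.
by apply/andP; split; lra.
Qed.

Lemma continuous_rnorm (g : R -> V) :
  (forall t (e : R), 0 < e -> exists2 d : R, 0 < d &
     forall x : R, `|x - t| < d -> rnorm (g x - g t) < e) ->
  continuous (fun t => rnorm (g t)).
Proof.
move=> H t; apply/cvgrPdist_lt => e /(H t)[d d0 hd]; apply/nbhs_ballP; exists d => //= x.
rewrite /ball /= distrC => /hd; apply: le_lt_trans; rewrite distrC; exact: ler_rdist.
Qed.

End rnorm.

Lemma absS_ge0 x : 0 <= absS x. Proof. exact: (rnorm_ge0 (x : K^o)). Qed.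

Lemma absSM x y : absS (x * y) = absS x * absS y.
Proof. exact: (rnormZ x (y : K^o)). Qed.

Lemma absSD x y : absS (x + y) <= absS x + absS y.
Proof. exact: (ler_rnormD (x : K^o) y). Qed.

Lemma absSN x : absS (- x) = absS x.
Proof. exact: (rnormN (x : K^o)). Qed.

Lemma absS0 : absS 0 = 0.
Proof. exact: (rnorm0 K^o). Qed.

Lemma absS1 : absS 1 = 1.
Proof. by rewrite /absS normr1 reS1. Qed.

Lemma absS_eq0 x : absS x = 0 -> x = 0.
Proof. exact: (@rnorm_eq0 K^o). Qed.

Lemma absS_sqr x : absS x ^+ 2 = reS x ^+ 2 + imS x ^+ 2.
Proof.
rewrite /absS; case: s x => /= [x|[a b]]; first by rewrite expr0n addr0 real_normK ?num_real.
by rewrite /= sqr_sqrtr// addr_ge0 ?sqr_ge0.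
Qed.

Lemma mulS_conj x : x * conjS R s x = ofR s (absS x ^+ 2).
Proof.
by apply: scalars_ext; rewrite ?(reSM, imSM, reS_conj, imS_conj, reS_ofR, imS_ofR) ?absS_sqr; ring.
Qed.

Lemma absS_ofR (a : R) : absS (ofR s a) = `|a|.
Proof.
apply: (@pexpIrn _ 2); rewrite ?nnegrE ?absS_ge0//.
by rewrite absS_sqr reS_ofR imS_ofR expr0n addr0 real_normK ?num_real.
Qed.

Lemma absS_conj x : absS (conjS R s x) = absS x.
Proof.
apply: (@pexpIrn _ 2); rewrite ?nnegrE ?absS_ge0//.
by rewrite !absS_sqr reS_conj imS_conj sqrrN.
Qed.

Lemma ler_reS x : `|reS x| <= absS x.
Proof.
rewrite -(@ler_pXn2r _ 2) ?nnegrE ?absS_ge0//.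
by rewrite absS_sqr real_normK ?num_real// lerDl sqr_ge0.
Qed.

Lemma ler_imS x : `|imS x| <= absS x.
Proof.
rewrite -(@ler_pXn2r _ 2) ?nnegrE ?absS_ge0//.
by rewrite absS_sqr real_normK ?num_real// lerDr sqr_ge0.
Qed.

Lemma absS_ler x : absS x <= `|reS x| + `|imS x|.
Proof.
rewrite -(@ler_pXn2r _ 2) ?nnegrE ?absS_ge0 ?addr_ge0//.
rewrite absS_sqr sqrrD !real_normK ?num_real//.
by rewrite lerD2r lerDl mulrn_wge0// mulr_ge0.
Qed.

Lemma reS_integralS (D : set R) (h : R -> K) :
  reS (integralS D h) = \int[lebesgue_measure]_(t in D) reS (h t).
Proof. by rewrite /integralS; case: s h. Qed.

Lemma imS_integralS (D : set R) (h : R -> K) :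
  imS (integralS D h) = \int[lebesgue_measure]_(t in D) imS (h t).
Proof.
rewrite /integralS; case: s h => //= h.
by rewrite /Rintegral integral0.
Qed.

End Scalars.

(** * The convolution algebra of C([0, T]) *)

Section ConvolutionAlgebra.
Variables (R : realType) (s : scalar_kind).
Local Notation K := (scalars R s).
Local Notation leb := (@lebesgue_measure R).

Lemma continuous_addf (f g : R -> R) : continuous f -> continuous g ->
  continuous (fun t => f t + g t).
Proof. by move=> cf cg x; apply: (@continuousD R R^o R f g); [exact: cf|exact: cg]. Qed.

Lemma continuous_subf (f g : R -> R) : continuous f -> continuous g ->
  continuous (fun t => f t - g t).
Proof. by move=> cf cg x; apply: (@continuousB R R^o R f g); [exact: cf|exact: cg]. Qed.

Lemma continuous_mulf (f g : R -> R) : continuous f -> continuous g ->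
  continuous (fun t => f t * g t).
Proof. by move=> cf cg x; apply: (@continuousM R R f g); [exact: cf|exact: cg]. Qed.

Lemma continuous_compf (f g : R -> R) : continuous f -> continuous g ->
  continuous (fun t => f (g t)).
Proof. by move=> cf cg x; apply: (@continuous_comp R R R g f); [exact: cg|exact: cf]. Qed.

Definition reF (f : R -> K) (t : R) : R := reS (f t).
Definition imF (f : R -> K) (t : R) : R := imS (f t).

Definition contS (f : R -> K) := continuous (reF f) /\ continuous (imF f).

Lemma contS_cst (a : K) : contS (fun=> a).
Proof. by split => x; exact: cst_continuous. Qed.

Lemma reFD f g : reF (fun t => f t + g t) = fun t => reF f t + reF g t.
Proof. by apply/funext => t; rewrite /reF reSD. Qed.
Lemma imFD f g : imF (fun t => f t + g t) = fun t => imF f t + imF g t.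
Proof. by apply/funext => t; rewrite /imF imSD. Qed.
Lemma reFM f g :
  reF (fun t => f t * g t) = fun t => reF f t * reF g t - imF f t * imF g t.
Proof. by apply/funext => t; rewrite /reF reSM. Qed.
Lemma imFM f g :
  imF (fun t => f t * g t) = fun t => reF f t * imF g t + imF f t * reF g t.
Proof. by apply/funext => t; rewrite /imF imSM. Qed.

Lemma contSD (f g : R -> K) : contS f -> contS g -> contS (fun t => f t + g t).
Proof.
by move=> [fr fi] [gr gi]; split; rewrite (reFD, imFD); exact: continuous_addf.
Qed.

Lemma contSM (f g : R -> K) : contS f -> contS g -> contS (fun t => f t * g t).
Proof.
move=> [fr fi] [gr gi]; split; rewrite (reFM, imFM);
  by [apply: continuous_subf; exact: continuous_mulf|
      apply: continuous_addf; exact: continuous_mulf].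
Qed.

Lemma contS_ofR (f : R -> R) : continuous f -> contS (fun t => ofR s (f t)).
Proof.
move=> cf; split.
  by rewrite (_ : reF _ = f)//; apply/funext => t; rewrite /reF reS_ofR.
rewrite (_ : imF _ = cst 0); last by apply/funext => t; rewrite /imF imS_ofR.
by move=> x; exact: cst_continuous.
Qed.

Lemma contS_comp (f : R -> K) (g : R -> R) :
  contS f -> continuous g -> contS (fun t => f (g t)).
Proof. by move=> [fr fi] cg; split;
  [exact: (continuous_compf fr)|exact: (continuous_compf fi)]. Qed.

Definition conv (f g : R -> K) (t : R) : K :=
  integralS `[0, t] (fun r => f (t - r) * g r).

Lemma eq_conv (f f' g g' : R -> K) (t : R) :
  (forall r, 0 <= r <= t -> f r = f' r) -> (forall r, 0 <= r <= t -> g r = g' r) ->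
  conv f g t = conv f' g' t.
Proof.
move=> ff gg; apply: scalars_ext; rewrite ?(reS_integralS, imS_integralS);
  apply: eq_Rintegral => r; rewrite inE /= in_itv/= => rt; rewrite ff ?gg//; lra.
Qed.

Lemma reS_conv f g t : contS f -> contS g -> reS (conv f g t) =
  rconv (reF f) (reF g) t - rconv (imF f) (imF g) t.
Proof.
move=> [fr fi] [gr gi]; rewrite reS_integralS /rconv -RintegralB//.
- by apply: eq_Rintegral => r _; rewrite reSM.
- by apply: continuous_integrable; exact: continuous_reflectM.
- by apply: continuous_integrable; exact: continuous_reflectM.
Qed.

Lemma imS_conv f g t : contS f -> contS g -> imS (conv f g t) =
  rconv (reF f) (imF g) t + rconv (imF f) (reF g) t.
Proof.
move=> [fr fi] [gr gi]; rewrite imS_integralS /rconv -RintegralD//.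
- by apply: eq_Rintegral => r _; rewrite imSM.
- by apply: continuous_integrable; exact: continuous_reflectM.
- by apply: continuous_integrable; exact: continuous_reflectM.
Qed.

Lemma reF_conv f g : contS f -> contS g ->
  reF (conv f g) = fun t => rconv (reF f) (reF g) t - rconv (imF f) (imF g) t.
Proof. by move=> cf cg; apply/funext => t; rewrite -reS_conv. Qed.

Lemma imF_conv f g : contS f -> contS g ->
  imF (conv f g) = fun t => rconv (reF f) (imF g) t + rconv (imF f) (reF g) t.
Proof. by move=> cf cg; apply/funext => t; rewrite -imS_conv. Qed.

Lemma conv_contS f g : contS f -> contS g -> contS (conv f g).
Proof.
move=> cf cg; have [fr fi] := cf; have [gr gi] := cg.
split; rewrite (reF_conv, imF_conv)//.
  by apply: continuous_subf; exact: rconv_continuous.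
by apply: continuous_addf; exact: rconv_continuous.
Qed.

Lemma convC f g : contS f -> contS g -> conv f g = conv g f.
Proof.
move=> cf cg; have [fr fi] := cf; have [gr gi] := cg; apply/funext => t.
apply: scalars_ext.
  by rewrite !reS_conv// (rconvC fr gr) (rconvC fi gi).
by rewrite !imS_conv// (rconvC fr gi) (rconvC fi gr) addrC.
Qed.

Lemma rconvDl (f g h : R -> R) : continuous f -> continuous g -> continuous h ->
  rconv (fun t => f t + g t) h = (fun t => rconv f h t + rconv g h t).
Proof.
move=> cf cg ch; apply/funext => t; rewrite /rconv -RintegralD//.
- by apply: eq_Rintegral => r _; rewrite mulrDl.
- by apply: continuous_integrable; exact: continuous_reflectM.
- by apply: continuous_integrable; exact: continuous_reflectM.
Qed.

Lemma rconvBl (f g h : R -> R) : continuous f -> continuous g -> continuous h ->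
  rconv (fun t => f t - g t) h = (fun t => rconv f h t - rconv g h t).
Proof.
move=> cf cg ch; apply/funext => t; rewrite /rconv -RintegralB//.
- by apply: eq_Rintegral => r _; rewrite mulrBl.
- by apply: continuous_integrable; exact: continuous_reflectM.
- by apply: continuous_integrable; exact: continuous_reflectM.
Qed.

Lemma convA f g h : contS f -> contS g -> contS h ->
  conv f (conv g h) = conv (conv f g) h.
Proof.
move=> cf cg ch; have [fr fi] := cf; have [gr gi] := cg; have [hr hi] := ch.
have cfg := conv_contS cf cg; have cgh := conv_contS cg ch.
have cc (a b : R -> R) : continuous a -> continuous b -> continuous (rconv a b).
  exact: rconv_continuous.
have BR (a b c : R -> R) : continuous a -> continuous b -> continuous c ->
    rconv c (fun t => a t - b t) = (fun t => rconv c a t - rconv c b t).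
  move=> ca cb c0; rewrite rconvC//; last exact: continuous_subf.
  by rewrite rconvBl// (rconvC ca)// (rconvC cb).
have DR (a b c : R -> R) : continuous a -> continuous b -> continuous c ->
    rconv c (fun t => a t + b t) = (fun t => rconv c a t + rconv c b t).
  move=> ca cb c0; rewrite rconvC//; last exact: continuous_addf.
  by rewrite rconvDl// (rconvC ca)// (rconvC cb).
have AA (a b c : R -> R) : continuous a -> continuous b -> continuous c ->
    rconv a (rconv b c) = rconv (rconv a b) c.
  by move=> ? ? ?; apply: rconvA => //; exact: cc.
apply/funext => t; apply: scalars_ext.
  rewrite !reS_conv// !reF_conv// !imF_conv// !rconvBl ?rconvDl ?BR ?DR ?AA//; try exact: cc.
  by repeat match goal with |- context [rconv ?a ?b ?t] => generalize (rconv a b t); intro end; ring.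
rewrite !imS_conv// !reF_conv// !imF_conv// !rconvBl ?rconvDl ?BR ?DR ?AA//; try exact: cc.
by repeat match goal with |- context [rconv ?a ?b ?t] => generalize (rconv a b t); intro end; ring.
Qed.

Lemma convDl (f g h : R -> K) t : contS f -> contS g -> contS h ->
  conv (fun t => f t + g t) h t = conv f h t + conv g h t.
Proof.
move=> cf cg ch; have [fr fi] := cf; have [gr gi] := cg; have [hr hi] := ch.
have cfg := contSD cf cg.
apply: scalars_ext.
  by rewrite reSD !reS_conv// reFD imFD !rconvDl//; ring.
by rewrite imSD !imS_conv// reFD imFD !rconvDl//; ring.
Qed.

Lemma integralSZ (a : K) (D : set R) (f : R -> K) : measurable D ->
  leb.-integrable D (EFin \o (reF f)) -> leb.-integrable D (EFin \o (imF f)) ->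
  integralS D (fun t => a * f t) = a * integralS D f.
Proof.
move=> mD fr fi.
have iZ (c : R) (h : R -> R) : leb.-integrable D (EFin \o h) -> leb.-integrable D (EFin \o (fun x => c * h x)).
  move=> hi; rewrite (_ : _ \o _ = fun x => (c%:E * (EFin \o h) x)%E); first exact: integrableZl.
  by apply/funext => x; rewrite /= EFinM.
apply: scalars_ext.
  rewrite reSM !reS_integralS imS_integralS -!RintegralZl// -RintegralB//; [|exact: iZ..].
  by apply: eq_Rintegral => r _; rewrite reSM.
rewrite imSM !imS_integralS reS_integralS -!RintegralZl// -RintegralD//; [|exact: iZ..].
by apply: eq_Rintegral => r _; rewrite imSM.
Qed.

Lemma contS_integrable f a b : contS f ->
  leb.-integrable `[a, b] (EFin \o reF f) /\ leb.-integrable `[a, b] (EFin \o imF f).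
Proof. by move=> [cr ci]; split; exact: continuous_integrable. Qed.

Lemma contS_reflectM f g t : contS f -> contS g -> contS (fun r => f (t - r) * g r).
Proof.
move=> cf cg; apply: contSM => //; apply: contS_comp => //.
by apply: (@continuous_reflect _ id) => x; exact: cvg_id.
Qed.

Lemma convZl (a : K) f g t : contS f -> contS g ->
  conv (fun t => a * f t) g t = a * conv f g t.
Proof.
move=> cf cg; have [i1 i2] := contS_integrable 0 t (contS_reflectM t cf cg).
rewrite /conv -integralSZ//.
by congr integralS; apply/funext => r; rewrite mulrA.
Qed.

End ConvolutionAlgebra.

Section ContinuousFunctions.
Variables (R : realType) (s : scalar_kind) (T : R).
Local Notation K := (scalars R s).

Definition clamp (t : R) : R := Num.max 0 (Num.min t T).

Lemma clamp_id t : 0 <= t <= T -> clamp t = t.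
Proof. by move=> /andP[t0 tT]; rewrite /clamp (min_idPl tT) (max_idPr t0). Qed.

Lemma clamp_ge0 t : 0 <= clamp t.
Proof. by rewrite /clamp le_max lexx. Qed.

Lemma clampP r t : 0 <= r <= clamp t -> clamp r = r.
Proof.
move=> /andP[r0]; rewrite /clamp le_max => /orP[r0'|rT].
  have -> : r = 0 by lra.
  by rewrite maxEle; case: ifP => //; rewrite minElt; case: ifP => // *; lra.
apply: clamp_id; rewrite r0/=; apply: le_trans rT _; rewrite ge_min lexx orbT//.
Qed.

Lemma clampK t : clamp (clamp t) = clamp t.
Proof. by apply: (@clampP _ t); rewrite clamp_ge0 lexx. Qed.

Lemma clamp0 : clamp 0 = 0.
Proof. by apply: (@clampP _ 0); rewrite lexx clamp_ge0. Qed.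

Lemma clamp_itv t : 0 <= T -> 0 <= clamp t <= T.
Proof. by move=> T0; rewrite clamp_ge0 /clamp ge_max T0 ge_min lexx orbT. Qed.

Lemma continuous_clamp : continuous clamp.
Proof.
move=> x; apply: (@continuous_max _ R (fun=> 0) (fun t => Num.min t T)).
  exact: cst_continuous.
by apply: (@continuous_min _ R id (fun=> T)); [exact: cvg_id|exact: cst_continuous].
Qed.

(* C([0, T]), encoded as the continuous functions on the line that are constant
   outside [0, T], so that Leibniz equality is equality on [0, T] *)
Definition cfun_pred : {pred R -> K} :=
  fun f => `[< contS f /\ forall t, f (clamp t) = f t >].

Record cfun := CFun { cfun_val :> R -> K; _ : cfun_val \in cfun_pred }.

HB.instance Definition _ := [isSub for cfun_val].
HB.instance Definition _ := [Choice of cfun by <:].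

Lemma cfunP (f : cfun) : contS f /\ forall t, f (clamp t) = f t.
Proof. by case: f => f /= /asboolP. Qed.

Lemma cfun_contS (f : cfun) : contS f. Proof. by have [] := cfunP f. Qed.

Lemma cfun_clamp (f : cfun) t : f (clamp t) = f t.
Proof. by have [_] := cfunP f. Qed.

Lemma cfun_submod_closed : submod_closed cfun_pred.
Proof.
split.
  by apply/asboolP; split => //; exact: (contS_cst (0 : K)).
move=> a f g /asboolP[cf ef] /asboolP[cg eg]; apply/asboolP; split.
  by apply: contSD => //; apply: contSM => //; exact: contS_cst.
by move=> t; rewrite !fctE ef eg.
Qed.

HB.instance Definition _ :=
  GRing.isSubmodClosed.Build K (R -> K) cfun_pred cfun_submod_closed.
HB.instance Definition _ := [SubChoice_isSubLmodule of cfun by <:].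

Lemma cfun_ext (f g : cfun) : (forall t, 0 <= t <= T -> f t = g t) ->
  0 <= T -> f = g.
Proof.
move=> h T0; apply/val_inj/funext => t /=.
by rewrite -(cfun_clamp f) -(cfun_clamp g); apply: h; exact: clamp_itv.
Qed.

Definition cfun_of_subproof (f : R -> K) (cf : contS f) :
  (fun t => f (clamp t)) \in cfun_pred.
Proof.
apply/asboolP; split; first exact: (contS_comp cf continuous_clamp).
by move=> t; rewrite clampK.
Qed.

Definition cfun_of f (cf : contS f) : cfun := CFun (cfun_of_subproof cf).

Definition cconv (f g : cfun) : cfun :=
  cfun_of (conv_contS (cfun_contS f) (cfun_contS g)).

Lemma cconvE f g t : cconv f g t = conv f g (clamp t). Proof. by []. Qed.

Lemma cfunDE (f g : cfun) t : (f + g) t = f t + g t. Proof. by []. Qed.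
Lemma cfunNE (f : cfun) t : (- f) t = - f t. Proof. by []. Qed.
Lemma cfunZE (a : K) (f : cfun) t : (a *: f) t = a * f t. Proof. by []. Qed.
Lemma cfun0E t : (0 : cfun) t = 0. Proof. by []. Qed.

Lemma cconvC f g : cconv f g = cconv g f.
Proof.
apply/val_inj/funext => t; rewrite /= (convC (cfun_contS f) (cfun_contS g))//.
Qed.

Lemma cconvA f g h : cconv f (cconv g h) = cconv (cconv f g) h.
Proof.
apply/val_inj/funext => t; rewrite /=.
have cf := cfun_contS f; have cg := cfun_contS g; have ch := cfun_contS h.
rewrite (@eq_conv _ _ f f _ (conv g h))//; last by move=> r rt /=; rewrite (clampP rt).
rewrite [RHS](@eq_conv _ _ _ (conv f g) h h)//; last by move=> r rt /=; rewrite (clampP rt).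
by rewrite convA.
Qed.

Lemma cconvDl f g h : cconv (f + g) h = cconv f h + cconv g h.
Proof.
apply/val_inj/funext => t; rewrite /=.
exact: (convDl _ (cfun_contS f) (cfun_contS g) (cfun_contS h)).
Qed.

Lemma cconvZl a f g : cconv (a *: f) g = a *: cconv f g.
Proof.
apply/val_inj/funext => t; rewrite /=.
exact: (convZl a _ (cfun_contS f) (cfun_contS g)).
Qed.

Lemma cconvDr f g h : cconv f (g + h) = cconv f g + cconv f h.
Proof. by rewrite cconvC cconvDl !(cconvC f). Qed.

Lemma cconvZr a f g : cconv f (a *: g) = a *: cconv f g.
Proof. by rewrite cconvC cconvZl cconvC. Qed.

Lemma cconvNl f g : cconv (- f) g = - cconv f g.
Proof. by rewrite -scaleN1r cconvZl scaleN1r. Qed.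

Lemma cconvNr f g : cconv f (- g) = - cconv f g.
Proof. by rewrite cconvC cconvNl cconvC. Qed.

(* the convolution algebra with a unit (the Dirac mass) adjoined:
   (a, f) stands for a delta + f *)
Definition calg := (K * cfun)%type.

HB.instance Definition _ := GRing.Zmodule.on calg.

Definition calg_one : calg := (1, 0).
Definition calg_mul (x y : calg) : calg :=
  (x.1 * y.1, x.1 *: y.2 + y.1 *: x.2 + cconv x.2 y.2).

Lemma calg_mulA : associative calg_mul.
Proof.
move=> [a f] [b g] [c h]; rewrite /calg_mul /=; congr pair; first by rewrite mulrA.
rewrite !(cconvDl, cconvDr, cconvZl, cconvZr) !scalerDr !scalerA cconvA.
by rewrite [c * a]mulrC [c * b]mulrC (AC (4*3) ((1*(2*4*6))*(3*5*7))).
Qed.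

Lemma calg_mulC : commutative calg_mul.
Proof.
move=> [a f] [b g]; rewrite /calg_mul /=; congr pair; first by rewrite mulrC.
by rewrite (addrC (a *: g)) cconvC.
Qed.

Lemma calg_mul1 : left_id calg_one calg_mul.
Proof.
move=> [a f]; rewrite /calg_mul /= mul1r scale1r scaler0 addr0.
by rewrite -(scale0r (0 : cfun)) cconvZl scale0r addr0.
Qed.

Lemma calg_mulDl : left_distributive calg_mul +%R.
Proof.
move=> [a f] [b g] [c h]; rewrite /calg_mul /=; congr pair; first by rewrite mulrDl.
rewrite cconvDl scalerDl scalerDr.
by rewrite /= (AC (2*2*2) ((1*3*5)*(2*4*6))).
Qed.

Lemma calg_one_neq0 : calg_one != 0.
Proof. by apply/eqP => -[/eqP]; rewrite oner_eq0. Qed.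

HB.instance Definition _ := GRing.Zmodule_isComNzRing.Build calg
  calg_mulA calg_mulC calg_mul1 calg_mulDl calg_one_neq0.

End ContinuousFunctions.

(** * Primitives *)

Section Primitives.
Variable R : realType.
Local Notation leb := (@lebesgue_measure R).
Implicit Types F f g : R -> R.

Lemma is_derive_integral (g : R -> R) (t : R) : continuous g -> 0 < t ->
  is_derive t 1 (fun x => \int[leb]_(r in `[0, x]) g r) (g t).
Proof.
move=> cg t0; have tt : t < t + 1 by lra.
have [d e] := continuous_FTC1_closed tt (continuous_integrable 0 (t + 1) cg) t0 (cg t).
by apply: DeriveDef; [exact: d|rewrite -derive1E; exact: e].
Qed.

Definition primR (T : R) F g := forall t : R, 0 <= t <= T ->
  F t = F 0 + \int[leb]_(r in `[0, t]) g r.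

Lemma primR_is_derive (T : R) (F g : R -> R) : continuous g -> primR T F g ->
  forall t : R, 0 < t < T -> is_derive t 1 F (g t).
Proof.
move=> cg Fg t /andP[t0 tT].
have h : is_derive t 1 (fun x => F 0 + \int[leb]_(r in `[0, x]) g r) (g t).
  rewrite -[g t]add0r; apply: is_deriveD; exact: is_derive_integral.
have e : \near t, (fun x => F 0 + \int[leb]_(r in `[0, x]) g r) t = F t.
  near=> x; apply/esym/Fg; apply/andP; split.
    by near: x; apply: (filterS (fun y (hy : 0 < y) => ltW hy)); exact: lt_nbhsr.
  by near: x; apply: (filterS (fun y (hy : y < T) => ltW hy)); exact: lt_nbhsl.
exact: (@near_eq_is_derive R R^o R^o _ F t 1 (g t) e h).
Unshelve. all: by end_near. Qed.

Lemma primR_intro (T : R) (F g : R -> R) : continuous F -> continuous g ->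
  (forall t : R, 0 < t < T -> is_derive t 1 F (g t)) -> primR T F g.
Proof.
move=> cF cg d t /andP[]; rewrite le_eqVlt => /predU1P[<- _|t0 tT].
  by rewrite set_itv1 Rintegral_set1 addr0.
have dd x : x \in `]0, t[ -> is_derive x 1 F (g x).
  by rewrite in_itv/= => /andP[? ?]; apply: d; lra.
have := @continuous_FTC2 R g F 0 t t0 (continuous_subspaceT cg).
rewrite /Rintegral => -> //=.
- by rewrite [RHS]addrC subrK.
- split; first by move=> x /dd[].
    by apply: cvg_at_right_filter; exact: cF.
  by apply: cvg_at_left_filter; exact: cF.
- by move=> x /dd h; rewrite derive1E; exact: derive_val.
Qed.

Lemma primRM (T : R) (F G f g : R -> R) : continuous F -> continuous G -> continuous f ->
  continuous g -> primR T F f -> primR T G g ->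
  primR T (fun t => F t * G t) (fun t => f t * G t + F t * g t).
Proof.
move=> cF cG cf cg Ff Gg; apply: primR_intro.
- exact: continuous_mulf.
- by apply: continuous_addf; exact: continuous_mulf.
move=> t tT; have dF := primR_is_derive cf Ff tT; have dG := primR_is_derive cg Gg tT.
have := is_deriveM dF dG.
rewrite (_ : F t *: g t + G t *: f t = f t * G t + F t * g t)//.
by rewrite /GRing.scale /= addrC mulrC.
Qed.

Lemma primRD (T : R) (F G f g : R -> R) : continuous f -> continuous g ->
  primR T F f -> primR T G g ->
  primR T (fun t => F t + G t) (fun t => f t + g t).
Proof.
move=> cf cg Ff Gg t tT; rewrite Ff// Gg// RintegralD//; [ring|exact: continuous_integrable..].
Qed.

Lemma primRB (T : R) (F G f g : R -> R) : continuous f -> continuous g ->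
  primR T F f -> primR T G g ->
  primR T (fun t => F t - G t) (fun t => f t - g t).
Proof.
move=> cf cg Ff Gg t tT; rewrite Ff// Gg// RintegralB//; [ring|exact: continuous_integrable..].
Qed.

Lemma integral_expR (l t : R) : 0 < l -> 0 <= t ->
  \int[leb]_(r in `[0, t]) expR (l * r) = (expR (l * t) - 1) / l.
Proof.
move=> l0 t0.
have dl (x : R) : is_derive x 1 (fun r => expR (l * r) / l) (expR (l * x)).
  have -> : expR (l * x) = (l * expR (l * x)) / l by rewrite mulrAC divff ?mul1r// gt_eqF.
  have h1 : is_derive x 1 (fun r : R => l * r) l.
    by rewrite -{2}[l]mulr1; exact: (@is_deriveZ _ _ _ id l x 1 1 _).
  have h2 : is_derive x 1 (fun r : R => expR (l * r)) (l * expR (l * x)).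
    rewrite mulrC; exact: (@is_derive1_comp _ expR (fun r : R => l * r) x _ _ (is_derive_expR _) h1).
  rewrite mulrC; under eq_fun do rewrite mulrC.
  exact: (@is_deriveZ _ _ _ (fun r : R => expR (l * r)) l^-1 x 1 _ h2).
have cF : continuous (fun r : R => expR (l * r)).
  apply: continuous_compf; first exact: continuous_expR.
  by apply: continuous_mulf; [exact: cst_continuous|move=> x; exact: cvg_id].
have cl : continuous (fun r : R => expR (l * r) / l).
  by apply: continuous_mulf => //; exact: cst_continuous.
have := @primR_intro t _ _ cl cF (fun x _ => dl x) t.
have tt : 0 <= t <= t by rewrite t0 lexx.
move=> /(_ tt); rewrite mulr0 expR0 mulrBl => ->; ring.
Qed.

Lemma normal_series_limit (c : R) (g_ : nat -> R -> R) :
  (forall n, continuous (g_ n)) -> (forall n x, `|g_ n x| <= c / 2 ^+ n) ->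
  exists2 G : R -> R, continuous G &
    forall n x, `|G x - \sum_(j < n) g_ j x| <= 2 * c / 2 ^+ n.
Proof.
move=> cg gc.
have c0 : 0 <= c by have := gc 0%N 0; rewrite expr0 divr1; apply: le_trans.
have p2 n : (0 : R) < 2 ^+ n by rewrite exprn_gt0.
have tail k n x : `|\sum_(j < n + k) g_ j x - \sum_(j < n) g_ j x| <= 2 * c / 2 ^+ n - 2 * c / 2 ^+ (n + k).
  elim: k => [|k ih]; first by rewrite addn0 !subrr normr0.
  rewrite addnS big_ord_recr /= addrAC; apply: le_trans (ler_normD _ _) _.
  apply: le_trans (lerD ih (gc _ _)) _.
  rewrite exprS invfM; have := p2 (n + k)%N; lra.
have tl n m x : (n <= m)%N -> `|\sum_(j < m) g_ j x - \sum_(j < n) g_ j x| <= 2 * c / 2 ^+ n.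
  move=> nm; rewrite -(subnKC nm); apply: le_trans (tail _ _ _) _.
  by rewrite gerDl oppr_le0 divr_ge0 ?mulr_ge0// ltW.
have geo : (fun n : nat => 2 * c / 2 ^+ n) @ \oo --> (0 : R).
  rewrite -(mulr0 (2 * c)); apply: cvgMr.
  under eq_fun do rewrite -exprVn.
  by apply: cvg_expr; rewrite ger0_norm ?invr_ge0//; lra.
have cv x : cvgn (fun n => \sum_(j < n) g_ j x).
  rewrite (_ : (fun n => _) = series (fun j => g_ j x)); last first.
    by apply/funext => n; rewrite /series /= big_mkord.
  apply: normed_cvg; apply: (@series_le_cvg _ _ (geometric c 2^-1)) => //.
  - by move=> n; rewrite /=.
  - by move=> n; rewrite /geometric/= mulr_ge0// exprn_ge0// invr_ge0.
  - by move=> n; rewrite /geometric/= exprVn; exact: gc.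
  - by apply: is_cvg_geometric_series; rewrite ger0_norm ?invr_ge0//; lra.
pose G x := limn (fun n => \sum_(j < n) g_ j x).
have Gb n x : `|G x - \sum_(j < n) g_ j x| <= 2 * c / 2 ^+ n.
  apply/ler_addgt0Pr => e e0.
  have /cvgrPdist_lt /(_ e e0) [N _ hN] : (fun m : nat => \sum_(j < m) g_ j x) @ \oo --> G x by exact: cv.
  have h1 := hN (maxn N n) (leq_maxl _ _); have h2 := tl n (maxn N n) x (leq_maxr _ _).
  rewrite -(subrKA (\sum_(j < maxn N n) g_ j x)).
  by apply: le_trans (ler_normD _ _) _; rewrite addrC; apply: lerD => //; exact: ltW.
exists G => //.
move=> x; apply/cvgrPdist_lt => e e0.
have [N _ hN] : \forall n \near \oo, 2 * c / 2 ^+ n < e / 3.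
  have /cvgrPdist_lt /(_ (e / 3)) := geo; move=> h.
  have /h : 0 < e / 3 by lra.
  apply: filterS => n; rewrite sub0r normrN; apply: le_lt_trans; exact: ler_norm.
have cs : continuous (fun x => \sum_(j < N) g_ j x).
  elim: (N) => [|n ih].
    by under eq_fun do rewrite big_ord0; exact: cst_continuous.
  by under eq_fun do rewrite big_ord_recr /=; exact: continuous_addf.
have /cvgrPdist_lt /(_ (e / 3)) := cs x.
have e3 : 0 < e / 3 by lra.
move=> /(_ e3); apply: filterS => y hy.
have h1 := Gb N x; have h2 := Gb N y; have h3 := hN N (leqnn N).
move: h1 h2 h3 hy => /=; set A := \sum_(j < N) g_ j x; set B := \sum_(j < N) g_ j y.
rewrite !ler_norml !ltr_norml => /andP[? ?] /andP[? ?] ? /andP[? ?]; apply/andP; split; lra.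
Qed.

End Primitives.

Section ScalarPrimitives.
Variables (R : realType) (s : scalar_kind).
Local Notation K := (scalars R s).
Local Notation leb := (@lebesgue_measure R).
Implicit Types f g F G : R -> K.

Lemma continuous_diffquot (T : R) (F g : R -> R) (t e : R) :
  continuous F -> continuous g -> primR T F g -> 0 <= t <= T -> 0 < e ->
  exists2 d : R, 0 < d & forall h, h != 0 -> `|h| < d -> 0 <= t + h <= T ->
    `|g t - h^-1 * (F (t + h) - F t)| < e.
Proof.
move=> cF cg Fg tT e0.
have /cvgrPdist_lt /(_ e e0) := cg t.
move=> /nbhs_ballP [d /= d0 hd]; exists d => // h h0 hlt thT.
have dF x : 0 < x < T -> is_derive x 1 F (g x) by exact: primR_is_derive.
have MV a b : a < b -> 0 <= a -> b <= T -> exists2 c, a < c < b & F b - F a = g c * (b - a).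
  move=> ab a0 bT.
  have [|| c + ->] := @MVT R F g a b ab.
  - by move=> x; rewrite in_itv/= => xab; apply: dF; lra.
  - exact: continuous_subspaceT.
  by rewrite in_itv/= => cab; exists c.
have [hn|hp|h00] := ltgtP h 0; last by rewrite h00 eqxx in h0.
  have [|||c cab E] := MV (t + h) t; [lra|lra|lra|].
  have -> : h^-1 * (F (t + h) - F t) = g c by rewrite -opprB E; field.
  by apply: hd; rewrite /ball /= ltr_norml; move: hlt; rewrite ltr_norml; lra.
have [|||c cab E] := MV t (t + h); [lra|lra|lra|].
have -> : h^-1 * (F (t + h) - F t) = g c by rewrite E; field.
by apply: hd; rewrite /ball /= ltr_norml; move: hlt; rewrite ltr_norml; lra.
Qed.

Definition prim (T : R) f g := primR T (reF f) (reF g) /\ primR T (imF f) (imF g).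

Lemma primP (T : R) f g : prim T f g <->
  forall t, 0 <= t <= T -> f t = f 0 + integralS `[0, t] g.
Proof.
split=> [[h1 h2] t tT|h].
  apply: scalars_ext; rewrite (reSD, imSD) (reS_integralS, imS_integralS).
    exact: h1.
  exact: h2.
split=> t /h => [/(congr1 (@reS R s))|/(congr1 (@imS R s))].
  by rewrite reSD reS_integralS.
by rewrite imSD imS_integralS.
Qed.

Lemma primM (T : R) F G f g : contS F -> contS G -> contS f -> contS g ->
  prim T F f -> prim T G g ->
  prim T (fun t => F t * G t) (fun t => f t * G t + F t * g t).
Proof.
move=> [Fr Fi] [Gr Gi] [fr fi] [gr gi] [h1 h2] [h3 h4]; split.
  rewrite reFM reFD !reFM.
  rewrite (_ : (fun t => reF f t * reF G t - imF f t * imF G t + _) =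
     fun t => (reF f t * reF G t + reF F t * reF g t) -
     (imF f t * imF G t + imF F t * imF g t)); last by apply/funext => t; ring.
  by apply: primRB; [apply: continuous_addf; exact: continuous_mulf..| |]; exact: primRM.
rewrite imFM imFD !imFM.
rewrite (_ : (fun t => reF f t * imF G t + imF f t * reF G t + _) =
     fun t => (reF f t * imF G t + reF F t * imF g t) +
   (imF f t * reF G t + imF F t * reF g t)); last by apply/funext => t; ring.
by apply: primRD; [apply: continuous_addf; exact: continuous_mulf..| |]; exact: primRM.
Qed.

Lemma is_deriv_onP (V : normedModType K) (T : R) (f : R -> V) (t : R) (l : V) :
  is_deriv_on T f t l <->
  forall e : R, 0 < e -> exists2 d : R, 0 < d &
    forall h : R, h != 0 -> `|h| < d -> 0 <= t + h <= T ->
      rnorm (l - ofR s h^-1 *: (f (t + h) - f t)) < e.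
Proof.
split.
  move=> /rnorm_cvgP H e /H /nbhs_ballP [d /= d0 hd]; exists d => // h h0 hd' thT.
  by apply: hd => //=; rewrite /ball /= sub0r normrN.
move=> H; apply/rnorm_cvgP => e /H [d d0 hd]; apply/nbhs_ballP; exists d => //= h.
rewrite /ball /= sub0r normrN => hd' h0 thT; exact: hd.
Qed.

Lemma prim_is_deriv_on (T : R) F f : contS F -> contS f -> prim T F f ->
  forall t, 0 <= t <= T -> @is_deriv_on R s K^o T F t (f t).
Proof.
move=> [Fr Fi] [fr fi] [h1 h2] t tT; apply/is_deriv_onP => e e0.
have e2 : 0 < e / 2 by lra.
have [d1 d10 hd1] := continuous_diffquot Fr fr h1 tT e2.
have [d2 d20 hd2] := continuous_diffquot Fi fi h2 tT e2.
exists (Num.min d1 d2); first by rewrite lt_min d10.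
move=> h h0; rewrite lt_min => /andP[hh1 hh2] thT.
rewrite rnormE; apply: le_lt_trans (absS_ler _) _.
have := hd1 h h0 hh1 thT; have := hd2 h h0 hh2 thT; rewrite /reF /imF.
rewrite /GRing.scale /= !raddfB /= reS_ofRM imS_ofRM !raddfB /=.
lra.
Qed.

Lemma is_deriv_on_continuous (V : normedModType K) (T : R) (f : R -> V) (t : R) (l : V) :
  is_deriv_on T f t l -> forall e : R, 0 < e -> exists2 d : R, 0 < d &
    forall x : R, `|x - t| < d -> 0 <= x <= T -> rnorm (f x - f t) < e.
Proof.
move=> /is_deriv_onP H e e0; have [d d0 hd] := H 1 ltr01.
have l0 := rnorm_ge0 l.
exists (Num.min d (e / (rnorm l + 1))).
  by rewrite lt_min d0 divr_gt0//; lra.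
move=> x; rewrite lt_min => /andP[xd xe] xT.
have [->|xt] := eqVneq x t; first by rewrite subrr rnorm0.
have h0 : x - t != 0 by rewrite subr_eq0.
have := hd (x - t) h0 xd; rewrite [t + _]addrC subrK => /(_ xT) hh.
have hk0 : 0 < `|x - t| by rewrite normr_gt0.
have -> : f x - f t = ofR s (x - t) *: (ofR s (x - t)^-1 *: (f x - f t)).
  by rewrite scalerA -rmorphM divff// rmorph1 scale1r.
rewrite rnormZ absS_ofR.
have : rnorm (ofR s (x - t)^-1 *: (f x - f t)) < rnorm l + 1.
  rewrite -{1}[X in rnorm X](subKr l); apply: le_lt_trans (ler_rnormD _ _) _.
  by rewrite rnormN; lra.
move: xe; rewrite ltr_pdivlMr; last by lra.
set a := `|x - t| in hk0 *; set b := rnorm _ ; set c := rnorm l + 1 => h1 h2.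
have b0 : 0 <= b by exact: rnorm_ge0.
by apply: le_lt_trans h1; rewrite ler_pM2l//; exact: ltW.
Qed.

Lemma contS_eps f : (forall t (e : R), 0 < e -> exists2 d : R, 0 < d &
    forall x : R, `|x - t| < d -> absS (f x - f t) < e) <-> contS f.
Proof.
split=> [H|[fr fi] t e e0].
  split=> t; apply/cvgrPdist_lt => e /(H t)[d d0 hd]; apply/nbhs_ballP; exists d => //= x;
    rewrite /ball /= distrC => /hd xd; apply: le_lt_trans xd; rewrite distrC.
    by rewrite /reF -raddfB; exact: ler_reS.
  by rewrite /imF -raddfB; exact: ler_imS.
have e2 : 0 < e / 2 by lra.
have /cvgrPdist_lt /(_ _ e2) /nbhs_ballP [d1 /= d10 hd1] := fr t.
have /cvgrPdist_lt /(_ _ e2) /nbhs_ballP [d2 /= d20 hd2] := fi t.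
exists (Num.min d1 d2); first by rewrite lt_min d10.
move=> x; rewrite lt_min distrC => /andP[/hd1 + /hd2]; rewrite /reF /imF.
rewrite -!raddfB => h1 h2; rewrite -absSN opprB; apply: le_lt_trans (absS_ler _) _; lra.
Qed.

Lemma clamp_lip (T x y : R) : `|clamp T x - clamp T y| <= `|x - y|.
Proof.
rewrite /clamp /Num.max /Num.min; do 4 (case: ifP); rewrite ?ler_norml //; case: (ger0P (x - y)); lra.
Qed.

Lemma deriv_on_contS (T : R) f f' : 0 <= T ->
  (forall t, 0 <= t <= T -> @is_deriv_on R s K^o T f t (f' t)) ->
  contS (fun t => f (clamp T t)).
Proof.
move=> T0 df; apply/contS_eps => t e e0.
have ct := clamp_itv t T0.
have [d d0 hd] := is_deriv_on_continuous (df _ ct) e0.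
exists d => // x xt; apply: hd; last exact: clamp_itv.
exact: le_lt_trans (clamp_lip _ _ _) xt.
Qed.

Lemma deriv_on_prim (T : R) f f' : 0 <= T ->
  (forall t, 0 <= t <= T -> @is_deriv_on R s K^o T f t (f' t)) ->
  contS (fun t => f' (clamp T t)) ->
  prim T (fun t => f (clamp T t)) (fun t => f' (clamp T t)).
Proof.
move=> T0 df [cr ci]; have [Fr Fi] := deriv_on_contS T0 df.
have main (p : K -> R) (pB : forall x y, p (x - y) = p x - p y)
    (pZ : forall a x, p (ofR s a * x) = a * p x) (pl : forall x, `|p x| <= absS x)
    t : 0 < t < T -> is_derive t 1 (fun t => p (f (clamp T t))) (p (f' (clamp T t))).
  move=> tT; have tT' : 0 <= t <= T by lra.
  have /is_deriv_onP H := df t tT'.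
  have cv : (fun h => h^-1 *: (((fun t => p (f (clamp T t))) \o shift t) (h *: (1:R)) - p (f (clamp T t)))) @ (0:R)^' -->
       p (f' (clamp T t)).
    apply/cvgrPdist_lt => e /H[d d0 hd].
    apply/nbhs_ballP; exists (Num.min d (Num.min t (T - t))); first by rewrite /= !lt_min d0; lra.
    move=> h /=; rewrite /ball /= sub0r normrN !lt_min => /and3P[hd' ht hT] h0.
    have thT : 0 <= t + h <= T by move: ht hT; rewrite !ltr_norml; lra.
    have := hd h h0 hd' thT; rewrite rnormE; apply: le_lt_trans.
    rewrite /GRing.scale /= mulr1 [h + t]addrC !clamp_id//.
    by rewrite -pB -pZ -pB; exact: pl.
  apply: DeriveDef; first by apply/cvg_ex; exists (p (f' (clamp T t))).
  exact/cvg_lim.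
split; apply: primR_intro => //.
  apply: (main (@reS R s)) => [x y|a x|x]; [by rewrite reSD reSN| |exact: ler_reS].
  exact: reS_ofRM.
apply: (main (@imS R s)) => [x y|a x|x]; [by rewrite imSD imSN| |exact: ler_imS].
exact: imS_ofRM.
Qed.

Lemma contS_absS f : contS f -> continuous (fun t => absS (f t)).
Proof.
move=> [fr fi].
rewrite (_ : (fun t => _) = fun t => Num.sqrt (reF f t * reF f t + imF f t * imF f t)).
  by apply: continuous_compf; [exact: sqrt_continuous|
    apply: continuous_addf; exact: continuous_mulf].
by apply/funext => t; rewrite -!expr2 -absS_sqr sqrtr_sqr ger0_norm// absS_ge0.
Qed.

Lemma absS_integralS f (a b : R) : contS f ->
  absS (integralS `[a, b] f) <= \int[leb]_(r in `[a, b]) absS (f r).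
Proof.
move=> cf; set I := integralS _ _; set J := \int[leb]_(r in _) _.
have [->|I0] := eqVneq (absS I) 0; first by apply: Rintegral_ge0 => *; exact: absS_ge0.
have Ip : 0 < absS I by rewrite lt_neqAle eq_sym I0 absS_ge0.
rewrite -(ler_pM2l Ip) -expr2.
have -> : absS I ^+ 2 = reS (conjS R s I * I) by rewrite mulrC mulS_conj reS_ofR.
have cc := contSM (contS_cst (conjS R s I)) cf.
have [i1 i2] := contS_integrable a b cf.
have [i3 i4] := contS_integrable a b cc.
rewrite /I -integralSZ// reS_integralS -/I -RintegralZl//; last first.
  by apply: continuous_integrable; exact: contS_absS.
apply: le_Rintegral => //.
  apply: continuous_integrable; apply: continuous_mulf; first exact: cst_continuous.
  exact: contS_absS.
move=> x _; apply: le_trans (ler_norm _) _; apply: le_trans (ler_reS _) _.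
by rewrite absSM absS_conj.
Qed.

End ScalarPrimitives.

(** * Inversion and square root in the convolution algebra *)

Section Vanishing.
Variables (R : realType) (s : scalar_kind) (T : R).
Hypothesis T0 : 0 < T.
Local Notation K := (scalars R s).
Local Notation C := (cfun s T).
Local Notation A := (calg s T).
Local Notation leb := (@lebesgue_measure R).

Definition ccst (a : K) : C := cfun_of T (contS_cst a).
Definition inC (f : C) : A := (0, f).
Definition scal (a : K) : A := (a, 0).

Lemma inC_is_zmod_morphism : zmod_morphism inC.
Proof. by move=> f g; rewrite /inC; congr pair; rewrite subrr. Qed.
HB.instance Definition _ := GRing.isZmodMorphism.Build C A inC inC_is_zmod_morphism.

Lemma inCM f g : inC f * inC g = inC (cconv f g).
Proof. by congr pair; rewrite /= ?mulr0// !scale0r !add0r. Qed.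

Lemma cconv0 (f : C) : cconv f 0 = 0.
Proof. by rewrite -[in LHS](scale0r (0 : C)) cconvZr scale0r. Qed.

Lemma scal_inC a f : scal a * inC f = inC (a *: f).
Proof. by congr pair; rewrite /= ?mulr0// cconvC cconv0 scaler0 !addr0. Qed.

Lemma scal_is_zmod_morphism : zmod_morphism scal.
Proof. by move=> a b; rewrite /scal; congr pair; rewrite /= subrr. Qed.

Lemma scal_is_monoid_morphism : monoid_morphism scal.
Proof.
split=> // a b; congr pair.
by rewrite /= !scaler0 cconv0 !addr0.
Qed.
HB.instance Definition _ := GRing.isZmodMorphism.Build K A scal scal_is_zmod_morphism.
HB.instance Definition _ := GRing.isMonoidMorphism.Build K A scal scal_is_monoid_morphism.

Lemma inC_inj : injective inC. Proof. by move=> f g []. Qed.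

Lemma calgE (x : A) : x = scal x.1 + inC x.2.
Proof. by case: x => a f; congr pair; rewrite /= ?addr0 ?add0r. Qed.

Definition nb (f : C) (c : R) := forall t, 0 <= t <= T -> absS (f t) <= c.

Lemma nb_ge0 f c : nb f c -> 0 <= c.
Proof. by move=> /(_ 0); rewrite lexx ltW// => /(_ isT); apply: le_trans; exact: absS_ge0. Qed.

Lemma nb_exists f : exists2 c, 0 <= c & nb f c.
Proof.
have [c c0 hc] := continuous_bounded 0 T (contS_absS (cfun_contS f)).
by exists c => // t /hc; apply: le_trans; rewrite ler_norm.
Qed.

Lemma nb_le f c d : c <= d -> nb f c -> nb f d.
Proof. by move=> cd h t /h; move/le_trans; apply. Qed.

Lemma nbD f g c d : nb f c -> nb g d -> nb (f + g) (c + d).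
Proof. by move=> h1 h2 t tT; apply: le_trans (absSD _ _) _; apply: lerD; [exact: h1|exact: h2]. Qed.

Lemma nbN f c : nb f c -> nb (- f) c.
Proof. by move=> h t tT; rewrite cfunNE absSN; exact: h. Qed.

Lemma nbZ a f c : nb f c -> nb (a *: f) (absS a * c).
Proof. by move=> h t tT; rewrite cfunZE absSM ler_wpM2l ?absS_ge0//; exact: h. Qed.

Lemma nb0 : nb 0 0.
Proof. by move=> t _; rewrite cfun0E absS0. Qed.

Lemma nb_eq0 f : nb f 0 -> f = 0.
Proof.
move=> h; apply: cfun_ext; last exact: ltW.
move=> t /h; rewrite cfun0E => a0; apply: absS_eq0; apply/eqP.
by rewrite eq_le a0 absS_ge0.
Qed.

Definition nbw (l : R) (f : C) (c : R) :=
  forall t, 0 <= t <= T -> absS (f t) <= c * expR (l * t).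

Lemma cconv_abs (f g : C) (t : R) : 0 <= t <= T -> absS (cconv f g t) <=
  \int[leb]_(r in `[0, t]) (absS (f (t - r)) * absS (g r)).
Proof.
move=> tT; rewrite cconvE clamp_id//.
apply: le_trans (absS_integralS _ _ _) _.
  by apply: contS_reflectM; exact: cfun_contS.
by rewrite le_eqVlt; apply/orP; left; apply/eqP; apply: eq_Rintegral => r _; rewrite absSM.
Qed.

Lemma nbw_conv l m f g c : 0 < l -> 0 <= c -> nb f m -> nbw l g c ->
  nbw l (cconv f g) (m * c / l).
Proof.
move=> l0 c0 hf hg t tT; apply: le_trans (cconv_abs _ _ tT) _.
have m0 := nb_ge0 hf.
have cE : continuous (fun r => expR (l * r)).
  apply: continuous_compf; first exact: continuous_expR.
  by apply: continuous_mulf; [exact: cst_continuous|move=> x; exact: cvg_id].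
apply: (@le_trans _ _ (\int[leb]_(r in `[0, t]) (m * c * expR (l * r)))).
  apply: le_Rintegral => //.
  - apply: continuous_integrable; apply: continuous_mulf; last first.
      exact: contS_absS (cfun_contS g).
    apply: (@continuous_reflect _ (fun x => absS (f x))).
    exact: contS_absS (cfun_contS f).
  - apply: continuous_integrable; apply: continuous_mulf => //; exact: cst_continuous.
  - move=> r /=; rewrite in_itv/= => rt; rewrite -mulrA; apply: ler_pM; rewrite ?absS_ge0//.
      by apply: hf; lra.
    by apply: hg; lra.
rewrite RintegralZl//; last exact: continuous_integrable.
rewrite integral_expR//; last by lra.
rewrite mulrA [leRHS]mulrAC; apply: ler_wpM2r; first by rewrite invr_ge0 ltW.
by apply: ler_wpM2l; [rewrite mulr_ge0|lra].
Qed.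

Lemma nb_conv f g m c : nb f m -> nb g c -> nb (cconv f g) (T * m * c).
Proof.
move=> hf hg t tT; apply: le_trans (cconv_abs _ _ tT) _.
have m0 := nb_ge0 hf; have c0 := nb_ge0 hg.
apply: (@le_trans _ _ (\int[leb]_(r in `[0, t]) (m * c))).
  apply: le_Rintegral => //.
  - apply: continuous_integrable; apply: continuous_mulf; last first.
      exact: contS_absS (cfun_contS g).
    apply: (@continuous_reflect _ (fun x => absS (f x))).
    exact: contS_absS (cfun_contS f).
  - apply: continuous_integrable; exact: cst_continuous.
  - move=> r /=; rewrite in_itv/= => rt; apply: ler_pM; rewrite ?absS_ge0//.
      by apply: hf; lra.
    by apply: hg; lra.
rewrite Rintegral_cst//= lebesgue_measure_itv/= lte_fin.
rewrite -[leRHS]mulrA [leRHS]mulrC; apply: ler_wpM2l; first by rewrite mulr_ge0.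
by case: ifP => _; rewrite /= ?oppr0 ?addr0; lra.
Qed.

Definition nbA (x : A) (c : R) := absS x.1 <= c /\ nb x.2 c.

Lemma nbA_ge0 x c : nbA x c -> 0 <= c. Proof. by move=> [_ /nb_ge0]. Qed.

Lemma nbA_le x c d : c <= d -> nbA x c -> nbA x d.
Proof. by move=> cd [h1 h2]; split; [exact: le_trans h1 cd|exact: nb_le h2]. Qed.

Lemma nbAD x y c d : nbA x c -> nbA y d -> nbA (x + y) (c + d).
Proof.
move=> [h1 h2] [h3 h4]; split; last exact: nbD.
by apply: le_trans (absSD _ _) _; exact: lerD.
Qed.

Lemma nbAN x c : nbA x c -> nbA (- x) c.
Proof. by move=> [h1 h2]; split; [rewrite absSN|exact: nbN]. Qed.

Lemma nbA0 : nbA 0 0. Proof. by split; [rewrite absS0|exact: nb0]. Qed.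

Lemma nbA_exists x : exists2 c, 0 <= c & nbA x c.
Proof.
have [c c0 h] := nb_exists x.2; exists (Num.max c (absS x.1)).
  by rewrite le_max c0.
by split; [rewrite le_max lexx orbT|apply: nb_le h; rewrite le_max lexx].
Qed.

Lemma nbA_inC f c : nb f c -> nbA (inC f) c.
Proof. by move=> h; split => //; rewrite absS0; exact: nb_ge0 h. Qed.

Lemma nbAM x y c d : nbA x c -> nbA y d -> nbA (x * y) ((2 + T) * (c * d)).
Proof.
move=> hx hy; have c0 := nbA_ge0 hx; have d0 := nbA_ge0 hy.
have cd0 : 0 <= c * d by rewrite mulr_ge0.
have T00 := ltW T0.
case: hx => h1 h2; case: hy => h3 h4; split.
  rewrite absSM; apply: le_trans (ler_pM (absS_ge0 _) (absS_ge0 _) h1 h3) _.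
  by rewrite mulrDl mulr2n mulrDl mul1r -addrA lerDl addr_ge0// mulr_ge0.
rewrite mulrDl mulr2n mulrDl mul1r; apply: nbD; last first.
  by rewrite mulrA; exact: nb_conv.
apply: nbD.
  apply: nb_le (nbZ x.1 h4); exact: ler_wpM2r.
by apply: nb_le (nbZ y.1 h2); rewrite mulrC; exact: ler_wpM2l.
Qed.

Lemma nbA_eq0 x : nbA x 0 -> x = 0.
Proof.
case: x => a f [/= h1 h2]; rewrite (nb_eq0 h2); congr pair.
by apply: absS_eq0; apply/eqP; rewrite eq_le h1 absS_ge0.
Qed.

Definition vanish (x : nat -> A) := exists c, forall n, nbA (x n) (c / 2 ^+ n).

Lemma eq_vanish x y : x =1 y -> vanish x -> vanish y.
Proof. by move=> /funext ->. Qed.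

Lemma vanishD x y : vanish x -> vanish y -> vanish (fun n => x n + y n).
Proof. by move=> [c hc] [d hd]; exists (c + d) => n; rewrite mulrDl; exact: nbAD. Qed.

Lemma vanishN x : vanish x -> vanish (fun n => - x n).
Proof. by move=> [c hc]; exists c => n; exact: nbAN. Qed.

Lemma vanishB x y : vanish x -> vanish y -> vanish (fun n => x n - y n).
Proof. by move=> hx hy; apply: vanishD => //; exact: vanishN. Qed.

Lemma vanishM_bounded x y : vanish x -> (exists c, forall n, nbA (y n) c) ->
  vanish (fun n => y n * x n).
Proof.
move=> [c hc] [d hd]; exists ((2 + T) * (d * c)) => n.
by rewrite -!mulrA; exact: nbAM.
Qed.

Lemma vanishM x y : vanish x -> vanish (fun n => y * x n).
Proof.
move=> hx; apply: (vanishM_bounded hx); have [c _ h] := nbA_exists y.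
by exists c.
Qed.

Lemma vanish_bounded x : vanish x -> exists c, forall n, nbA (x n) c.
Proof.
move=> [c hc]; exists c => n; apply: nbA_le (hc n).
have c0 : 0 <= c by have := nbA_ge0 (hc 0%N); rewrite expr0 divr1.
by rewrite ler_pdivrMr ?exprn_gt0// ler_peMr// exprn_ege1// ler1n.
Qed.

Lemma vanish_shift x k : vanish (fun n => x (n + k)%N) <-> vanish x.
Proof.
split=> -[c hc].
  elim: k c hc => [|k ih] c hc; first by exists c => n; have := hc n; rewrite addn0.
  have [d d0 hd] := nbA_exists (x k).
  apply: (ih (2 * c + d)) => -[|n].
    rewrite add0n expr0 divr1; apply: nbA_le hd; rewrite lerDr mulr_ge0//.
    by have := nbA_ge0 (hc 0%N); rewrite expr0 divr1.
  rewrite addSnnS; apply: nbA_le (hc n).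
  rewrite exprS invfM mulrA; apply: ler_wpM2r; first by rewrite invr_ge0 exprn_ge0.
  lra.
exists c => n; apply: nbA_le (hc (n + k)%N).
have c0 : 0 <= c by have := nbA_ge0 (hc 0%N); rewrite expr0 divr1.
apply: ler_wpM2l => //; rewrite lef_pV2 ?posrE ?exprn_gt0//.
by apply: ler_weXn2l; [rewrite ler1n|exact: leq_addr].
Qed.

Lemma vanish_cst x : vanish (fun=> x) -> x = 0.
Proof.
move=> [c hc]; have c0 : 0 <= c by have := nbA_ge0 (hc 0%N); rewrite expr0 divr1.
have le0 (d : R) : (forall n, d <= c / 2 ^+ n) -> d <= 0.
  move=> h; rewrite leNgt; apply/negP => d0.
  have := cvg_geometric c (_ : `|2^-1| < 1 :> R).
  rewrite ger0_norm ?invr_ge0// => /(_ _)/cvgrPdist_lt/(_ d d0).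
  have h2 : 2^-1 < 1 :> R by lra.
  move=> /(_ h2)[N _ /(_ N (leqnn N))]; rewrite /geometric /= sub0r normrN exprVn.
  move=> /(le_lt_trans (ler_norm _)); have := h N; lra.
apply: nbA_eq0; split; first by apply: le0 => n; have [] := hc n.
by move=> t tT; apply: le0 => n; have [_] := hc n; exact.
Qed.

Lemma series_limit (c : R) (f_ : nat -> C) : (forall n, nb (f_ n) (c / 2 ^+ n)) ->
  exists F : C, vanish (fun n => inC F - \sum_(j < n) inC (f_ j)) /\
    forall n, nb (F - \sum_(j < n) f_ j) (4 * c / 2 ^+ n).
Proof.
move=> hf.
have ct := clamp_itv _ (ltW T0).
have cr n : continuous (reF (f_ n)) by have [] := cfun_contS (f_ n).
have ci n : continuous (imF (f_ n)) by have [] := cfun_contS (f_ n).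
have br n x : `|reF (f_ n) x| <= c / 2 ^+ n.
  by apply: le_trans (ler_reS _) _; rewrite -cfun_clamp; exact: hf.
have bi n x : `|imF (f_ n) x| <= c / 2 ^+ n.
  by apply: le_trans (ler_imS _) _; rewrite -cfun_clamp; exact: hf.
have [Gr cGr hGr] := normal_series_limit cr br.
have [Gi cGi hGi] := normal_series_limit ci bi.
have reE x : reS (mkS s (Gr x) (Gi x)) = Gr x by exact: reS_mkS.
have imE n x : `|imS (mkS s (Gr x) (Gi x)) - \sum_(j < n) imF (f_ j) x| <= 2 * c / 2 ^+ n.
  rewrite imS_mkS; have [->|im0] := imS_i R s; first by rewrite mul1r.
  rewrite im0 mul0r big1 ?subrr ?normr0; last by move=> j _; exact: im0.
  exact: le_trans (hGr n x).
have cF : contS (fun x => mkS s (Gr x) (Gi x)).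
  split; first by rewrite (_ : reF _ = Gr)//; apply/funext.
  rewrite (_ : imF _ = fun x => imS (mkS s 0 1) * Gi x).
    by apply: continuous_mulf => //; exact: cst_continuous.
  by apply/funext => x; rewrite /imF imS_mkS.
have sE n t : (\sum_(j < n) f_ j : C) t = \sum_(j < n) f_ j t.
  by elim/big_ind2 : _ => // x1 x2 y1 y2 <- <-.
have key n : nb (cfun_of T cF - \sum_(j < n) f_ j) (4 * c / 2 ^+ n).
  move=> t tT; apply: le_trans (absS_ler _) _.
  rewrite cfunDE cfunNE sE /= clamp_id// reSD reSN imSD imSN reE.
  rewrite (raddf_sum (@reS R s)) (raddf_sum (@imS R s)).
  by apply: le_trans (lerD (hGr n t) (imE n t)) _; lra.
exists (cfun_of T cF); split => //.
exists (4 * c) => n; rewrite -raddf_sum -raddfB; exact: nbA_inC.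
Qed.

End Vanishing.

Section CentralBinomial.
Variable R : realFieldType.

(* the coefficients of (1 - X)^(-1/2) *)
Fixpoint cbin (n : nat) : R :=
  if n is m.+1 then cbin m * (m.*2.+1)%:R / (m.*2.+2)%:R else 1.

Lemma cbinS n : (n.+1)%:R * 2 * cbin n.+1 = (n%:R * 2 + 1) * cbin n.
Proof.
have n0 : (n%:R : R) >= 0 by [].
rewrite /= -addnn -[(n + n).+2]addn2 -[(n + n).+1]addn1 -[n.+1]addn1 !natrD.
by field; lra.
Qed.

Lemma cbin_ge0 n : 0 <= cbin n.
Proof. by elim: n => [|n ih] /=; rewrite ?ler01// divr_ge0// mulr_ge0. Qed.

Lemma cbin_le1 n : cbin n <= 1.
Proof.
elim: n => [|n ih] //=; rewrite -mulrA; apply: mulr_ile1 => //.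
- exact: cbin_ge0.
- by rewrite ler_pdivrMr ?ltr0n// mul1r ler_nat.
Qed.

Lemma cbin_conv n : \sum_(i < n.+1) cbin i * cbin (n - i) = 1.
Proof.
elim: n => [|n ih]; first by rewrite big_ord1 subnn mulr1.
have sym m : \sum_(i < m.+1) i%:R * 2 * (cbin i * cbin (m - i)) =
    m%:R * \sum_(i < m.+1) cbin i * cbin (m - i).
  rewrite [RHS]mulr_sumr.
  have -> : \sum_(i < m.+1) m%:R * (cbin i * cbin (m - i)) =
    \sum_(i < m.+1) i%:R * (cbin i * cbin (m - i)) +
    \sum_(i < m.+1) (m - i)%:R * (cbin i * cbin (m - i)).
    rewrite -big_split /=; apply: eq_bigr => i _.
    by rewrite -mulrDl -natrD subnKC// -ltnS.
  rewrite [X in _ + X](reindex_inj rev_ord_inj) /= -big_split /=.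
  apply: eq_bigr => i _; rewrite subSS subKn; last by rewrite -ltnS.
  by rewrite [cbin (m - i) * _]mulrC -mulrDl mulr2n mulrDr mulr1.
have n0 : (n.+1%:R : R) != 0 by rewrite pnatr_eq0.
apply: (mulfI n0); rewrite -sym big_ord_recl /= !mul0r add0r mulr1.
rewrite (eq_bigr (fun i : 'I_n.+1 => i%:R * 2 * (cbin i * cbin (n - i)) + cbin i * cbin (n - i))).
  by rewrite big_split /= sym ih mulr1 -natr1.
move=> i _; rewrite /bump /= add1n subSS mulrA cbinS; ring.
Qed.

Definition cbinp (J : nat) : {poly R} := \poly_(i < J) cbin i.

Lemma cbinp_sqr_coef J n : 0 <= (cbinp J * cbinp J)`_n <= 1 /\
  ((n < J)%N -> (cbinp J * cbinp J)`_n = 1).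
Proof.
rewrite coefM; split.
  apply/andP; split.
    apply: sumr_ge0 => i _; rewrite !coef_poly.
    by do 2 case: ifP => _; rewrite ?mulr0 ?mul0r// mulr_ge0// cbin_ge0.
  rewrite -(cbin_conv n); apply: ler_sum => i _; rewrite !coef_poly.
  by do 2 case: ifP => _; rewrite ?mulr0 ?mul0r// mulr_ge0// cbin_ge0.
move=> nJ; rewrite -(cbin_conv n); apply: eq_bigr => i _; rewrite !coef_poly !ifT//.
  by apply: leq_ltn_trans nJ; exact: leq_subr.
by apply: leq_ltn_trans nJ; rewrite -ltnS.
Qed.

Lemma cbinp_remainder J : exists r : nat -> R, (forall k, `|r k| <= 1) /\
  cbinp J.+1 * cbinp J.+1 * (1 - 'X) - 1 =
  \sum_(k < J.+2) r k *: 'X^(J.+1 + k).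
Proof.
set p := cbinp J.+1; set v := p * p * _ - 1.
have vE n : v`_n = (p * p)`_n - (if n is m.+1 then (p * p)`_m else 1).
  rewrite /v coefB mulrBr mulr1 coefB coefMX coef1.
  by case: n => [|n] /=; rewrite ?subr0.
exists (fun k => v`_(J.+1 + k)); split.
  move=> k; rewrite vE addSn /=.
  have [/andP[h1 h2] _] := cbinp_sqr_coef J.+1 (J + k).+1.
  have [/andP[h3 h4] _] := cbinp_sqr_coef J.+1 (J + k).
  by rewrite ler_norml; lra.
have sp : (size (p * p)%R <= J.+1 + J.+1)%N.
  apply: leq_trans (size_polyMleq _ _) _; apply: leq_trans (leq_pred _) _.
  by apply: leq_add; exact: size_poly.
have sv n : (J.+1 + J.+2 <= n)%N -> v`_n = 0.
  rewrite vE; case: n => [|n]; first by rewrite addSn.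
  rewrite addnS ltnS => /(leq_trans sp) hn.
  by rewrite !nth_default ?subr0//; exact: leqW.
have v0 n : (n < J.+1)%N -> v`_n = 0.
  move=> nJ; rewrite vE; have [_ ->//] := cbinp_sqr_coef J.+1 n.
  case: n nJ => [|n] nJ; first by rewrite subrr.
  by have [_ ->] := cbinp_sqr_coef J.+1 n; rewrite ?subrr// ltnW.
rewrite [LHS](_ : v = \poly_(i < J.+1 + J.+2) v`_i); last first.
  by apply/polyP => n; rewrite coef_poly; case: ltnP => // /sv.
by rewrite poly_def big_split_ord /= big1 ?add0r// => i _; rewrite v0 ?scale0r.
Qed.

End CentralBinomial.

Section SquareRoot.
Variables (R : realType) (s : scalar_kind) (T : R).
Hypothesis T0 : 0 < T.
Local Notation K := (scalars R s).
Local Notation C := (cfun s T).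
Local Notation A := (calg s T).
Local Notation inC := (@inC R s T).
Local Notation scal := (@scal R s T).

(* In the weighted norm sup e^(-lt) |f(t)| with l large, convolution by N is a
   contraction of ratio 1/2. *)
Lemma pow_bound_uniform (m d : R) : 0 <= m -> 0 <= d -> exists c : R,
  forall N z : C, nb N m -> nb z d -> exists g : nat -> C,
  (forall n, inC N ^+ n * inC z = inC (g n)) /\ forall n, nb (g n) (c / 2 ^+ n).
Proof.
move=> m0 d0.
pose l := 2 * m + 1; have l0 : 0 < l by rewrite /l; lra.
exists (d * expR (l * T)) => N z hm hd.
pose g n := iter n (cconv N) z.
have gE n : inC N ^+ n * inC z = inC (g n).
  elim: n => [|n ih]; first by rewrite expr0 mul1r.
  by rewrite exprS -mulrA ih inCM.
have ge0 t : 0 <= t <= T -> 1 <= expR (l * t).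
  by move=> tT; rewrite -expR0 ler_expR mulr_ge0//; lra.
have gw n : nbw l (g n) (d / 2 ^+ n).
  elim: n => [|n ih].
    move=> t tT; rewrite expr0 divr1; apply: le_trans (hd t tT) _.
    by rewrite ler_peMr// ge0.
  have dn0 : 0 <= d / 2 ^+ n by rewrite divr_ge0// exprn_ge0.
  have := nbw_conv T0 l0 dn0 hm ih => hw t tT; apply: le_trans (hw t tT) _.
  apply: ler_wpM2r; first exact: expR_ge0.
  rewrite exprS invfM [2^-1 * _]mulrC [leRHS]mulrA ler_pdivrMr//.
  by move: dn0; set D := d / _ => D0; rewrite /l; lra.
exists g; split => // n t tT.
apply: le_trans (gw n t tT) _; rewrite mulrAC; apply: ler_wpM2r.
  by rewrite invr_ge0 exprn_ge0.
by apply: ler_wpM2l => //; rewrite ler_expR ler_pM2l//; lra.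
Qed.

Lemma pow_bound (N z : C) : exists g : nat -> C, exists c : R,
  (forall n, inC N ^+ n * inC z = inC (g n)) /\ forall n, nb (g n) (c / 2 ^+ n).
Proof.
have [m m0 hm] := nb_exists N; have [d d0 hd] := nb_exists z.
have [c hc] := pow_bound_uniform m0 d0.
by have [g hg] := hc N z hm hd; exists g, c.
Qed.

Lemma neumann (m d : R) : 0 <= m -> 0 <= d -> exists c : R,
  forall N z : C, nb N m -> nb z d ->
  exists2 F : C, inC F = inC z + inC N * inC F & nb F c.
Proof.
move=> m0 d0; have [c hc] := pow_bound_uniform m0 d0; exists (4 * c) => N z hm hd.
have [g [gE gb]] := hc N z hm hd; have [F [hF Fb]] := series_limit T0 gb.
exists F; last by have := Fb 0%N; rewrite big_ord0 subr0 expr0 divr1.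
apply/eqP; rewrite -subr_eq0; apply/eqP; apply: (vanish_cst T0).
have h1 : vanish (fun n => inC F - \sum_(j < n.+1) inC (g j)).
  have := (vanish_shift T0 (fun n => inC F - \sum_(j < n) inC (g j)) 1).2 hF.
  by apply: eq_vanish => n; rewrite addn1.
have h2 := vanishM T0 (inC N) hF.
apply: eq_vanish (vanishB h1 h2) => n.
rewrite big_ord_recl /= -gE expr0 mul1r.
have -> : \sum_(i < n) inC (g (bump 0 i)) = inC N * \sum_(i < n) inC (g i).
  by rewrite mulr_sumr; apply: eq_bigr => i _; rewrite -!gE /bump /= add1n exprS mulrA.
ring.
Qed.

Lemma nbA_geometric_sum (x : nat -> A) (c : R) m : 
  (forall k, nbA (x k) (c / 2 ^+ k)) -> nbA (\sum_(k < m) x k) (2 * c).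
Proof.
move=> hx; have c0 : 0 <= c by have := nbA_ge0 T0 (hx 0%N); rewrite expr0 divr1.
suff h : nbA (\sum_(k < m) x k) (2 * c - 2 * c / 2 ^+ m).
  by apply: nbA_le h; rewrite gerBl divr_ge0 ?mulr_ge0// exprn_ge0.
elim: m => [|m ih]; first by rewrite big_ord0 expr0 divr1 subrr; exact: nbA0.
rewrite big_ord_recr /=; apply: nbA_le (nbAD ih (hx m)).
have p0 : (2 ^+ m : R) != 0 by rewrite expf_neq0.
by rewrite exprS invfM; lra.
Qed.

Lemma nbA_scal (a : R) (x : A) (c : R) : `|a| <= 1 -> nbA x c ->
  nbA (scal (ofR s a) * x) c.
Proof.
move=> a1 hx; have c0 := nbA_ge0 T0 hx; case: hx => h1 h2.
rewrite {1}[x]calgE mulrDr scal_inC -rmorphM; split.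
  rewrite /= addr0 absSM absS_ofR; apply: le_trans h1.
  by rewrite ler_piMl// absS_ge0.
rewrite /= add0r => t tT; rewrite cfunZE absSM absS_ofR; apply: le_trans (h2 t tT).
by rewrite ler_piMl// absS_ge0.
Qed.

(* (delta - N)^(-1/2) = sum_n binom(2n, n) / 4^n N^n *)
Lemma convolution_sqrt (N : C) : exists q : C,
  let Q := 1 + scal (ofR s (cbin R 1)) * inC N + inC N * inC q in
  Q * Q * (1 - inC N) = 1.
Proof.
have [g [c [gE gb]]] := pow_bound N N.
pose f_ j := ofR s (cbin R j.+2) *: g j.
have fb n : nb (f_ n) (c / 2 ^+ n).
  move=> t tT; rewrite cfunZE absSM absS_ofR ger0_norm ?cbin_ge0//.
  by apply: le_trans (gb n t tT); rewrite ler_piMl ?absS_ge0// cbin_le1.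
have [F [hF _]] := series_limit T0 fb.
exists F => Q.
pose e n := inC F - \sum_(j < n) inC (f_ j).
pose ev (p : {poly R}) : A := (map_poly (scal \o ofR s) p).[inC N].
have evM p r : ev (p * r) = ev p * ev r by rewrite /ev rmorphM hornerM.
have evB p r : ev (p - r) = ev p - ev r by rewrite /ev rmorphB hornerD hornerN.
have ev1 : ev 1 = 1 by rewrite /ev rmorph1 hornerC.
have evX : ev 'X = inC N by rewrite /ev map_polyX hornerX.
have evZ a n : ev (a *: 'X^n) = scal (ofR s a) * inC N ^+ n.
  by rewrite /ev map_polyZ map_polyXn hornerZ hornerXn.
have evS m (E : nat -> {poly R}) : ev (\sum_(i < m) E i) = \sum_(i < m) ev (E i).
  by rewrite /ev rmorph_sum horner_sum.
have evp n : ev (cbinp R n.+2) = Q - inC N * e n.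
  rewrite /cbinp poly_def (evS _ (fun i => cbin R i *: 'X^i)) 2!big_ord_recl.
  have -> : \sum_(i < n) ev (cbin R (lift ord0 (lift ord0 i)) *: 'X^(lift ord0 (lift ord0 i))) =
      inC N * \sum_(j < n) inC (f_ j).
    rewrite mulr_sumr; apply: eq_bigr => j _.
    by rewrite evZ /f_ -scal_inC -gE !lift0 !exprS; ring.
  by rewrite !evZ expr0 expr1 mulr1 !rmorph1 /Q /e; ring.
have van : vanish (fun n => Q * Q * (1 - inC N) - 1).
  have v1 : vanish (fun n => ev (cbinp R n.+2 * cbinp R n.+2 * (1 - 'X) - 1)).
    exists (2 * c) => n.
    have [r [r1 ->]] := cbinp_remainder R n.+1.
    rewrite (evS _ (fun k => r k *: 'X^(n.+2 + k))) -mulrA.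
    apply: (@nbA_geometric_sum (fun k => ev (r k *: 'X^(n.+2 + k)))) => k; rewrite evZ; apply: nbA_scal => //.
    rewrite addSn exprSr gE; apply: nbA_inC => // t tT; apply: le_trans (gb _ t tT) _.
    have c0 : 0 <= c by have := nb_ge0 T0 (gb 0%N); rewrite expr0 divr1.
    rewrite -mulrA; apply: ler_wpM2l => //; rewrite -invfM -exprD.
    rewrite lef_pV2 ?posrE ?exprn_gt0//; apply: ler_weXn2l; first by rewrite ler1n.
    by rewrite addSn.
  have v2 : vanish (fun n => inC N * e n) by exact: vanishM.
  have v3 : vanish (fun n => (2%:R * Q - inC N * e n) * (inC N * e n)).
    apply: vanishM_bounded => //.
    have [b b0 hb] := nbA_exists (2%:R * Q); have [b' hb'] := vanish_bounded T0 v2.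
    by exists (b + b') => n; apply: nbAD => //; exact: nbAN.
  have v4 := vanishM T0 (1 - inC N) v3.
  apply: eq_vanish (vanishD v1 v4) => n.
  by rewrite evB !evM evB evX ev1 evp; ring.
by have := vanish_cst T0 van => /eqP; rewrite subr_eq0 => /eqP.
Qed.

End SquareRoot.

(** * From the wave equation to the equation with memory *)

Section Calculus.
Variables (R : realType) (s : scalar_kind) (T : R).
Hypothesis T0 : 0 < T.
Local Notation K := (scalars R s).
Local Notation C := (cfun s T).
Local Notation A := (calg s T).
Local Notation inC := (@inC R s T).
Local Notation scal := (@scal R s T).
Local Notation one := (@ccst R s T 1).

Lemma oneE (t : R) : one t = 1. Proof. by []. Qed.

Definition pmul (f g : C) : C := cfun_of T (contSM (cfun_contS f) (cfun_contS g)).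

Lemma pmulE f g t : pmul f g t = f t * g t.
Proof. by rewrite /= !cfun_clamp. Qed.

Lemma cconv_oneE (f : C) t : 0 <= t <= T -> cconv one f t = integralS `[0, t] f.
Proof.
move=> tT; rewrite cconvE clamp_id//; congr integralS.
by apply/funext => r; rewrite oneE mul1r.
Qed.

Lemma cconv_at0 (f g : C) : cconv f g 0 = 0.
Proof.
rewrite cconvE clamp0; apply: scalars_ext; rewrite (reS_integralS, imS_integralS) set_itv1 Rintegral_set1 raddf0//.
Qed.

Lemma cprimP (F f : C) : F = F 0 *: one + cconv one f <-> prim T F f.
Proof.
split=> [E|/primP h].
  apply/primP => t tT; rewrite {1}E cfunDE cfunZE oneE mulr1 cconv_oneE//.
apply: cfun_ext; last exact: ltW.
by move=> t tT; rewrite h// cfunDE cfunZE oneE mulr1 cconv_oneE.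
Qed.

Definition cprim (F f : C) := F = F 0 *: one + cconv one f.

Lemma cprim_inC F f : cprim F f <->
  inC F = inC one * (scal (F 0) + inC f).
Proof.
rewrite mulrDr mulrC scal_inC inCM -raddfD; split=> [{1}->//|].
exact: (@inC_inj R s T).
Qed.

Lemma cprim_pmul F G f g : cprim F f -> cprim G g ->
  cprim (pmul F G) (pmul f G + pmul F g).
Proof.
move=> /cprimP hF /cprimP hG; apply/cprimP.
have := primM (cfun_contS F) (cfun_contS G) (cfun_contS f) (cfun_contS g) hF hG.
congr (prim T _ _); apply/funext => t; rewrite ?cfunDE !pmulE//.
Qed.

Lemma cconv_one_inj (f g : C) : cconv one f = cconv one g -> f = g.
Proof.
move=> e; apply/eqP; rewrite -subr_eq0; apply/eqP; set h := f - g.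
have h0 : cprim 0 h.
  by rewrite /cprim cfun0E scale0r add0r /h cconvDr cconvNr e subrr.
have [/= pr pi] := (cprimP _ _).1 h0; have [cr ci] := cfun_contS h.
have z (k : R -> R) : continuous k -> primR T (fun=> 0) k -> forall t, 0 < t < T -> k t = 0.
  move=> ck hk t tT; have [_ <-] := primR_is_derive ck hk tT.
  by rewrite derive_cst.
have hz t : 0 < t < T -> h t = 0.
  move=> tT; apply: scalars_ext; rewrite raddf0.
    apply: (z (reF h) cr _ t tT).
    by move: pr; rewrite (_ : reF (0 : C) = fun=> 0)//; apply/funext => x; rewrite /reF raddf0.
  apply: (z (imF h) ci _ t tT).
  by move: pi; rewrite (_ : imF (0 : C) = fun=> 0)//; apply/funext => x; rewrite /imF raddf0.
apply: cfun_ext; last exact: ltW.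
move=> t tT; rewrite cfun0E; apply: absS_eq0; apply/eqP.
rewrite eq_le absS_ge0 andbT; apply/ler_addgt0Pr => e' e0; rewrite add0r.
have [d d0 hd] := (contS_eps h).2 (cfun_contS h) t e' e0.
have [x [x0 xd]] : exists x, 0 < x < T /\ `|x - t| < d.
  pose m := Num.min (d / 2) (T / 3).
  have m1 : m <= d / 2 by rewrite ge_min lexx.
  have m2 : m <= T / 3 by rewrite ge_min lexx orbT.
  have m3 : 0 < m by rewrite lt_min !divr_gt0.
  have [tm|tm] := leP t (T / 2).
    exists (t + m); rewrite (_ : t + m - t = m) ?gtr0_norm; [split; lra|lra|ring].
  exists (t - m); rewrite (_ : t - m - t = - m) ?normrN ?gtr0_norm; [split; lra|lra|ring].
have := hd x xd; rewrite (hz x x0) sub0r absSN => /ltW//.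
Qed.

(* exp(-a t) and its reciprocal exp(a t) *)
Lemma exists_exponential (a : K) : exists E : C, [/\ E 0 = 1,
  cprim E (- (a *: E)) & exists2 e : R, 0 < e & forall t, 0 <= t <= T -> e <= absS (E t)].
Proof.
have ex b : exists2 E : C, E 0 = 1 & cprim E (- (b *: E)).
  have [m m0 hm] := nb_exists (- (b *: one) : C); have [d d0 hd] := nb_exists one.
  have [c hc] := neumann s T0 m0 d0.
  have [E hE _] := hc _ _ hm hd.
  have E1 : E = one + cconv one (- (b *: E)).
    apply: (@inC_inj R s T); by rewrite hE inCM raddfD /= cconvNl cconvNr cconvZl cconvZr.
  have E0 : E 0 = 1 by rewrite E1 cfunDE cconv_at0 oneE addr0.
  by exists E => //; rewrite /cprim E0 scale1r.
have [E E0 hE] := ex a; have [F F0 hF] := ex (- a).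
exists E; split=> //.
have := cprim_pmul hE hF.
have -> : pmul (- (a *: E)) F + pmul E (- (- a *: F)) = 0.
  apply: cfun_ext; last exact: ltW.
  by move=> t tT; rewrite cfunDE !pmulE !cfunNE !cfunZE cfun0E; ring.
rewrite /cprim pmulE E0 F0 mulr1 cconv0 addr0 scale1r => EF.
have [f f0 hf] := nb_exists F.
exists (f + 1)^-1; first by rewrite invr_gt0; lra.
move=> t tT; have : absS (E t) * absS (F t) = 1 by rewrite -absSM -pmulE EF oneE absS1.
have := hf t tT; have := absS_ge0 (F t); have := absS_ge0 (E t) => h1 h2 h3 h4.
have f1 : 0 < f + 1 by lra.
rewrite -(ler_pM2r f1) mulVf ?gt_eqF// -h4; apply: ler_wpM2l => //; lra.
Qed.

(* the solutions S of S'' + mu S = 0, S(0) = 0, S'(0) = 1 are bounded uniformly in mu >= -c *)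
Lemma exists_oscillation (c : R) : 0 <= c -> exists2 k : R, 0 <= k &
  forall m : R, - c <= m -> exists S S' : C,
    [/\ S = cconv one S', S' = one - ofR s m *: cconv one S & nb S k].
Proof.
move=> c0.
have ex (m0 : R) : 0 <= m0 -> exists k : R, forall m, `|m| <= m0 -> exists S S' : C,
    [/\ S = cconv one S', S' = one - ofR s m *: cconv one S & nb S k].
  move=> m00.
  have [d d0 hd] := nb_exists (cconv one one).
  have [k hk] := neumann s T0 (mulr_ge0 m00 d0) d0; exists k => m mm0.
  have hm : nb (- (ofR s m *: cconv one one)) (m0 * d).
    apply: nbN; apply: nb_le (nbZ (ofR s m) hd).
    by rewrite absS_ofR; apply: ler_wpM2r.
  have [S hS Sk] := hk _ _ hm hd.
  exists S, (one - ofR s m *: cconv one S); split => //.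
  apply: (@inC_inj R s T); rewrite hS inCM -raddfD; congr inC.
  by rewrite cconvDr cconvNl cconvNr cconvZr cconvZl cconvA.
have [k1 hk1] := ex c c0.
have k0 : 0 <= Num.max k1 T by rewrite le_max (ltW T0) orbT.
exists (Num.max k1 T) => // m cm.
have [m0|m0] := leP m 0.
  have [|S [S' [h1 h2 h3]]] := hk1 m; first by rewrite ler_norml cm/=; lra.
  by exists S, S'; split => //; apply: nb_le h3; rewrite le_max lexx.
have [k2 hk2] := ex `|m| (normr_ge0 m).
have [S [S' [h1 h2 _]]] := hk2 m (lexx _); exists S, S'; split => //.
have S00 : S 0 = 0 by rewrite h1 cconv_at0.
have S'0 : S' 0 = 1 by rewrite h2 cfunDE cfunNE cfunZE cconv_at0 mulr0 subr0 oneE.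
have [p1 p2] : prim T S S' by apply/cprimP; rewrite S00 scale0r add0r.
have [q1 q2] : prim T S' (- (ofR s m *: S)).
  by apply/cprimP; rewrite S'0 scale1r {1}h2 cconvNr cconvZr.
have [Sr Si] := cfun_contS S; have [S'r S'i] := cfun_contS S'.
have energy (x y z : R -> R) : continuous x -> continuous y -> continuous z ->
    primR T x y -> primR T y z -> z = (fun t => - (m * x t)) ->
    forall t, 0 <= t <= T -> y t * y t + m * (x t * x t) = y 0 * y 0 + m * (x 0 * x 0).
  move=> cx cy cz pxy pyz zE t tT.
  have e1 := primRM cy cy cz cz pyz pyz; have e2 := primRM cx cx cy cy pxy pxy.
  rewrite (e1 t tT) (e2 t tT).
  have -> : \int[lebesgue_measure]_(r in `[0, t]) (z r * y r + y r * z r) =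
      (- m) * \int[lebesgue_measure]_(r in `[0, t]) (y r * x r + x r * y r).
    rewrite -RintegralZl//; last first.
      by apply: continuous_integrable; apply: continuous_addf; exact: continuous_mulf.
    by apply: eq_Rintegral => r _; rewrite zE; ring.
  ring.
have [zr zi] := cfun_contS (- (ofR s m *: S)).
have zrE : reF (- (ofR s m *: S)) = (fun t => - (m * reF S t)).
  by apply/funext => t; rewrite /reF cfunNE cfunZE reSN reS_ofRM.
have ziE : imF (- (ofR s m *: S)) = (fun t => - (m * imF S t)).
  by apply/funext => t; rewrite /imF cfunNE cfunZE imSN imS_ofRM.
have S'1 : nb S' 1.
  move=> t tT; rewrite -(@ler_pXn2r _ 2) ?nnegrE ?absS_ge0// absS_sqr expr1n.
  have := energy _ _ _ Sr S'r zr p1 q1 zrE t tT.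
  have := energy _ _ _ Si S'i zi p2 q2 ziE t tT.
  rewrite /reF /imF S00 S'0 !raddf0 reS1 imS1 !mulr0 !addr0 mulr1 -!expr2 => h3 h4.
  have : 0 <= m * reS (S t) ^+ 2 by rewrite mulr_ge0 ?sqr_ge0// ltW.
  have : 0 <= m * imS (S t) ^+ 2 by rewrite mulr_ge0 ?sqr_ge0// ltW.
  lra.
have o1 : nb one 1 by move=> t _; rewrite oneE absS1.
rewrite h1; apply: nb_le (nb_conv T0 o1 S'1).
by rewrite !mulr1 le_max lexx orbT.
Qed.

End Calculus.

Section Transmutation.
Variables (R : realType) (s : scalar_kind) (T : R).
Hypothesis T0 : 0 < T.
Local Notation K := (scalars R s).
Local Notation C := (cfun s T).
Local Notation A := (calg s T).
Local Notation inC := (@inC R s T).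
Local Notation scal := (@scal R s T).
Local Notation one := (@ccst R s T 1).

Lemma pow_fact_le_expR (x : R) n : 0 <= x -> x ^+ n / n`!%:R <= expR x.
Proof.
move=> x0.
have : series (exp_coeff x) n.+1 <= expR x.
  apply: nondecreasing_cvgn_le; last exact: is_cvg_series_exp_coeff.
  apply: nondecreasing_series => k _ _; exact: exp_coeff_ge0.
apply: le_trans; rewrite /series /= big_nat_recr//= lerDr.
by apply: sumr_ge0 => i _; exact: exp_coeff_ge0.
Qed.

Definition monom (j : nat) : R -> R := fun t => (- t) ^+ j / j`!%:R.

Lemma continuous_monom j : continuous (monom j).
Proof.
apply: continuous_mulf; last exact: cst_continuous.
elim: j => [|j ih]; first by under eq_fun do rewrite expr0; exact: cst_continuous.
under eq_fun do rewrite exprS; apply: continuous_mulf => //.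
by move=> x; apply: continuousN; exact: cvg_id.
Qed.

Definition cmonom j : C := cfun_of T (contS_ofR s (@continuous_monom j)).

Lemma is_derive_monom j (t : R) : is_derive t 1 (monom j.+1) (- monom j t).
Proof.
have h : is_derive t 1 (fun t : R => (- t) ^+ j.+1) (- (j.+1%:R * (- t) ^+ j)).
  have fe n : (-%R ^+ n : R -> R) = fun t => (- t) ^+ n.
    by elim: n => [|n ih]; apply/funext => x; rewrite ?expr0// !exprS ih.
  have := @is_deriveX R R^o (-%R) j.+1 t 1 (-1) (@is_deriveN R R^o R^o id t 1 1 (is_derive_id t 1)).
  by rewrite fe /GRing.scale /= mulrN1.
have e : - monom j t = - (j.+1%:R * (- t) ^+ j) / j.+1`!%:R.
  rewrite /monom factS natrM; field.
  by rewrite nat1r !pnatr_eq0 -lt0n fact_gt0.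
rewrite e mulrC /monom; under eq_fun do rewrite mulrC.
exact: (@is_deriveZ R R^o R^o (fun t : R => (- t) ^+ j.+1) (j.+1`!%:R^-1) t 1 _ h).
Qed.

Lemma cmonomE j t : 0 <= t <= T -> cmonom j t = ofR s (monom j t).
Proof. by move=> tT; rewrite /= clamp_id. Qed.

Lemma cprim_monom j : cprim (cmonom j.+1) (- cmonom j).
Proof.
apply/(cprimP T0).
have h : primR T (monom j.+1) (fun t => - monom j t).
  apply: primR_intro; [exact: continuous_monom| |move=> t _; exact: is_derive_monom].
  by move=> x; apply: continuousN; exact: continuous_monom.
have T00 : 0 <= (0 : R) <= T by rewrite lexx ltW.
apply/primP => t tT; apply: scalars_ext; rewrite (reSD, imSD) (reS_integralS, imS_integralS).
  rewrite !cmonomE// !reS_ofR (h t tT); congr (_ + _); apply: eq_Rintegral => r.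
  rewrite inE /= in_itv/= => rt; transitivity (reS (- cmonom j r)) => //.
  by rewrite reSN cmonomE ?reS_ofR//; lra.
rewrite !cmonomE// !imS_ofR add0r.
transitivity (\int[lebesgue_measure]_(r in `[0, t]) (0 : R)).
  by rewrite Rintegral_cst//= mul0r.
apply: eq_Rintegral => r; rewrite inE /= in_itv/= => rt.
transitivity (imS (- cmonom j r)) => //.
by rewrite imSN cmonomE ?imS_ofR ?oppr0//; lra.
Qed.

Lemma nb_monom j : nb (cmonom j) (expR T).
Proof.
move=> t tT; rewrite /= clamp_id// absS_ofR /monom normrM normrX normrN.
rewrite (ger0_norm (_ : 0 <= j`!%:R^-1)) ?invr_ge0//.
apply: le_trans (pow_fact_le_expR j (normr_ge0 t)) _.
by rewrite ler_expR ger0_norm; lra.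
Qed.

Lemma mul_inC (x : A) (f : C) : x * inC f = inC (x.1 *: f + cconv x.2 f).
Proof. by rewrite {1}[x]calgE mulrDl scal_inC inCM raddfD. Qed.

Lemma pmul1 (f : C) : pmul one f = f.
Proof. by apply/val_inj/funext => t /=; rewrite mul1r cfun_clamp. Qed.

Lemma pmulZl a (f g : C) : pmul (a *: f) g = a *: pmul f g.
Proof.
apply: cfun_ext; last exact: ltW.
by move=> t _; rewrite pmulE !cfunZE pmulE mulrA.
Qed.

Lemma pmulZr a (f g : C) : pmul f (a *: g) = a *: pmul f g.
Proof.
apply: cfun_ext; last exact: ltW.
by move=> t _; rewrite pmulE !cfunZE pmulE mulrCA.
Qed.

Lemma nb_pmul (f g : C) c d : nb f c -> nb g d -> nb (pmul f g) (c * d).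
Proof.
move=> hf hg t tT; rewrite pmulE absSM.
by apply: ler_pM; rewrite ?absS_ge0//; [exact: hf|exact: hg].
Qed.

(* In Laplace variables the equation reads (p^2 + m) Y^ = (1 - N^)^-1 sg^ with
   p = lambda (1 - N^)^(-1/2) = lambda + a + b^, so that Y is the superposition
   of the S(r) against the kernel with transform exp(-p r) (1 - N^)^-1 sg^.
   Expanding exp(-r b^) in powers of b gives the k j and w j below. *)
Lemma volterra_representation (N N1 sg sg1 : C) :
  cprim N N1 -> cprim sg sg1 -> sg 0 != 0 ->
  exists (al : C) (k w : nat -> C) (e c : R),
  [/\ 0 < e, forall t, 0 <= t <= T -> e <= absS (al t),
     forall j, nb (k j) (c / 2 ^+ j), forall j, nb (w j) c &
   forall (m : K) (S S' : C), S = cconv one S' -> S' = one - m *: cconv one S ->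
    exists Y D : C, [/\ Y = cconv one D,
       D = cconv one (sg - m *: Y + m *: cconv N Y) &
       exists c', forall n,
         nb (D - pmul al S - \sum_(j < n) cconv (k j) (pmul (w j) S)) (c' / 2 ^+ n)]].
Proof.
move=> hN hs s00.
have [q hQ] := convolution_sqrt T0 N.
set I := inC one.
pose a : K := N 0 * ofR s (cbin R 1).
pose b : C := N 0 *: q + ofR s (cbin R 1) *: N1 + cconv N1 q.
pose x : A := scal a + inC b.
pose Q : A := 1 + I * x.
have NE : inC N = I * (scal (N 0) + inC N1) by apply/cprim_inC.
have sE : inC sg = I * (scal (sg 0) + inC sg1) by apply/cprim_inC.
have {}hQ : Q * Q * (1 - inC N) = 1.
  rewrite -[RHS]hQ; congr (_ * _ * _); rewrite /Q /x /a /b !raddfD /= -!scal_inC -inCM rmorphM NE; ring.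
have [E [E0 hE [e0 e00 he0]]] := exists_exponential T0 a.
have [En En0 hEn] := nb_exists E.
pose w j := pmul (cmonom j) E.
have w0 : w 0%N = E.
  rewrite /w (_ : cmonom 0 = one) ?pmul1//.
  by apply/val_inj/funext => t /=; rewrite /monom expr0 fact0 divr1 rmorph1.
have wb j : nb (w j) (expR T * En) by apply: nb_pmul => //; exact: nb_monom.
have hw0 h h' : cprim h h' -> inC (pmul (w 0%N) h) =
    I * (scal (h 0) + inC (pmul (w 0%N) h' - a *: pmul (w 0%N) h)).
  move=> hh; rewrite w0; have /(cprim_inC _ _) -> := cprim_pmul T0 hE hh.
  rewrite pmulE E0 mul1r; congr (_ * (_ + inC _)).
  apply: cfun_ext; last exact: ltW.
  by move=> t _; rewrite !(cfunDE, cfunNE, cfunZE, pmulE); ring.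
have hwS j h h' : cprim h h' -> inC (pmul (w j.+1) h) =
    I * inC (pmul (w j.+1) h' - a *: pmul (w j.+1) h - pmul (w j) h).
  move=> hh; have := cprim_pmul T0 (cprim_pmul T0 (cprim_monom j) hE) hh.
  rewrite -/(w j.+1) => /(cprim_inC _ _) ->.
  have m0 : cmonom j.+1 0 = 0.
    by rewrite /= clamp0 /monom oppr0 expr0n mul0r rmorph0.
  rewrite pmulE pmulE m0 !mul0r raddf0 add0r; congr (_ * inC _).
  apply: cfun_ext; last exact: ltW.
  by move=> t _; rewrite /w !(cfunDE, cfunNE, cfunZE, pmulE); ring.
pose chi : C := let y := 2%:R * x + I * x * x in y.1 *: sg + cconv y.2 sg.
pose k0 := sg1 + chi.
pose sig := Q * Q * inC sg.
have sigE : sig = I * (scal (sg 0) + inC k0).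
  have chiE : inC chi = (2%:R * x + I * x * x) * inC sg by rewrite [RHS]mul_inC.
  transitivity (I * (scal (sg 0) + inC sg1) + I * inC chi).
    by rewrite -sE chiE /sig /Q; ring.
  by rewrite -mulrDr -addrA -raddfD.
pose z := sg 0 *: b + cconv b k0.
have [g [cg [gE gb]]] := pow_bound T0 b z.
pose k j := if j is i.+1 then g i else k0.
have [ck ck0 hk0] := nb_exists k0.
have cg0 : 0 <= cg by have := nb_ge0 T0 (gb 0%N); rewrite expr0 divr1.
have kb j : nb (k j) ((ck + 2 * cg) / 2 ^+ j).
  case: j => [|j]; first by apply: nb_le hk0; rewrite expr0 divr1 lerDl mulr_ge0.
  apply: nb_le (gb j); rewrite exprS invfM mulrA; apply: ler_wpM2r.
    by rewrite invr_ge0 exprn_ge0.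
  lra.
pose al := sg 0 *: E.
pose beta j := inC b ^+ j * sig.
have betaS j : beta j.+1 = I * inC (k j.+1).
  have zE : inC z = scal (sg 0) * inC b + inC b * inC k0 by rewrite scal_inC inCM -raddfD.
  rewrite /beta /k -gE zE sigE exprSr; ring.
pose P n h : A := \sum_(j < n) beta j * inC (pmul (w j) h).
have PE n h : P n.+1 h = I * (inC (pmul al h) + \sum_(j < n.+1) inC (k j) * inC (pmul (w j) h)).
  rewrite /P !big_ord_recl.
  have -> : \sum_(i < n) beta (lift ord0 i) * inC (pmul (w (lift ord0 i)) h) =
      I * \sum_(i < n) inC (k (lift ord0 i)) * inC (pmul (w (lift ord0 i)) h).
    by rewrite mulr_sumr; apply: eq_bigr => i _; rewrite lift0 betaS mulrA.
  have -> : beta (@ord0 n) = sig by rewrite /beta expr0 mul1r.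
  rewrite sigE /al pmulZl -scal_inC [w ord0]w0 [k ord0]/=; ring.
have exD h : exists D : C, (exists c', forall n,
    nb (D - pmul al h - \sum_(j < n) cconv (k j) (pmul (w j) h)) (c' / 2 ^+ n)) /\
    vanish (fun n => I * inC D - P n h).
  have [hc hc0 hh] := nb_exists h.
  have fb j : nb (cconv (k j) (pmul (w j) h)) (T * (ck + 2 * cg) * (expR T * En * hc) / 2 ^+ j).
    apply: nb_le (nb_conv T0 (kb j) (nb_pmul (wb j) hh)).
    rewrite le_eqVlt; apply/orP; left; apply/eqP; ring.
  have [F [vF bF]] := series_limit T0 fb.
  exists (pmul al h + F); split.
    exists (4 * (T * (ck + 2 * cg) * (expR T * En * hc))) => n.
    by rewrite [_ + F]addrC addrK.
  apply/(vanish_shift T0 _ 1).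
  have v1 := (vanish_shift T0 (fun n => inC F - \sum_(j < n) inC (cconv (k j) (pmul (w j) h))) 1).2 vF.
  apply: eq_vanish (vanishM T0 I v1) => n.
  rewrite addn1 PE raddfD /=.
  under [in RHS]eq_bigr do rewrite inCM.
  ring.
have key h h' (Y Y' : A) : cprim h h' -> vanish (fun n => Y - P n h) ->
    vanish (fun n => Y' - P n h') -> Q * Y = I * (Y' + scal (h 0) * sig).
  move=> hh v1 v2; apply/eqP; rewrite -subr_eq0; apply/eqP; apply: (vanish_cst T0).
  have v3 := (vanish_shift T0 _ 1).2 v1; have v4 := (vanish_shift T0 _ 1).2 v2.
  apply: eq_vanish (vanishB (vanishD (vanishM T0 (1 + scal a * I) v3) (vanishM T0 (I * inC b) v1)) (vanishM T0 I v4)) => n.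
  have PE1 : P (n + 1)%N h = I * (scal (h 0) * sig - scal a * P (n + 1)%N h + P (n + 1)%N h' - inC b * P n h).
    rewrite addn1 /P !big_ord_recl /=.
    set T1 := \sum_(i < n) beta (bump 0 i) * inC (pmul _ h).
    set T2 := \sum_(i < n) beta (bump 0 i) * inC (pmul _ h'); set T3 := \sum_(j < n) _.
    have E1 : T1 = I * (T2 - scal a * T1 - inC b * T3).
      rewrite /T1 /T2 /T3 !mulr_sumr -!sumrB mulr_sumr; apply: eq_bigr => i _.
      rewrite /bump /= add1n {1}(hwS i h h' hh) !raddfB /= -scal_inC /beta exprS; ring.
    rewrite {1}E1 {1}(hw0 h h' hh) raddfB /= -scal_inC /beta expr0; ring.
  rewrite [in RHS]/Q /x; move: PE1; set P1 := P _ h; set P2 := P _ h'; set P3 := P n h => PE1.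
  have : P1 - I * (scal (h 0) * sig - scal a * P1 + P2 - inC b * P3) = 0 by rewrite {1}PE1 subrr.
  move=> e1; apply/eqP; rewrite -subr_eq0 -oppr_eq0 -e1; apply/eqP; ring.
exists al, k, w, (absS (sg 0) * e0), (ck + 2 * cg + expR T * En).
split.
- rewrite mulr_gt0// lt_neqAle absS_ge0 andbT eq_sym; apply: contraNneq s00 => /absS_eq0 ->//.
- by move=> t tT; rewrite cfunZE absSM; apply: ler_wpM2l; [exact: absS_ge0|exact: he0].
- move=> j; apply: nb_le (kb j); apply: ler_wpM2r; first by rewrite invr_ge0 exprn_ge0.
  by rewrite lerDl mulr_ge0// expR_ge0.
- by move=> j; apply: nb_le (wb j); rewrite lerDr addr_ge0// mulr_ge0.
move=> m S S' SE S'E.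
have S00 : S 0 = 0 by rewrite SE cconv_at0.
have S'0 : S' 0 = 1 by rewrite S'E cfunDE cfunNE cfunZE cconv_at0 mulr0 subr0 oneE.
have hS : cprim S S' by rewrite /cprim S00 scale0r add0r.
have hS' : cprim S' (- (m *: S)) by rewrite /cprim S'0 scale1r {1}S'E cconvNr cconvZr.
have [D [Dn vD]] := exD S; have [D' [_ vD']] := exD S'.
have vD2 : vanish (fun n => - (scal m * (I * inC D)) - P n (- (m *: S))).
  apply: eq_vanish (vanishM T0 (- scal m) vD) => n.
  have -> : P n (- (m *: S)) = - (scal m * P n S).
    rewrite /P mulr_sumr -sumrN; apply: eq_bigr => j _.
    by rewrite -scaleNr pmulZr -scal_inC raddfN; ring.
  ring.
have e1 := key _ _ _ _ hS vD vD'; have e2 := key _ _ _ _ hS' vD' vD2.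
exists (cconv one D), D; split => //.
apply: (cconv_one_inj T0); apply: (@inC_inj R s T).
rewrite -!inCM 2!raddfD /= raddfN /= -!scal_inC -!inCM -/I.
move: e1 e2; rewrite S00 S'0 raddf0 rmorph1 mul0r addr0 mul1r /sig.
move=> e1 e2.
have e3 : Q * Q * (I * inC D) = I * I * (Q * Q * inC sg - scal m * (I * inC D)).
  rewrite -mulrA e1 mulrCA e2; ring.
have : (1 - inC N) * (Q * Q * (I * inC D)) = (1 - inC N) * (I * I * (Q * Q * inC sg - scal m * (I * inC D))) by rewrite e3.
have -> : (1 - inC N) * (Q * Q * (I * inC D)) = (Q * Q * (1 - inC N)) * (I * inC D) by ring.
have -> : (1 - inC N) * (I * I * (Q * Q * inC sg - scal m * (I * inC D))) =
  I * I * ((Q * Q * (1 - inC N)) * inC sg - (1 - inC N) * scal m * (I * inC D)) by ring.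
rewrite hQ !mul1r => e4; rewrite {1}e4; ring.
Qed.

End Transmutation.

(** * Gronwall estimates *)

Section Gronwall.
Variable R : realType.
Local Notation leb := (@lebesgue_measure R).
Implicit Types x y : R -> R.

Lemma le_integral_continuous x y (a b : R) : continuous x -> continuous y ->
  (forall t, a <= t <= b -> x t <= y t) ->
  \int[leb]_(r in `[a, b]) x r <= \int[leb]_(r in `[a, b]) y r.
Proof.
by move=> cx cy xy; apply: le_Rintegral => //; exact: continuous_integrable.
Qed.

Lemma integral_le_itv x (t T : R) : continuous x -> (forall t, 0 <= x t) -> 0 <= t <= T ->
  \int[leb]_(r in `[0, t]) x r <= \int[leb]_(r in `[0, T]) x r.
Proof.
move=> cx x0 tT; rewrite -subr_ge0 Rintegral_itvB//=.
- by apply: Rintegral_ge0.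
- exact: continuous_integrable.
- by rewrite bnd_simp; lra.
- by rewrite bnd_simp; lra.
Qed.

Lemma sqr_integral_le x (t : R) : continuous x -> 0 <= t ->
  (\int[leb]_(r in `[0, t]) x r) ^+ 2 <= t * \int[leb]_(r in `[0, t]) x r ^+ 2.
Proof.
move=> cx; rewrite le_eqVlt => /predU1P[<-|t0].
  by rewrite set_itv1 !Rintegral_set1 mulr0 expr0n.
set I := \int[leb]_(r in _) _; set J := \int[leb]_(r in _) _.
have cx2 : continuous (fun r => x r ^+ 2) by under eq_fun do rewrite expr2; exact: continuous_mulf.
pose m := I / t.
have : 0 <= \int[leb]_(r in `[0, t]) ((x r - m) ^+ 2).
  by apply: Rintegral_ge0 => r _; exact: sqr_ge0.
have -> : \int[leb]_(r in `[0, t]) ((x r - m) ^+ 2) = J + (- (2 * m) * I + m ^+ 2 * t).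
  rewrite /J /I -RintegralZl//; last exact: continuous_integrable.
  have ct : \int[leb]_(r in `[0, t]) (m ^+ 2) = m ^+ 2 * t.
    by rewrite Rintegral_cst//= lebesgue_measure_itv/= lte_fin t0 /= oppr0 addr0.
  rewrite -ct -RintegralD//; last 2 first.
  - by apply: continuous_integrable; apply: continuous_mulf => //; exact: cst_continuous.
  - by apply: continuous_integrable; exact: cst_continuous.
  rewrite -RintegralD//; last 2 first.
  - exact: continuous_integrable.
  - apply: continuous_integrable; apply: continuous_addf; last exact: cst_continuous.
    by apply: continuous_mulf => //; exact: cst_continuous.
  by apply: eq_Rintegral => r _; ring.
have -> : J + (- (2 * m) * I + m ^+ 2 * t) = (t * J - I ^+ 2) / t.
  by rewrite /m; field; rewrite gt_eqF.
by rewrite pmulr_lge0 ?invr_gt0// subr_ge0.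
Qed.

Lemma volterra_upper (T A B : R) x y : 0 <= T -> 0 <= A -> 0 <= B -> 
  continuous x -> continuous y ->
  (forall t, 0 <= x t) -> (forall t, 0 <= y t) ->
  (forall t, 0 <= t <= T -> y t <= A * x t + B * \int[leb]_(r in `[0, t]) x r) ->
  \int[leb]_(r in `[0, T]) y r ^+ 2 <=
    (2 * A ^+ 2 + 2 * B ^+ 2 * T ^+ 2) * \int[leb]_(r in `[0, T]) x r ^+ 2.
Proof.
move=> T0 A0 B0 cx cy x0 y0 h.
have c2 (z : R -> R) : continuous z -> continuous (fun r => z r ^+ 2).
  by move=> cz; under eq_fun do rewrite expr2; exact: continuous_mulf.
set J := \int[leb]_(r in _) x r ^+ 2.
have J0 : 0 <= J by apply: Rintegral_ge0 => r _; exact: sqr_ge0.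
have -> : (2 * A ^+ 2 + 2 * B ^+ 2 * T ^+ 2) * J =
    \int[leb]_(r in `[0, T]) (2 * A ^+ 2 * x r ^+ 2 + 2 * B ^+ 2 * T * J).
  rewrite RintegralD//; last 2 first.
  - by apply: continuous_integrable; apply: continuous_mulf; [exact: cst_continuous|exact: c2].
  - by apply: continuous_integrable; exact: cst_continuous.
  rewrite RintegralZl//; last by apply: continuous_integrable; exact: c2.
  rewrite Rintegral_cst//= lebesgue_measure_itv/= lte_fin -/J.
  move: T0; rewrite le_eqVlt => /predU1P[<-|->].
    by rewrite ltxx /= !mulr0; ring.
  by rewrite /= oppr0 addr0; ring.
apply: le_integral_continuous; first exact: c2.
  apply: continuous_addf; last exact: cst_continuous.
  by apply: continuous_mulf; [exact: cst_continuous|exact: c2].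
move=> t tT; have [t00 tT2] := andP tT.
have I0 : 0 <= \int[leb]_(r in `[0, t]) x r by apply: Rintegral_ge0.
have hI := sqr_integral_le cx t00.
have hJ : t * \int[leb]_(r in `[0, t]) x r ^+ 2 <= T * J.
  apply: ler_pM => //; first by apply: Rintegral_ge0 => r _; exact: sqr_ge0.
  by apply: integral_le_itv => // [|r]; [exact: c2|exact: sqr_ge0].
have {}hI := le_trans hI hJ.
have hy := h t tT.
apply: (@le_trans _ _ ((A * x t + B * \int[leb]_(r in `[0, t]) x r) ^+ 2)).
  by rewrite ler_sqr ?nnegrE// addr_ge0// mulr_ge0.
move: hI; set I' := \int[leb]_(r in `[0, t]) x r => hI.
apply: (@le_trans _ _ (2 * A ^+ 2 * x t ^+ 2 + 2 * B ^+ 2 * I' ^+ 2)).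
  by have := sqr_ge0 (A * x t - B * I'); rewrite !expr2; lra.
have B2 : 0 <= 2 * B ^+ 2 by rewrite mulr_ge0 ?sqr_ge0.
by rewrite lerD2l -[leRHS]mulrA; exact: (ler_wpM2l B2 hI).
Qed.

Lemma gronwall_integral (T c : R) x y : 0 <= T -> 0 <= c -> continuous x -> continuous y ->
  (forall t, 0 <= x t) -> (forall t, 0 <= y t) ->
  (forall t, 0 <= t <= T -> x t <= y t + c * \int[leb]_(r in `[0, t]) x r) ->
  \int[leb]_(r in `[0, T]) x r <= expR (c * T) * \int[leb]_(r in `[0, T]) y r.
Proof.
move=> T0 c0 cx cy x0 y0 h.
move: T0; rewrite le_eqVlt => /predU1P[<-|T0].
  by rewrite !set_itv1 !Rintegral_set1 mulr0.
pose W t := \int[leb]_(r in `[0, t]) x r.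
pose Y t := \int[leb]_(r in `[0, t]) y r.
pose Z t := expR (- (c * t)) * W t - Y t.
have cW : continuous W by exact: rconv1_continuous.
have cY : continuous Y by exact: rconv1_continuous.
have cE : continuous (fun t => expR (- (c * t))).
  apply: continuous_compf; first exact: continuous_expR.
  move=> t; apply: continuousN; apply: continuous_mulf; [exact: cst_continuous|].
  by move=> z; exact: cvg_id.
have cZ : continuous Z by apply: continuous_subf => //; exact: continuous_mulf.
have dZ t : 0 < t < T -> is_derive t 1 Z (expR (- (c * t)) * x t + W t * (- c * expR (- (c * t))) - y t).
  move=> /andP[t0 _].
  have dE : is_derive t 1 (fun t => expR (- (c * t))) (- c * expR (- (c * t))).
    have h1 : is_derive t 1 (fun r : R => - (c * r)) (- c).
      apply: is_deriveN; rewrite -{2}[c]mulr1; exact: (@is_deriveZ _ _ _ id c t 1 1 _).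
    rewrite mulrC; exact: (@is_derive1_comp _ expR (fun r : R => - (c * r)) t _ _ (is_derive_expR _) h1).
  have dW := is_derive_integral cx t0; have dY := is_derive_integral cy t0.
  exact: (is_deriveB (is_deriveM dE dW) dY).
have Zle t : t \in `]0, T[ -> derive1 Z t <= 0.
  rewrite in_itv/= => tT; have d := dZ t tT.
  rewrite derive1E derive_val subr_le0.
  have tT' : 0 <= t <= T by lra.
  have hx := h t tT'; rewrite -/(W t) in hx.
  have e0 := expR_gt0 (- (c * t)).
  have e1 : expR (- (c * t)) <= 1 by rewrite -expR0 ler_expR oppr_le0 mulr_ge0//; lra.
  have -> : expR (- (c * t)) * x t + W t * (- c * expR (- (c * t))) = expR (- (c * t)) * (x t - c * W t) by ring.
  apply: (@le_trans _ _ (expR (- (c * t)) * y t)); first by rewrite ler_pM2l//; lra.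
  by rewrite ler_piMl.
have der t : t \in `]0, T[ -> derivable Z t 1 by rewrite in_itv/= => tT; have [] := dZ t tT.
have := ler0_derive1_le_cc der Zle (continuous_subspaceT cZ).
move=> /(_ T 0); rewrite !in_itv/= !lexx (ltW T0) => /(_ isT isT isT).
have -> : Z 0 = 0 by rewrite /Z /W /Y set_itv1 !Rintegral_set1 mulr0 subrr.
rewrite /Z subr_le0 => hZ.
have e1 : W T = expR (c * T) * (expR (- (c * T)) * W T).
  by rewrite mulrA -expRD subrr expR0 mul1r.
by rewrite -/(W T) -/(Y T) {1}e1; apply: ler_wpM2l => //; exact: expR_ge0.
Qed.

Lemma volterra_lower (T e B : R) x y : 0 <= T -> 0 < e -> 0 <= B -> 
  continuous x -> continuous y ->
  (forall t, 0 <= x t) -> (forall t, 0 <= y t) ->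
  (forall t, 0 <= t <= T -> e * x t <= y t + B * \int[leb]_(r in `[0, t]) x r) ->
  \int[leb]_(r in `[0, T]) x r ^+ 2 <=
    expR (2 * B ^+ 2 * T / e ^+ 2 * T) * (2 / e ^+ 2) * \int[leb]_(r in `[0, T]) y r ^+ 2.
Proof.
move=> T0 e0 B0 cx cy x0 y0 h.
have c2 (z : R -> R) : continuous z -> continuous (fun r => z r ^+ 2).
  by move=> cz; under eq_fun do rewrite expr2; exact: continuous_mulf.
have e20 : 0 < e ^+ 2 by rewrite exprn_gt0.
rewrite -mulrA -RintegralZl//; last by apply: continuous_integrable; exact: c2.
apply: gronwall_integral => //.
- by rewrite divr_ge0 ?(ltW e20)// !mulr_ge0 ?sqr_ge0.
- exact: c2.
- by apply: continuous_mulf; [exact: cst_continuous|exact: c2].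
- by move=> t; rewrite sqr_ge0.
- by move=> t; rewrite mulr_ge0 ?sqr_ge0// divr_ge0// ltW.
move=> t tT.
have t0 : 0 <= t by lra.
have hI := sqr_integral_le cx t0.
have hJ : t * \int[leb]_(r in `[0, t]) x r ^+ 2 <= T * \int[leb]_(r in `[0, t]) x r ^+ 2.
  by apply: ler_wpM2r; [apply: Rintegral_ge0 => r _; exact: sqr_ge0|lra].
have {}hI := le_trans hI hJ.
have I0 : 0 <= \int[leb]_(r in `[0, t]) x r by apply: Rintegral_ge0.
have := h t tT; move: hI I0.
set I := \int[leb]_(r in _) x r; set J := \int[leb]_(r in _) _ => hI I0 hx.
have hx2 : (e * x t) ^+ 2 <= (y t + B * I) ^+ 2.
  by rewrite ler_sqr ?nnegrE ?addr_ge0 ?mulr_ge0// ltW.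
have hx3 : (y t + B * I) ^+ 2 <= 2 * y t ^+ 2 + 2 * B ^+ 2 * (T * J).
  apply: (@le_trans _ _ (2 * y t ^+ 2 + 2 * B ^+ 2 * I ^+ 2)).
    by have := sqr_ge0 (y t - B * I); rewrite !expr2; lra.
  by rewrite lerD2l; apply: ler_wpM2l => //; rewrite mulr_ge0 ?sqr_ge0.
have := le_trans hx2 hx3; rewrite exprMn.
rewrite mulrC -ler_pdivlMr// => hh; apply: le_trans hh _.
by rewrite le_eqVlt; apply/orP; left; apply/eqP; field; rewrite gt_eqF.
Qed.

End Gronwall.

Section HilbertBasics.
Variables (R : realType) (s : scalar_kind) (G : hilbert R s).
Local Notation K := (scalars R s).
Local Notation "<< x , y >>" := (inner G x y).
Implicit Types x y z : G.

Lemma innerC x y : << x, y >> = conjS R s << y, x >>.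
Proof. by have := @hermitian_subproof _ _ _ _ (inner G) x y; rewrite expr0 mul1r. Qed.

Lemma innerDl x y z : << x + y, z >> = << x, z >> + << y, z >>.
Proof. exact: linearDl. Qed.

Lemma innerBl x y z : << x - y, z >> = << x, z >> - << y, z >>.
Proof. exact: linearBl. Qed.

Lemma inner0l z : << 0, z >> = 0.
Proof. exact: linear0l. Qed.

Lemma innerZl (a : K) x z : << a *: x, z >> = a * << x, z >>.
Proof. exact: linearZl_LR. Qed.

Lemma innerDr x y z : << x, y + z >> = << x, y >> + << x, z >>.
Proof. by rewrite innerC innerDl rmorphD -!innerC. Qed.

Lemma innerBr x y z : << x, y - z >> = << x, y >> - << x, z >>.
Proof. by rewrite innerC innerBl rmorphB -!innerC. Qed.

Lemma innerZr (a : K) x z : << x, a *: z >> = conjS R s a * << x, z >>.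
Proof. by rewrite innerC innerZl rmorphM -innerC. Qed.

Lemma inner0r z : << z, 0 >> = 0.
Proof. by rewrite innerC inner0l rmorph0. Qed.

Lemma inner_suml (I : Type) (r : seq I) (P : pred I) (F : I -> G) z :
  << \sum_(i <- r | P i) F i, z >> = \sum_(i <- r | P i) << F i, z >>.
Proof.
by elim/big_rec2 : _ => [|i y1 y2 _ <-]; rewrite ?inner0l// innerDl.
Qed.

Lemma inner_sumr (I : Type) (r : seq I) (P : pred I) (F : I -> G) z :
  << z, \sum_(i <- r | P i) F i >> = \sum_(i <- r | P i) << z, F i >>.
Proof.
by elim/big_rec2 : _ => [|i y1 y2 _ <-]; rewrite ?inner0r// innerDr.
Qed.

Lemma innerxx x : << x, x >> = ofR s (rnorm x ^+ 2).
Proof. by rewrite -norm_inner ofR_rnorm rmorphXn. Qed.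

Lemma rnorm_sqrD x y :
  rnorm (x + y) ^+ 2 = rnorm x ^+ 2 + 2 * reS << x, y >> + rnorm y ^+ 2.
Proof.
have sq z : rnorm z ^+ 2 = reS << z, z >> by rewrite innerxx reS_ofR.
rewrite !sq innerDl !innerDr !reSD [<< y, x >>]innerC reS_conj; ring.
Qed.

Lemma rnorm_sqrB x y :
  rnorm (x - y) ^+ 2 = rnorm x ^+ 2 - 2 * reS << x, y >> + rnorm y ^+ 2.
Proof.
by rewrite rnorm_sqrD rnormN -scaleN1r innerZr rmorphN1 mulN1r reSN; ring.
Qed.

Lemma cauchy_schwarz x y : absS << x, y >> <= rnorm x * rnorm y.
Proof.
have [y0|y0] := eqVneq (rnorm y) 0.
  by rewrite (rnorm_eq0 y0) inner0r rnorm0 absS0 mulr0.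
have yp : 0 < rnorm y by rewrite lt_neqAle eq_sym y0 rnorm_ge0.
rewrite -(@ler_pXn2r _ 2) ?nnegrE ?absS_ge0 ?mulr_ge0 ?rnorm_ge0//.
pose a := ofR s (rnorm y ^- 2) * << x, y >>.
have := sqr_ge0 (rnorm (x - a *: y)).
rewrite rnorm_sqrB innerZr rnormZ exprMn.
have aE : absS a = rnorm y ^- 2 * absS << x, y >>.
  by rewrite /a absSM absS_ofR ger0_norm// invr_ge0 exprn_ge0// rnorm_ge0.
have -> : reS (conjS R s a * << x, y >>) = rnorm y ^- 2 * absS << x, y >> ^+ 2.
  rewrite /a rmorphM -mulrA [conjS R s << x, y >> * _]mulrC mulS_conj.
  have -> : conjS R s (ofR s (rnorm y ^- 2)) = ofR s (rnorm y ^- 2).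
    by apply: scalars_ext; rewrite (reS_conj, imS_conj) // imS_ofR oppr0.
  by rewrite -rmorphM reS_ofR.
rewrite aE; set n := rnorm y; set m := absS _; set p := rnorm x => h.
have : 0 <= n ^+ 2 * (p ^+ 2 - 2 * (n ^- 2 * m ^+ 2) + (n ^- 2 * m) ^+ 2 * n ^+ 2).
  by rewrite mulr_ge0// exprn_ge0// ltW.
have -> : n ^+ 2 * (p ^+ 2 - 2 * (n ^- 2 * m ^+ 2) + (n ^- 2 * m) ^+ 2 * n ^+ 2) =
   (p * n) ^+ 2 - m ^+ 2 by field.
by rewrite subr_ge0.
Qed.

End HilbertBasics.

Section VectorFunctions.
Variables (R : realType) (s : scalar_kind) (G : hilbert R s) (T : R).
Hypothesis T0 : 0 < T.
Local Notation K := (scalars R s).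
Local Notation C := (cfun s T).
Local Notation leb := (@lebesgue_measure R).
Local Notation "<< x , y >>" := (inner G x y).

Definition vcomb p (a_ : nat -> C) (v_ : nat -> G) (t : R) : G :=
  \sum_(n < p) a_ n t *: v_ n.

Lemma vcomb_continuous p a_ v_ : forall t (e : R), 0 < e -> exists2 d : R, 0 < d &
  forall x : R, `|x - t| < d -> rnorm (vcomb p a_ v_ x - vcomb p a_ v_ t) < e.
Proof.
elim: p => [|p ih] t e e0.
  by exists 1 => // x _; rewrite /vcomb !big_ord0 subrr rnorm0.
have e2 : 0 < e / 2 by lra.
have [d d0 hd] := ih t _ e2.
have v0 := rnorm_ge0 (v_ p).
have e3 : 0 < e / 2 / (rnorm (v_ p) + 1) by rewrite divr_gt0//; lra.
have [d' d'0 hd'] := (contS_eps (a_ p)).2 (cfun_contS (a_ p)) t _ e3.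
exists (Num.min d d'); first by rewrite lt_min d0.
move=> x; rewrite lt_min => /andP[/hd h1 /hd' h2].
rewrite /vcomb !big_ord_recr /= opprD addrACA -scalerBl.
apply: le_lt_trans (ler_rnormD _ _) _.
have : rnorm ((a_ p x - a_ p t) *: v_ p) <= e / 2.
  rewrite rnormZ; move: h2; rewrite ltr_pdivlMr; last by lra.
  move=> h2; apply: le_trans (ltW h2); apply: ler_wpM2l; [exact: absS_ge0|lra].
by move: h1; rewrite /vcomb; lra.
Qed.

Lemma continuous_rnorm_vcomb p a_ v_ : continuous (fun t => rnorm (vcomb p a_ v_ t)).
Proof. exact/continuous_rnorm/vcomb_continuous. Qed.

Lemma cfun_sumE p (a_ : nat -> C) t : (\sum_(n < p) a_ n : C) t = \sum_(n < p) a_ n t.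
Proof. by elim/big_ind2 : _ => // x1 x2 y1 y2 <- <-. Qed.

(* duality: the norm of a vector-valued convolution is estimated by pairing it
   with itself, which reduces the estimate to a scalar convolution *)
Lemma rnorm_vconv (k w : C) ck cw p (a_ : nat -> C) v_ t : nb k ck -> nb w cw -> 0 <= t <= T ->
  rnorm (vcomb p (fun n => cconv k (pmul w (a_ n))) v_ t) <=
    ck * cw * \int[leb]_(r in `[0, t]) rnorm (vcomb p a_ v_ r).
Proof.
move=> hk hw tT; set J := vcomb _ _ _ _.
have ck0 := nb_ge0 T0 hk; have cw0 := nb_ge0 T0 hw.
have int0 : 0 <= \int[leb]_(r in `[0, t]) rnorm (vcomb p a_ v_ r).
  by apply: Rintegral_ge0 => r _; exact: rnorm_ge0.
have [->|J0] := eqVneq (rnorm J) 0; first by rewrite !mulr_ge0.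
have Jp : 0 < rnorm J by rewrite lt_neqAle eq_sym J0 rnorm_ge0.
rewrite -(ler_pM2l Jp) -expr2.
pose ph : C := \sum_(n < p) << v_ n, J >> *: a_ n.
have phE r : ph r = << vcomb p a_ v_ r, J >>.
  rewrite /ph (cfun_sumE p (fun n => << v_ n, J >> *: a_ n)) inner_suml; apply: eq_bigr => n _.
  by rewrite cfunZE innerZl mulrC.
have -> : rnorm J ^+ 2 = reS (cconv k (pmul w ph) t).
  rewrite -[LHS](@reS_ofR R s) -innerxx {1}/J inner_suml; congr reS.
  have -> : cconv k (pmul w ph) = \sum_(n < p) << v_ n, J >> *: cconv k (pmul w (a_ n)).
    rewrite /ph; elim: (p) => [|q ih].
      rewrite !big_ord0 (_ : pmul w 0 = 0) ?cconv0//.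
      by apply: cfun_ext; [move=> r _; rewrite pmulE cfun0E mulr0|exact: ltW].
    rewrite !big_ord_recr /= -ih -cconvZr -cconvDr -pmulZr//; congr cconv.
    by apply: cfun_ext; [move=> r _; rewrite !(pmulE, cfunDE) mulrDr|exact: ltW].
  rewrite (cfun_sumE p (fun n => << v_ n, J >> *: cconv k (pmul w (a_ n)))).
  by apply: eq_bigr => n _; rewrite innerZl cfunZE mulrC.
apply: le_trans (le_trans (ler_norm _) (ler_reS _)) _.
apply: le_trans (cconv_abs k (pmul w ph) tT) _.
rewrite mulrA [rnorm J * _]mulrC -mulrA -!RintegralZl//; last 2 first.
- apply: continuous_integrable; apply: continuous_mulf; [exact: cst_continuous|exact: continuous_rnorm_vcomb].
- by apply: continuous_integrable; exact: continuous_rnorm_vcomb.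
apply: le_integral_continuous.
- apply: continuous_mulf; last exact: contS_absS (cfun_contS _).
  apply: (@continuous_reflect _ (fun x => absS (k x))); exact: contS_absS (cfun_contS _).
- do 2 (apply: continuous_mulf; first exact: cst_continuous); exact: continuous_rnorm_vcomb.
move=> r rt; rewrite -mulrA; apply: ler_pM; rewrite ?absS_ge0//; first by apply: hk; lra.
rewrite pmulE absSM; apply: ler_pM; rewrite ?absS_ge0//; first by apply: hw; lra.
by rewrite phE mulrC; exact: cauchy_schwarz.
Qed.

Lemma rnorm_vcomb_volterra (al : C) (k w : nat -> C) (c : R) p (S_ D_ : nat -> C) v_ t :
  (forall j, nb (k j) (c / 2 ^+ j)) -> (forall j, nb (w j) c) ->
  (forall n, exists c', forall J,
     nb (D_ n - pmul al (S_ n) - \sum_(j < J) cconv (k j) (pmul (w j) (S_ n))) (c' / 2 ^+ J)) ->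
  0 <= t <= T ->
  rnorm (vcomb p D_ v_ t - al t *: vcomb p S_ v_ t) <=
    2 * c ^+ 2 * \int[leb]_(r in `[0, t]) rnorm (vcomb p S_ v_ r).
Proof.
move=> hk hw hD tT; set I := \int[leb]_(r in _) _.
have I0 : 0 <= I by apply: Rintegral_ge0 => r _; exact: rnorm_ge0.
have c0 := nb_ge0 T0 (hw 0%N).
have [b bE] : exists b : nat -> R, forall n J, nb (D_ n - pmul al (S_ n) - \sum_(j < J) cconv (k j) (pmul (w j) (S_ n))) (b n / 2 ^+ J).
  by have [b hb] := choice hD; exists b.
pose B := \sum_(n < p) b n * rnorm (v_ n).
have key J : rnorm (vcomb p D_ v_ t - al t *: vcomb p S_ v_ t) <= B / 2 ^+ J + 2 * c ^+ 2 * I.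
  have -> : vcomb p D_ v_ t - al t *: vcomb p S_ v_ t =
     vcomb p (fun n => D_ n - pmul al (S_ n) - \sum_(j < J) cconv (k j) (pmul (w j) (S_ n))) v_ t +
     \sum_(j < J) vcomb p (fun n => cconv (k j) (pmul (w j) (S_ n))) v_ t.
    rewrite /vcomb [X in _ = _ + X]exchange_big /= scaler_sumr -sumrB -big_split /=.
    apply: eq_bigr => n _; rewrite -scaler_suml -scalerDl scalerA -scalerBl; congr (_ *: _).
    rewrite -[RHS]/((D_ n - pmul al (S_ n) - \sum_(j < J) cconv (k j) (pmul (w j) (S_ n)) : C) t +
      \sum_(j < J) cconv (k j) (pmul (w j) (S_ n)) t).
    by rewrite !cfunDE !cfunNE (cfun_sumE J (fun j => cconv (k j) (pmul (w j) (S_ n)))) pmulE subrK.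
  apply: le_trans (ler_rnormD _ _) _; apply: lerD.
    apply: le_trans (ler_rnorm_sum _ _) _; rewrite /B mulr_suml; apply: ler_sum => n _.
    by rewrite rnormZ mulrAC; apply: ler_wpM2r; [exact: rnorm_ge0|exact: bE].
  apply: le_trans (ler_rnorm_sum _ _) _.
  apply: (@le_trans _ _ (\sum_(j < J) c / 2 ^+ j * (c * I))).
    apply: ler_sum => j _; rewrite mulrA; exact: rnorm_vconv.
  rewrite -mulr_suml.
  have -> : 2 * c ^+ 2 * I = 2 * c * (c * I) by ring.
  apply: ler_wpM2r; first by rewrite mulr_ge0.
  suff -> : \sum_(j < J) c / 2 ^+ j = 2 * c - 2 * c / 2 ^+ J.
    by rewrite gerBl divr_ge0 ?mulr_ge0// exprn_ge0.
  elim: J => [|J ih]; first by rewrite big_ord0 expr0 divr1 subrr.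
  rewrite big_ord_recr /= ih exprS invfM; have : (2 ^+ J : R) != 0 by rewrite expf_neq0.
  by move=> ?; field.
apply/ler_addgt0Pr => e e0.
have := cvg_geometric B (_ : `|2^-1| < 1 :> R).
rewrite ger0_norm ?invr_ge0// => /(_ _)/cvgrPdist_lt/(_ e e0).
have h2 : 2^-1 < 1 :> R by lra.
move=> /(_ h2)[N _ /(_ N (leqnn N))]; rewrite /geometric /= sub0r normrN exprVn.
move=> /(le_lt_trans (ler_norm _)) h; apply: le_trans (key N) _; lra.
Qed.

End VectorFunctions.

Section VolterraEquivalence.
Variables (R : realType) (s : scalar_kind) (G : hilbert R s) (T : R).
Hypothesis T0 : 0 < T.
Local Notation K := (scalars R s).
Local Notation C := (cfun s T).
Local Notation leb := (@lebesgue_measure R).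

(* D = al S + sum_j (k j) * (w j S), with geometric convergence of the series *)
Definition volterra_image (al : C) (k w : nat -> C) (S D : C) :=
  exists c', forall J : nat,
     nb (D - pmul al S - \sum_(j < J) cconv (k j) (pmul (w j) S)) (c' / 2 ^+ J).

Lemma volterra_equivalence (al : C) (k w : nat -> C) (e c : R) : 0 < e ->
  (forall t, 0 <= t <= T -> e <= absS (al t)) ->
  (forall j, nb (k j) (c / 2 ^+ j)) -> (forall j, nb (w j) c) ->
  exists2 b : R, 0 < b & forall p (S_ D_ : nat -> C) (v_ : nat -> G),
    (forall n, volterra_image al k w (S_ n) (D_ n)) ->
    \int[leb]_(r in `[0, T]) rnorm (vcomb p D_ v_ r) ^+ 2 <=
      b * \int[leb]_(r in `[0, T]) rnorm (vcomb p S_ v_ r) ^+ 2 /\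
    \int[leb]_(r in `[0, T]) rnorm (vcomb p S_ v_ r) ^+ 2 <=
      b * \int[leb]_(r in `[0, T]) rnorm (vcomb p D_ v_ r) ^+ 2.
Proof.
move=> e0 hal hk hw.
have [A A0 hA] := nb_exists al.
pose B := 2 * c ^+ 2.
have B0 : 0 <= B by rewrite mulr_ge0// sqr_ge0.
pose b1 := 2 * A ^+ 2 + 2 * B ^+ 2 * T ^+ 2.
pose b2 := expR (2 * B ^+ 2 * T / e ^+ 2 * T) * (2 / e ^+ 2).
have b10 : 0 <= b1.
  have q x : 0 <= 2 * x ^+ 2 :> R by rewrite mulr_ge0// sqr_ge0.
  by apply: addr_ge0 => //; rewrite mulr_ge0// sqr_ge0.
have b20 : 0 <= b2 by rewrite mulr_ge0 ?expR_ge0// divr_ge0// sqr_ge0.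
exists (b1 + b2 + 1); first by lra.
move=> p S_ D_ v_ hD.
have key t : 0 <= t <= T -> rnorm (vcomb p D_ v_ t - al t *: vcomb p S_ v_ t) <=
    B * \int[leb]_(r in `[0, t]) rnorm (vcomb p S_ v_ r).
  by move=> tT; apply: (@rnorm_vcomb_volterra _ _ _ _ T0 al k w).
have cD := @continuous_rnorm_vcomb R s G T p D_ v_.
have cS := @continuous_rnorm_vcomb R s G T p S_ v_.
have int0 a_ : 0 <= \int[leb]_(r in `[0, T]) rnorm (@vcomb R s G T p a_ v_ r) ^+ 2.
  by apply: Rintegral_ge0 => r _; exact: sqr_ge0.
have T0' := ltW T0.
split.
- apply: le_trans (@volterra_upper R T A B (fun t => rnorm (vcomb p S_ v_ t))
    (fun t => rnorm (vcomb p D_ v_ t)) T0' A0 B0 cS cD (fun=> rnorm_ge0 _) (fun=> rnorm_ge0 _) _) _.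
    move=> t tT; apply: le_trans (lerD (lexx _) (key t tT)).
    rewrite -[X in rnorm X <= _](subrK (al t *: vcomb p S_ v_ t)).
    apply: le_trans (ler_rnormD _ _) _; rewrite addrC lerD2r rnormZ.
    by apply: ler_wpM2r; [exact: rnorm_ge0|exact: hA].
  by apply: ler_wpM2r => //; rewrite /b1; lra.
- apply: le_trans (@volterra_lower R T e B (fun t => rnorm (vcomb p S_ v_ t))
    (fun t => rnorm (vcomb p D_ v_ t)) T0' e0 B0 cS cD (fun=> rnorm_ge0 _) (fun=> rnorm_ge0 _) _) _.
    move=> t tT; apply: le_trans (lerD (lexx _) (key t tT)).
    apply: (@le_trans _ _ (rnorm (al t *: vcomb p S_ v_ t))).
      by rewrite rnormZ; apply: ler_wpM2r; [exact: rnorm_ge0|exact: hal].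
    rewrite -[X in rnorm X <= _](subKr (vcomb p D_ v_ t)).
    by apply: le_trans (ler_rnormD _ _) _; rewrite rnormN.
  by apply: ler_wpM2r => //; rewrite /b2; lra.
Qed.

Lemma nb_volterra_image (al : C) (k w : nat -> C) (A c m : R) S D :
  nb al A -> (forall j, nb (k j) (c / 2 ^+ j)) -> (forall j, nb (w j) c) ->
  nb S m -> volterra_image al k w S D -> nb D (A * m + 2 * (T * c * (c * m))).
Proof.
move=> hA hk hw hS [c' hD].
have A0 := nb_ge0 T0 hA; have c0 := nb_ge0 T0 (hw 0%N); have m0 := nb_ge0 T0 hS.
have hsum J : nb (\sum_(j < J) cconv (k j) (pmul (w j) S)) (2 * (T * c * (c * m))).
  apply: (@nb_le _ _ _ _ (2 * (T * c * (c * m)) - 2 * (T * c * (c * m)) / 2 ^+ J)).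
    by rewrite gerBl divr_ge0 ?mulr_ge0 ?exprn_ge0// ltW.
  elim: J => [|J ih].
    rewrite big_ord0 expr0 divr1 subrr; exact: nb0.
  rewrite big_ord_recr /=.
  apply: nb_le (nbD ih (nb_conv T0 (hk J) (nb_pmul (hw J) hS))).
  rewrite exprS le_eqVlt; apply/orP; left; apply/eqP.
  by field; rewrite expf_neq0.
move=> t tT; apply/ler_addgt0Pr => e e0.
have [N hN] : exists N, c' / 2 ^+ N <= e.
  have := @cvg_geometric R c' 2^-1; rewrite ger0_norm ?invr_ge0//.
  have h2 : 2^-1 < 1 :> R by lra.
  move=> /(_ h2)/cvgrPdist_lt/(_ e e0)[N _ /(_ N (leqnn N))].
  rewrite /geometric /= sub0r normrN exprVn => h; exists N.
  exact: le_trans (ler_norm _) (ltW h).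
have := nbD (nbD (hD N) (hsum N)) (nb_pmul hA hS).
rewrite subrK subrK => /(_ t tT) h; apply: le_trans h _; lra.
Qed.

End VolterraEquivalence.

(** * Square integrable functions with values in a Hilbert space *)

Section StrongMeasurability.
Variables (R : realType) (s : scalar_kind).
Local Notation K := (scalars R s).
Local Notation leb := (@lebesgue_measure R).

(* The field of scalars of V need not be the field R on which g is defined, which
   rules out the metric lemmas of the library on continuity. *)
Definition econt (V : normedModType K) (g : R -> V) := forall t (e : R), 0 < e ->
  exists2 d : R, 0 < d & forall x : R, `|x - t| < d -> rnorm (g x - g t) < e.

Lemma econt_uniform (V : normedModType K) (g : R -> V) (a b e : R) : econt g -> 0 < e ->
  exists2 d : R, 0 < d & forall x y : R, a <= x <= b -> `|y - x| < d -> rnorm (g y - g x) < e.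
Proof.
move=> cg e0.
have /compact_near_coveringP/(_ _ (0^'+ : set_system R) (fun d x => forall y : R, `|y - x| < d -> rnorm (g y - g x) < e)) := @segment_compact R a b.
move=> /(_ _)[|d' /= ].
  move=> x xab; have e2 : 0 < e / 2 by lra.
  have [d d0 hd] := cg x _ e2.
  have d2 : 0 < d / 2 by lra.
  exists (ball x (d / 2), [set z : R | 0 < z < d / 2]) => /=; first split.
  - exact: nbhsx_ballx.
  - by near=> z; apply/andP; split; near: z; [exact: nbhs_right_gt|exact: nbhs_right_lt].
  - move=> [x' z] /= [xx' /andP[z0 zd]] y yx'.
    rewrite /ball /= in xx'.
    have h1 : rnorm (g y - g x) < e / 2.
      apply: hd; apply: le_lt_trans (ler_distD x' _ _) _.
      by rewrite (distrC x'); lra.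
    have h2 : rnorm (g x' - g x) < e / 2 by apply: hd; rewrite distrC; lra.
    have -> : g y - g x' = (g y - g x) - (g x' - g x) by rewrite opprB addrA subrK.
    by apply: le_lt_trans (ler_rnormD _ _) _; rewrite rnormN; lra.
move=> d'0 hd; exists (d' / 2); first by lra.
move=> x y xab yx; apply: (hd (d' / 2)) => //=; last by lra.
by rewrite sub0r normrN ger0_norm; lra.
Unshelve. all: by end_near.
Qed.

Definition simple (X : Type) (f : R -> X) :=
  finite_set (range f) /\ forall v, measurable (f @^-1` [set v]).

Lemma simple_preimage (X : Type) (f : R -> X) (Q : set X) : simple f ->
  measurable (f @^-1` Q).
Proof.
move=> [fin mf].
have -> : f @^-1` Q = \bigcup_(v in range f `&` Q) (f @^-1` [set v]).
  apply/seteqP; split=> [x Qx|x [v [_ Qv] fv]]; last by rewrite /preimage /= fv.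
  by exists (f x) => //; split => //; exists x.
apply: fin_bigcup_measurable => //; exact: finite_setIl.
Qed.

Lemma simple_comp (X Y : Type) (f : R -> X) (g : X -> Y) : simple f -> simple (g \o f).
Proof.
move=> sf; split; last by move=> v; exact: (simple_preimage (g @^-1` [set v]) sf).
by have := finite_image g sf.1; rewrite image_comp.
Qed.

Lemma simple_pair (X Y : Type) (f : R -> X) (g : R -> Y) : simple f -> simple g ->
  simple (fun x => (f x, g x)).
Proof.
move=> [ff mf] [fg mg]; split.
  apply: (@sub_finite_set _ _ (range f `*` range g)); last exact: finite_setX.
  by move=> _ [x _ <-]; split; exists x.
move=> [a b].
have -> : (fun x => (f x, g x)) @^-1` [set (a, b)] = (f @^-1` [set a]) `&` (g @^-1` [set b]).
  by apply/seteqP; split=> x /= [-> ->].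
exact: measurableI.
Qed.

Lemma simple_indic (D : set R) : measurable D -> simple (fun x => `[< D x >]).
Proof.
move=> mD; split.
  apply: (@sub_finite_set _ _ [set true; false]); last exact: finite_set2.
  by move=> [] _; [left|right].
move=> [].
  have -> : (fun x => `[< D x >]) @^-1` [set true] = D; last by [].
  by apply/seteqP; split => x /=; [move/asboolP|move=> ?; exact/asboolP].
have -> : (fun x => `[< D x >]) @^-1` [set false] = ~` D; last exact: measurableC.
by apply/seteqP; split => x /=; [move/asboolPn|move=> ?; exact/asboolPn].
Qed.

Lemma simple_step (T : R) (k : nat) : 0 < T -> exists f : R -> R, simple f /\
  forall t, 0 <= t <= T -> 0 <= f t <= T /\ `|f t - t| <= 2^-1 ^+ k.
Proof.
move=> T0; pose p t := Num.truncn (2 ^+ k * clamp T t).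
have p2 : 0 < (2 ^+ k : R) by rewrite exprn_gt0.
have cl0 t : 0 <= 2 ^+ k * clamp T t by rewrite mulr_ge0 ?clamp_ge0// ltW.
have pE t j : p t = j <-> (j%:R <= 2 ^+ k * clamp T t < j.+1%:R).
  split; first by move=> <-; exact: truncn_itv.
  by move=> h; apply/eqP; rewrite truncn_eq.
exists (fun t => (p t)%:R / 2 ^+ k); split; last first.
  move=> t tT; have := (pE t (p t)).1 erefl; rewrite (clamp_id tT) -[(p t).+1%:R]natr1 => /andP[h1 h2].
  have h3 : (p t)%:R / 2 ^+ k <= t by rewrite ler_pdivrMr// mulrC.
  have h4 : t < (p t)%:R / 2 ^+ k + 2^-1 ^+ k.
    by rewrite exprVn -[X in _ + X]mul1r -mulrDl ltr_pdivlMr// mulrC.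
  have h5 : 0 <= (p t)%:R / 2 ^+ k :> R by rewrite divr_ge0// ltW.
  by split; [lra|rewrite distrC ger0_norm; lra].
apply: (@simple_comp _ _ p (fun j => j%:R / 2 ^+ k)); split.
  apply: (@sub_finite_set _ _ `I_(p T).+1); last exact: finite_II.
  move=> _ [t _ <-] /=; rewrite ltnS; apply: le_truncn.
  rewrite ler_pM2l// (_ : clamp T T = T); last by apply: clamp_id; rewrite lexx ltW.
  by have /andP[] := clamp_itv t (ltW T0).
move=> j.
have -> : p @^-1` [set j] = (fun t => 2 ^+ k * clamp T t) @^-1` `[j%:R, j.+1%:R[.
  by apply/seteqP; split => t /=; rewrite in_itv/=; move/pE.
rewrite -[X in measurable X]setTI; apply: (@measurable_realfun.continuous_measurable_fun R _ _) => //.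
apply: continuous_mulf; [exact: cst_continuous|exact: continuous_clamp].
Qed.

End StrongMeasurability.

Section L2Functions.
Variables (R : realType) (s : scalar_kind) (T : R).
Hypothesis T0 : 0 < T.
Local Notation K := (scalars R s).
Local Notation leb := (@lebesgue_measure R).

Lemma near_exp2 (e : R) : 0 < e -> \forall k \near \oo, 2^-1 ^+ k < e.
Proof.
move=> e0; have h2 : `|2^-1| < 1 :> R by rewrite ger0_norm ?invr_ge0//; lra.
have /cvgrPdist_lt/(_ e e0) := @cvg_geometric R 1 2^-1 h2.
apply: filterS => k; rewrite /geometric /= mul1r sub0r normrN.
exact: le_lt_trans (ler_norm _).
Qed.

Lemma strongly_measurable_lim (V : normedModType K) (F_ : nat -> R -> V) (E : set R)
    (g : R -> V) :
  (forall k, econt (F_ k)) -> measurable E ->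
  (forall t, 0 <= t <= T -> E t -> F_ k t @[k --> \oo] --> g t) ->
  (forall t, 0 <= t <= T -> ~ E t -> g t = 0) ->
  strongly_measurable T g.
Proof.
move=> cF mE Fg g0.
have H (k : nat) : exists h : R -> V, simple h /\
    forall t, 0 <= t <= T -> rnorm (h t - F_ k t) < 2^-1 ^+ k.
  have e0 : 0 < 2^-1 ^+ k :> R by rewrite exprn_gt0// invr_gt0.
  have [d d0 hd] := econt_uniform 0 T (cF k) e0.
  have [m _ /(_ m (leqnn m)) hm] := near_exp2 d0.
  have [f [sf hf]] := simple_step m T0.
  exists (F_ k \o f); split; first exact: simple_comp.
  move=> t tT; apply: hd => //; have [_ hft] := hf t tT.
  exact: le_lt_trans hft hm.
have [h /all_and2[sh hh]] := choice H.
exists (fun k => (fun p : bool * V => if p.1 then p.2 else 0) \o (fun t => (`[< E t >], h k t))).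
split.
  move=> k; apply: simple_comp; apply: simple_pair => //; exact: simple_indic.
move=> t tT /=; case: asboolP => Et; last by rewrite g0//; exact: cvg_cst.
apply/rnorm_cvgP => e e0; have e2 : 0 < e / 2 by lra.
have /rnorm_cvgP/(_ _ e2) := Fg t tT Et.
have := near_exp2 e2; apply: filterS2 => k hk1 hk2.
have -> : g t - h k t = (g t - F_ k t) - (h k t - F_ k t) by rewrite opprB addrA subrK.
apply: le_lt_trans (ler_rnormD _ _) _; rewrite rnormN.
by have := hh k t tT; lra.
Qed.

Lemma strongly_measurable_econt (V : normedModType K) (g : R -> V) : econt g ->
  strongly_measurable T g.
Proof.
move=> cg; apply: (@strongly_measurable_lim _ (fun=> g) setT) => //.
  by move=> t _ _; exact: cvg_cst.
by move=> t _ /(_ I).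
Qed.

Lemma simple_measurable (D : set R) (f : R -> R) : measurable D -> simple f ->
  measurable_fun D f.
Proof.
move=> mD sf _ Y _; apply: measurableI => //; exact: simple_preimage.
Qed.

Lemma strongly_measurable2 (V W : normedModType K) (g : R -> V) (h : R -> W)
    (phi : V -> W -> R) :
  (forall (v_ : nat -> V) (w_ : nat -> W) v w, v_ @ \oo --> v -> w_ @ \oo --> w ->
    phi (v_ k) (w_ k) @[k --> \oo] --> phi v w) ->
  strongly_measurable T g -> strongly_measurable T h ->
  measurable_fun `[0, T]%classic (fun t => phi (g t) (h t)).
Proof.
move=> cphi [g_ [sg hg]] [h_ [sh hh]].
apply: (@measurable_fun_cvg _ _ _ _ (fun k t => phi (g_ k t) (h_ k t))).
  move=> k; apply: simple_measurable => //.
  apply: (@simple_comp _ _ _ (fun t => (g_ k t, h_ k t)) (fun p => phi p.1 p.2)).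
  by apply: simple_pair; [exact: sg|exact: sh].
move=> t; rewrite /= in_itv/= => tT; apply: cphi; [exact: hg|exact: hh].
Qed.

Lemma cvg_squeeze0 (u v : nat -> R) (l : R) : (forall k, `|u k - l| <= v k) ->
  v @ \oo --> 0 -> u @ \oo --> l.
Proof.
move=> h /cvgrPdist_lt hv; apply/cvgrPdist_lt => e /hv; apply: filterS => k.
rewrite sub0r normrN distrC => hk.
exact: le_lt_trans (le_trans (h k) (ler_norm _)) hk.
Qed.

Lemma rnorm_dist0 (V : normedModType K) (v_ : nat -> V) v : v_ @ \oo --> v <->
  rnorm (v_ k - v) @[k --> \oo] --> 0.
Proof.
split.
  move=> /rnorm_cvgP h; apply/cvgrPdist_lt => e /h; apply: filterS => k.
  by rewrite sub0r normrN ger0_norm ?rnorm_ge0// rdistC.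
move=> /cvgrPdist_lt h; apply/rnorm_cvgP => e /h; apply: filterS => k.
by rewrite sub0r normrN ger0_norm ?rnorm_ge0// rdistC.
Qed.

Lemma cvg_rnormB (V : normedModType K) (v_ w_ : nat -> V) v w : v_ @ \oo --> v ->
  w_ @ \oo --> w -> rnorm (v_ k - w_ k) @[k --> \oo] --> rnorm (v - w).
Proof.
move=> /rnorm_dist0 hv /rnorm_dist0 hw.
apply: (@cvg_squeeze0 _ (fun k => rnorm (v_ k - v) + rnorm (w_ k - w))).
  move=> k; apply: le_trans (ler_rdist _ _) _.
  rewrite opprB addrACA [X in rnorm X](_ : _ = (v_ k - v) - (w_ k - w)).
    by rewrite -[rnorm (w_ k - w)]rnormN ler_rnormD.
  by rewrite opprB [- w_ k - v]addrC addrACA.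
by rewrite -(addr0 0); exact: cvgD.
Qed.

Section Inner.
Variable G : hilbert R s.
Local Notation "<< x , y >>" := (inner G x y).

Lemma cvg_inner (v_ w_ : nat -> G) v w : v_ @ \oo --> v -> w_ @ \oo --> w ->
  absS (<< v_ k, w_ k >> - << v, w >>) @[k --> \oo] --> 0.
Proof.
move=> /rnorm_dist0 hv /rnorm_dist0 hw.
apply: (@cvg_squeeze0 _ (fun k => rnorm (v_ k - v) * rnorm (w_ k - w) +
    (rnorm (v_ k - v) * rnorm w + rnorm v * rnorm (w_ k - w)))).
  move=> k; rewrite subr0 ger0_norm ?absS_ge0//.
  have -> : << v_ k, w_ k >> - << v, w >> =
     << v_ k - v, w_ k - w >> + (<< v_ k - v, w >> + << v, w_ k - w >>).
    by rewrite !(innerBl, innerBr); ring.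
  apply: le_trans (absSD _ _) _; apply: lerD; first exact: cauchy_schwarz.
  by apply: le_trans (absSD _ _) _; apply: lerD; exact: cauchy_schwarz.
have -> : (0 : R) = 0 * 0 + (0 * rnorm w + rnorm v * 0) by ring.
apply: cvgD; first exact: cvgM.
by apply: cvgD; apply: cvgM => //; exact: cvg_cst.
Qed.

Implicit Types g h : R -> G.

Lemma measurable_reS_inner g h : strongly_measurable T g -> strongly_measurable T h ->
  measurable_fun `[0, T]%classic (fun t => reS << g t, h t >>).
Proof.
apply: (@strongly_measurable2 _ _ g h (fun x y => reS << x, y >>)) => v_ w_ v w hv hw.
apply: (cvg_squeeze0 _ (cvg_inner hv hw)) => k; rewrite -raddfB; exact: ler_reS.
Qed.

Lemma measurable_imS_inner g h : strongly_measurable T g -> strongly_measurable T h ->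
  measurable_fun `[0, T]%classic (fun t => imS << g t, h t >>).
Proof.
apply: (@strongly_measurable2 _ _ g h (fun x y => imS << x, y >>)) => v_ w_ v w hv hw.
apply: (cvg_squeeze0 _ (cvg_inner hv hw)) => k; rewrite -raddfB; exact: ler_imS.
Qed.

Lemma measurable_rnormB (V : normedModType K) (g h : R -> V) :
  strongly_measurable T g -> strongly_measurable T h ->
  measurable_fun `[0, T]%classic (fun t => rnorm (g t - h t)).
Proof.
apply: (@strongly_measurable2 _ _ g h (fun x y => rnorm (x - y))) => v_ w_ v w.
exact: cvg_rnormB.
Qed.

Lemma measurable_rnorm (V : normedModType K) (g : R -> V) :
  strongly_measurable T g -> measurable_fun `[0, T]%classic (fun t => rnorm (g t)).
Proof.
move=> mg; have m0 : strongly_measurable T (fun=> 0 : V).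
  apply: strongly_measurable_econt => t e e0; exists 1 => // x _.
  by rewrite subrr rnorm0.
rewrite (_ : (fun t => _) = fun t => rnorm (g t - 0)); first exact: measurable_rnormB.
by apply/funext => t; rewrite subr0.
Qed.

Lemma measurable_sqr (D : set R) (f : R -> R) : measurable_fun D f ->
  measurable_fun D (fun t => f t ^+ 2).
Proof. by move=> mf; apply: measurable_funX. Qed.

Lemma integrable_bound (f b : R -> R) : measurable_fun `[0, T]%classic f ->
  (forall t, 0 <= t <= T -> `|f t| <= b t) -> leb.-integrable `[0, T]%classic (EFin \o b) ->
  leb.-integrable `[0, T]%classic (EFin \o f).
Proof.
move=> mf fb ib; apply: (le_integrable _ _ _ ib) => //.
  exact/measurable_EFinP.
move=> t; rewrite /= in_itv /= => /fb h; rewrite lee_fin.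
exact: le_trans h (ler_norm _).
Qed.

Lemma L2_integrable (V : normedModType K) (g : R -> V) : L2 T g ->
  leb.-integrable `[0, T]%classic (EFin \o (fun t => rnorm (g t) ^+ 2)).
Proof.
move=> [mg fg]; apply/integrableP; split.
  apply/measurable_EFinP.
  by apply: measurable_sqr; exact: measurable_rnorm.
by under eq_integral do rewrite /= ger0_norm ?sqr_ge0//.
Qed.

Lemma young_inner (x y : G) (l : R) : 0 < l ->
  absS << x, y >> <= (l * rnorm x ^+ 2 + l^-1 * rnorm y ^+ 2) / 2.
Proof.
move=> l0; apply: le_trans (cauchy_schwarz x y) _.
have l0' : l != 0 by rewrite gt_eqF.
have : 0 <= l^-1 * (l * rnorm x - rnorm y) ^+ 2.
  by rewrite mulr_ge0 ?sqr_ge0// invr_ge0 ltW.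
have -> : l^-1 * (l * rnorm x - rnorm y) ^+ 2 =
  l * rnorm x ^+ 2 + l^-1 * rnorm y ^+ 2 - 2 * (rnorm x * rnorm y) by field.
lra.
Qed.

Lemma L2_combine g h (a b : R) : L2 T g -> L2 T h ->
  leb.-integrable `[0, T]%classic (EFin \o (fun t => a * rnorm (g t) ^+ 2 + b * rnorm (h t) ^+ 2)).
Proof.
move=> /L2_integrable ig /L2_integrable ih.
rewrite (_ : _ \o _ = ((fun t => a%:E * (rnorm (g t) ^+ 2)%:E) \+ (fun t => b%:E * (rnorm (h t) ^+ 2)%:E))%E).
  by apply: integrableD => //; apply: integrableZl.
by apply/funext => t /=; rewrite EFinD !EFinM.
Qed.

Lemma integrable_rnormB2 g h : L2 T g -> L2 T h ->
  leb.-integrable `[0, T]%classic (EFin \o (fun t => rnorm (g t - h t) ^+ 2)).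
Proof.
move=> lg lh; apply: (integrable_bound _ _ (L2_combine 2 2 lg lh)).
  by apply: measurable_sqr; apply: measurable_rnormB; [case: lg|case: lh].
move=> t _; rewrite ger0_norm ?sqr_ge0// rnorm_sqrB.
have := rnorm_sqrD (g t) (h t); have := sqr_ge0 (rnorm (g t + h t)); lra.
Qed.

Lemma integrable_inner g h : L2 T g -> L2 T h ->
  leb.-integrable `[0, T]%classic (EFin \o (fun t => reS << g t, h t >>)) /\
  leb.-integrable `[0, T]%classic (EFin \o (fun t => imS << g t, h t >>)).
Proof.
move=> lg lh; have [mg _] := lg; have [mh _] := lh.
have key t : absS << g t, h t >> <= 2^-1 * rnorm (g t) ^+ 2 + 2^-1 * rnorm (h t) ^+ 2.
  by have := young_inner (g t) (h t) (ltr01 : 0 < (1 : R)); rewrite invr1; lra.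
have ib := L2_combine 2^-1 2^-1 lg lh.
split; apply: (integrable_bound _ _ ib).
- exact: measurable_reS_inner.
- by move=> t _; exact: le_trans (ler_reS _) (key t).
- exact: measurable_imS_inner.
- by move=> t _; exact: le_trans (ler_imS _) (key t).
Qed.

Lemma L2innerBl g g' h : L2 T g -> L2 T g' -> L2 T h ->
  L2inner T (fun t => g t - g' t) h = L2inner T g h - L2inner T g' h.
Proof.
move=> lg lg' lh; have [i1 i2] := integrable_inner lg lh.
have [i1' i2'] := integrable_inner lg' lh.
apply: scalars_ext; rewrite /L2inner (reSD, imSD) (reSN, imSN).
  rewrite !reS_integralS -RintegralB//; apply: eq_Rintegral => t _.
  by rewrite innerBl raddfB.
rewrite !imS_integralS -RintegralB//; apply: eq_Rintegral => t _.
by rewrite innerBl raddfB.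
Qed.

Lemma strongly_measurableB (V : normedModType K) (g h : R -> V) :
  strongly_measurable T g -> strongly_measurable T h ->
  strongly_measurable T (fun t => g t - h t).
Proof.
move=> [g_ [sg hg]] [h_ [sh hh]]; exists (fun k t => g_ k t - h_ k t); split.
  move=> k; apply: (@simple_comp _ _ _ (fun t => (g_ k t, h_ k t)) (fun p => p.1 - p.2)).
  by apply: simple_pair; [exact: sg|exact: sh].
by move=> t tT; apply: cvgB; [exact: hg|exact: hh].
Qed.

Lemma L2B g h : L2 T g -> L2 T h -> L2 T (fun t => g t - h t).
Proof.
move=> lg lh; split; first by apply: strongly_measurableB; [case: lg|case: lh].
have /integrableP[_] := integrable_rnormB2 lg lh.
by under eq_integral do rewrite /= ger0_norm ?sqr_ge0//.
Qed.

Lemma integral_Zadd g h (a b : R) : L2 T g -> L2 T h ->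
  \int[leb]_(t in `[0, T]) (a * rnorm (g t) ^+ 2 + b * rnorm (h t) ^+ 2) =
  a * \int[leb]_(t in `[0, T]) (rnorm (g t) ^+ 2) +
  b * \int[leb]_(t in `[0, T]) (rnorm (h t) ^+ 2).
Proof.
move=> /L2_integrable ig /L2_integrable ih; rewrite RintegralD ?RintegralZl//.
  rewrite (_ : _ \o _ = (fun t => a%:E * (rnorm (g t) ^+ 2)%:E)%E); first exact: integrableZl.
  by apply/funext => t /=; rewrite EFinM.
rewrite (_ : _ \o _ = (fun t => b%:E * (rnorm (h t) ^+ 2)%:E)%E); first exact: integrableZl.
by apply/funext => t /=; rewrite EFinM.
Qed.

Lemma L2inner_young g h (l : R) : 0 < l -> L2 T g -> L2 T h ->
  absS (L2inner T g h) <= l * \int[leb]_(t in `[0, T]) (rnorm (g t) ^+ 2) +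
    l^-1 * \int[leb]_(t in `[0, T]) (rnorm (h t) ^+ 2).
Proof.
move=> l0 lg lh; have [i1 i2] := integrable_inner lg lh.
have key (f : R -> R) : leb.-integrable `[0, T]%classic (EFin \o f) ->
    (forall t, `|f t| <= absS << g t, h t >>) ->
    `|\int[leb]_(t in `[0, T]) f t| <= 2^-1 * (l * \int[leb]_(t in `[0, T]) (rnorm (g t) ^+ 2) +
    l^-1 * \int[leb]_(t in `[0, T]) (rnorm (h t) ^+ 2)).
  move=> fi fh; apply: le_trans (le_normr_Rintegral _ fi) _ => //.
  rewrite mulrDr !mulrA -integral_Zadd//; apply: le_Rintegral => //.
  - rewrite (_ : _ \o _ = abse \o (EFin \o f)); first exact: integrable_abse.
    by apply/funext => t.
  - exact: L2_combine.
  - move=> t _; apply: le_trans (fh t) _.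
    by apply: le_trans (young_inner (g t) (h t) l0) _; lra.
apply: le_trans (absS_ler _) _.
have h1 := key _ i1 (fun t => ler_reS _); have h2 := key _ i2 (fun t => ler_imS _).
rewrite /L2inner reS_integralS imS_integralS.
by move: h1 h2; set X := `|_|; set Y := `|_|; set Z := _ + _ => h1 h2; lra.
Qed.

Lemma L2inner_approx g h (c : K) : L2 T g -> L2 T h ->
  (forall e : R, 0 < e -> exists F, [/\ L2 T F,
     \int[leb]_(t in `[0, T]) (rnorm (g t - F t) ^+ 2) <= e & L2inner T F h = c]) ->
  L2inner T g h = c.
Proof.
move=> lg lh H; apply/eqP; rewrite -subr_eq0; apply/eqP/absS_eq0/eqP.
rewrite eq_le absS_ge0 andbT; apply/ler_addgt0Pr => e e0; rewrite add0r.
pose J := \int[leb]_(t in `[0, T]) (rnorm (h t) ^+ 2).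
have J0 : 0 <= J by apply: Rintegral_ge0 => t _; exact: sqr_ge0.
pose l := 2 * (J + 1) / e.
have l0 : 0 < l by rewrite divr_gt0//; lra.
have d0 : 0 < e / 2 / l by rewrite divr_gt0// divr_gt0.
have [F [lF hF <-]] := H _ d0.
rewrite -(L2innerBl lg lF lh).
apply: le_trans (L2inner_young l0 (L2B lg lF) lh) _; rewrite -/J.
have h1 : l * \int[leb]_(t in `[0, T]) (rnorm (g t - F t) ^+ 2) <= e / 2.
  by rewrite mulrC -ler_pdivlMr.
have h2 : l^-1 * J <= e / 2.
  have J1 : 0 < J + 1 by lra.
  have -> : l^-1 * J = e / 2 * (J / (J + 1)).
    by rewrite /l; field; rewrite !gt_eqF.
  rewrite -[leRHS]mulr1; apply: ler_wpM2l; first by lra.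
  by rewrite ler_pdivrMr//; lra.
lra.
Qed.

End Inner.
End L2Functions.

Section RieszFischer.
Variables (R : realType) (s : scalar_kind) (T : R).
Hypothesis T0 : 0 < T.
Local Notation K := (scalars R s).
Local Notation leb := (@lebesgue_measure R).

Lemma ae_imply (P Q : set R) : {ae leb, forall t, P t} -> (forall t, P t -> Q t) ->
  {ae leb, forall t, Q t}.
Proof. by move=> aeP PQ; apply: negligibleS aeP => t /= nQ /PQ. Qed.

Lemma ae_imply2 (P P' Q : set R) : {ae leb, forall t, P t} -> {ae leb, forall t, P' t} ->
  (forall t, P t -> P' t -> Q t) -> {ae leb, forall t, Q t}.
Proof.
move=> aeP aeP' PQ; apply: negligibleS (negligibleU aeP aeP') => t /= nQ.
by apply/not_andP => -[Pt P't]; exact/nQ/PQ.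
Qed.

Lemma subrACA (V : zmodType) (a b c d : V) : a - b - (c - d) = (a - c) - (b - d).
Proof. by rewrite !opprB addrACA [RHS]addrACA [- c - b]addrC. Qed.

Lemma geometric_cauchy_cvg (V : completeNormedModType K) (x_ : nat -> V) (c : R) :
  (forall k, rnorm (x_ k.+1 - x_ k) <= c / 2 ^+ k) -> cvg (x_ @ \oo).
Proof.
move=> hx.
have c0 : 0 <= c by have := hx 0%N; rewrite expr0 divr1; apply: le_trans; exact: rnorm_ge0.
have tel N n : rnorm (x_ (N + n)%N - x_ N) <= 2 * c / 2 ^+ N - 2 * c / 2 ^+ (N + n).
  elim: n => [|n ih]; first by rewrite addn0 !subrr rnorm0.
  rewrite addnS.
  have -> : x_ (N + n).+1 - x_ N = (x_ (N + n).+1 - x_ (N + n)%N) + (x_ (N + n)%N - x_ N).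
    by rewrite addrA subrK.
  apply: le_trans (ler_rnormD _ _) _; apply: le_trans (lerD (hx _) ih) _.
  rewrite exprS le_eqVlt; apply/orP; left; apply/eqP.
  by field; rewrite !expf_neq0.
apply/cauchy_cvgP/cauchy_exP => e e0.
have [ee re0] := ge0_ofR (ltW e0).
have {}re0 : 0 < reS e by rewrite -(@ofR_lt R s) -ee rmorph0.
have d0 : 0 < reS e / (2 * c + 1) by rewrite divr_gt0//; lra.
have [N _ hN] := near_exp2 d0.
exists (x_ N); exists N => //= n Nn.
rewrite -ball_normE /ball_ /= ee ofR_rnorm ofR_lt rdistC.
have := tel N (n - N)%N; rewrite subnKC// => h; apply: le_lt_trans h _.
have := hN N (leqnn N); rewrite /= exprVn ltr_pdivlMr; last by lra.
have h3 : 0 <= 2 * c / 2 ^+ n by rewrite divr_ge0 ?mulr_ge0 ?exprn_ge0.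
have h4 : 0 < (2 ^+ N : R)^-1 by rewrite invr_gt0 exprn_gt0.
rewrite -/(_ / _) [2 * c / _]mulrC; lra.
Qed.

Lemma increasing_rate (e_ : nat -> R) (d_ : nat -> R) : e_ @ \oo --> 0 ->
  (forall k, 0 < d_ k) -> exists nu : nat -> nat,
    (forall k, (nu k < nu k.+1)%N) /\ forall k n, (nu k <= n)%N -> e_ n <= d_ k.
Proof.
move=> /cvgrPdist_lt he d0.
have H k : exists N, forall n, (N <= n)%N -> e_ n <= d_ k.
  have [N _ hN] := he _ (d0 k); exists N => n /hN; rewrite /= sub0r normrN => h.
  exact: le_trans (ler_norm _) (ltW h).
have [N_ hN] := choice H.
pose nu := fix nu k := if k is k'.+1 then maxn (N_ k) (nu k').+1 else N_ 0%N.
exists nu; split; first by move=> k; rewrite /= leq_max leqnn orbT.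
move=> [|k] n /=; first exact: hN.
by rewrite geq_max => /andP[/hN].
Qed.

Lemma limn_einf_le (u : (\bar R)^nat) (c : \bar R) : (forall n, (u n <= c)%E) ->
  (limn_einf u <= c)%E.
Proof.
move=> h; rewrite limn_einf_lim; apply: lime_le; first exact: is_cvg_einfs.
by apply: nearW => n; apply: le_trans (h n); apply: ereal_inf_lbound; exists n => //=.
Qed.

Lemma L2_econt (V : normedModType K) (g : R -> V) : econt g -> L2 T g.
Proof.
move=> cg; split; first exact: strongly_measurable_econt.
have cn : continuous (fun t => rnorm (g t) ^+ 2).
  have c1 := continuous_rnorm cg.
  by under eq_fun do rewrite expr2; exact: continuous_mulf.
have /integrableP[_] := continuous_integrable 0 T cn.
by under eq_integral do rewrite /= ger0_norm ?sqr_ge0//.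
Qed.

Variable G : hilbert R s.

(* Along a subsequence the integral of sum_k 4^k |F_(k+1) - F_k|^2 is finite, hence
   F_k converges geometrically almost everywhere. *)
Lemma riesz_fischer (F_ : nat -> R -> G) (e_ : nat -> R) :
  (forall N, econt (F_ N)) -> e_ @ \oo --> 0 ->
  (forall N M, (N <= M)%N ->
     \int[leb]_(t in `[0, T]) (rnorm (F_ M t - F_ N t) ^+ 2) <= e_ N) ->
  exists (g : R -> G) (nu : nat -> nat), [/\ L2 T g,
    forall N, \int[leb]_(t in `[0, T]) (rnorm (g t - F_ N t) ^+ 2) <= e_ N,
    forall k, (nu k < nu k.+1)%N &
    {ae leb, forall t : R, 0 <= t <= T -> F_ (nu k) t @[k --> \oo] --> g t}].
Proof.
move=> cF e0 he.
have p8 k : 0 < 8^-1 ^+ k :> R by rewrite exprn_gt0// invr_gt0.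
have [nu [nuS nuE]] := increasing_rate e0 p8.
have nu_ge k : (k <= nu k)%N by elim: k => // k ih; exact: leq_ltn_trans (nuS k).
have cdist N M : econt (fun t => F_ M t - F_ N t).
  move=> t e e1; have e2 : 0 < e / 2 by lra.
  have [d d0 hd] := cF N t _ e2; have [d' d'0 hd'] := cF M t _ e2.
  exists (Num.min d d'); first by rewrite lt_min d0.
  move=> x; rewrite lt_min => /andP[/hd h1 /hd' h2].
  rewrite subrACA.
  by apply: le_lt_trans (ler_rnormD _ _) _; rewrite rnormN; lra.
have L2d N M := L2_econt (cdist N M).
pose h k t := 4 ^+ k * rnorm (F_ (nu k.+1) t - F_ (nu k) t) ^+ 2.
have h0 k t : 0 <= h k t by apply: mulr_ge0; [exact: exprn_ge0|exact: sqr_ge0].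
have mh k : measurable_fun `[0, T]%classic (fun t => (h k t)%:E).
  apply/measurable_EFinP; apply: measurable_funM => //.
  by have [/(measurable_rnorm T0)/measurable_sqr] := L2d (nu k) (nu k.+1).
have hint k : (\int[leb]_(t in `[0%R, T]) (h k t)%:E <= (2 / (2 ^ (k + 1))%:R)%:E)%E.
  have ih := L2_integrable T0 (L2d (nu k) (nu k.+1)).
  under eq_integral do rewrite EFinM.
  rewrite integralZl//.
  have fn : (\int[leb]_(t in `[0%R, T]) (rnorm (F_ (nu k.+1) t - F_ (nu k) t) ^+ 2)%:E)%E \is a fin_num.
    exact: integrable_fin_num _ ih.
  rewrite -(fineK fn) -EFinM lee_fin -/(Rintegral _ _ _).
  have := he _ _ (ltnW (nuS k)); have := nuE k _ (leqnn _).
  move=> h1 h2; have := le_trans h2 h1.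
  rewrite -(ler_pM2l (exprn_gt0 k (ltr0n R 4))) => h3; apply: le_trans h3 _.
  rewrite -exprMn natrX addn1 exprS invfM mulrA divff// mul1r -exprVn.
  by rewrite (_ : 4 * 8^-1 = 2^-1)//; field.
pose S t := (\big[+%E/0]_(0 <= k <oo) (h k t)%:E)%E.
have iS : leb.-integrable `[0, T]%classic S.
  have mS : measurable_fun `[0, T]%classic S.
    apply: ge0_emeasurable_sum => // k t _ _.
    by rewrite lee_fin.
  have S0 t : (0 <= S t)%E by apply: nneseries_ge0 => k _ _; rewrite lee_fin.
  apply/integrableP; split => //.
  under eq_integral do rewrite gee0_abs//.
  rewrite integral_nneseries//; last by move=> k t _; rewrite lee_fin.
  apply: (@le_lt_trans _ _ (\big[+%E/0%R]_(0 <= k <oo) (2 / (2 ^ (k + 1))%:R)%:E)%E).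
    by apply: lee_nneseries => // k _ _; apply: integral_ge0 => t _; rewrite lee_fin.
  have := @cvg_geometric_eseries_half R 2 0.
  by move=> /cvg_lim ->//; rewrite ltry.
have mS := measurable_int _ iS.
have /(_ (measurable_itv _)) aeS := integrable_ae _ iS.
pose E := `[0, T]%classic `&` [set t | (S t < +oo)%E].
have mE : measurable E by apply: measurable_lte => //; exact: measurable_cst.
have cvE t : E t -> cvg (F_ (nu k) t @[k --> \oo]).
  move=> [_ St]; pose c := Num.sqrt (fine (S t)).
  have Sfin : S t \is a fin_num.
    by rewrite ge0_fin_numE//; apply: nneseries_ge0 => k _ _; rewrite lee_fin.
  apply: (@geometric_cauchy_cvg _ _ c) => k.
  have hk : h k t <= fine (S t).
    rewrite -lee_fin fineK//.
    apply: le_trans (@nneseries_lim_ge _ (fun k => (h k t)%:E) xpredT 0 k.+1 _).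
      rewrite big_nat_recr//= leeDr// sume_ge0// => i _; rewrite lee_fin; exact: h0.
    by move=> n _ _; rewrite lee_fin.
  have p2 : 0 < 2 ^+ k :> R by rewrite exprn_gt0.
  rewrite ler_pdivlMr// -(@ler_pXn2r _ 2) ?nnegrE ?sqrtr_ge0//.
    2: by rewrite mulr_ge0 ?rnorm_ge0// ltW.
  rewrite sqr_sqrtr; last exact: le_trans hk.
  apply: le_trans hk; rewrite exprMn mulrC /h -exprM mulnC exprM.
  by rewrite (_ : 2 ^+ 2 = 4 :> R)// expr2; ring.
pose g t := if `[< E t >] then lim (F_ (nu k) t @[k --> \oo]) else 0 : G.
have gE t : E t -> F_ (nu k) t @[k --> \oo] --> g t.
  by move=> Et; rewrite /g asboolT//; exact: cvE.
have smg : strongly_measurable T g.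
  apply: (@strongly_measurable_lim _ _ _ T0 _ (fun k => F_ (nu k)) E) => //.
    by move=> t _ Et; exact: gE.
  by move=> t _ Et; rewrite /g asboolF.
have msq N : measurable_fun `[0, T]%classic (fun t => (rnorm (g t - F_ N t) ^+ 2)%:E).
  apply/measurable_EFinP; apply: measurable_sqr; apply: measurable_rnormB => //.
  exact: strongly_measurable_econt.
have aeE : {ae leb, forall t : R, 0 <= t <= T -> E t}.
  apply: (ae_imply aeS) => t h1 tT; have tT' : `[0, T]%classic t by rewrite /= in_itv.
  split => //=; have := h1 tT'; rewrite fin_numE => /andP[_ h2].
  by rewrite ltey.
have gint N : (\int[leb]_(t in `[0%R, T]) (rnorm (g t - F_ N t) ^+ 2)%:E <= (e_ N)%:E)%E.
  pose phi t := (rnorm (g t - F_ N t) ^+ 2)%:E.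
  have -> : (\int[leb]_(t in `[0%R, T]) phi t = \int[leb]_(t in E) phi t)%E.
    have -> : E = `[0, T]%classic `&` E by rewrite /E setIA setIid.
    rewrite integral_mkcondr; apply: ge0_ae_eq_integral => //.
    - exact: msq.
    - apply/measurable_restrict => //.
      by apply: measurable_funS (msq N) => //; exact: subIsetl.
    - by move=> t _; rewrite lee_fin sqr_ge0.
    - by move=> t _; rewrite patchE; case: ifP => // _; rewrite lee_fin sqr_ge0.
    - apply: (ae_imply aeE) => t h1; rewrite /= in_itv /= => /h1 Et.
      by rewrite patchE mem_set.
  pose f k t := (rnorm (F_ (nu (k + N)%N) t - F_ N t) ^+ 2)%:E.
  have -> : (\int[leb]_(t in E) phi t = \int[leb]_(t in E) limn_einf (f^~ t))%E.
    apply: eq_integral => t; rewrite inE => Et.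
    have : f k t @[k --> \oo] --> phi t.
      apply: cvg_EFin; first by apply: nearW.
      rewrite /comp /=.
      have h1 : rnorm (F_ (nu (k + N)%N) t - F_ N t) @[k --> \oo] --> rnorm (g t - F_ N t).
        apply: cvg_rnormB; last exact: cvg_cst.
        by have := gE t Et; rewrite -(cvg_shiftn N).
      by under eq_fun do rewrite expr2; rewrite expr2; exact: cvgM.
    by move=> /cvg_limn_einf_sup[->].
  apply: le_trans (fatou _ _ _ _) _ => //.
  - move=> k; apply: (@measurable_funS _ _ _ _ `[0, T]%classic) => //; first exact: subIsetl.
    by apply/measurable_EFinP; have [/(measurable_rnorm T0)/measurable_sqr] := L2d N (nu (k + N)%N).
  - by move=> k t _; rewrite lee_fin sqr_ge0.
  apply: limn_einf_le => k.
  have ih := L2_integrable T0 (L2d N (nu (k + N)%N)).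
  apply: (@le_trans _ _ (\int[leb]_(t in `[0%R, T]) f k t)%E).
    apply: ge0_subset_integral => //; [exact: measurable_int _ ih| |exact: subIsetl].
    by move=> t _; rewrite lee_fin sqr_ge0.
  rewrite -(fineK (integrable_fin_num _ ih))// lee_fin.
  by apply: he; apply: leq_trans (nu_ge _); exact: leq_addl.
have L2gF N : L2 T (fun t => g t - F_ N t).
  split; last by apply: le_lt_trans (gint N) _; exact: ltry.
  by apply: strongly_measurableB => //; exact: strongly_measurable_econt.
exists g, nu; split => //.
- have L20 : L2 T (fun t => 0 - F_ 0%N t).
    split; last first.
      under eq_integral do rewrite sub0r rnormN.
      by have [] := L2_econt (cF 0%N).
    apply: strongly_measurableB; apply: strongly_measurable_econt => // t e e1.
    by exists 1 => // x _; rewrite subrr rnorm0.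
  rewrite (_ : g = fun t => (g t - F_ 0%N t) - (0 - F_ 0%N t)); first exact: L2B.
  by apply/funext => t; rewrite sub0r opprK subrK.
- move=> N; rewrite -lee_fin /Rintegral fineK; first exact: gint.
  exact: (integrable_fin_num _ (L2_integrable T0 (L2gF N))).
- by apply: (ae_imply aeE) => t h1 /h1; exact: gE.
Qed.

End RieszFischer.

(** * The biorthogonal sequence *)

Section DualSequence.
Variables (R : realType) (s : scalar_kind) (T : R).
Hypothesis T0 : 0 < T.
Local Notation K := (scalars R s).
Local Notation C := (cfun s T).
Local Notation leb := (@lebesgue_measure R).
Variable G : hilbert R s.
Local Notation "<< x , y >>" := (inner G x y).
Implicit Types g h : R -> G.

Lemma integral_rnorm2 g :
  \int[leb]_(t in `[0, T]) (rnorm (g t) ^+ 2) = reS (L2inner T g g).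
Proof.
by rewrite /L2inner reS_integralS; apply: eq_Rintegral => t _; rewrite innerxx reS_ofR.
Qed.

Lemma L2innerC g h : L2 T g -> L2 T h -> L2inner T g h = conjS R s (L2inner T h g).
Proof.
move=> lg lh; have [_ i2] := integrable_inner T0 lh lg.
apply: scalars_ext; rewrite /L2inner (reS_conj, imS_conj) !(reS_integralS, imS_integralS).
  by apply: eq_Rintegral => t _; rewrite [in LHS]innerC reS_conj.
rewrite -mulrN1 -RintegralZr ?imS_integralS -?mulrN -?RintegralZr//.
  by apply: eq_Rintegral => t _; rewrite [in LHS]innerC imS_conj mulrN1.
Qed.

Lemma L2innerDl g g' h : L2 T g -> L2 T g' -> L2 T h ->
  L2inner T (fun t => g t + g' t) h = L2inner T g h + L2inner T g' h.
Proof.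
move=> lg lg' lh; have [i1 i2] := integrable_inner T0 lg lh.
have [i1' i2'] := integrable_inner T0 lg' lh.
apply: scalars_ext; rewrite /L2inner (reSD, imSD).
  rewrite !reS_integralS -RintegralD//; apply: eq_Rintegral => t _.
  by rewrite innerDl reSD.
rewrite !imS_integralS -RintegralD//; apply: eq_Rintegral => t _.
by rewrite innerDl imSD.
Qed.

Lemma L2innerZl (a : K) g h : L2 T g -> L2 T h ->
  L2inner T (fun t => a *: g t) h = a * L2inner T g h.
Proof.
move=> lg lh; have [i1 i2] := integrable_inner T0 lg lh.
rewrite /L2inner -integralSZ//; congr integralS; apply/funext => t.
by rewrite innerZl.
Qed.

Lemma L2_sqrB g h : L2 T g -> L2 T h ->
  \int[leb]_(t in `[0, T]) (rnorm (g t - h t) ^+ 2) =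
  reS (L2inner T g g) - 2 * reS (L2inner T g h) + reS (L2inner T h h).
Proof.
move=> lg lh; have lgh := L2B T0 lg lh.
rewrite integral_rnorm2 (L2innerBl T0 lg lh lgh) (L2innerC lg lgh) (L2innerC lh lgh).
rewrite !(L2innerBl T0 lg lh)// !(reSD, reSN, reS_conj) (L2innerC lh lg) reS_conj.
by ring.
Qed.

Variables (d_ : nat -> C) (v_ : nat -> G).

Definition comb p (x : nat -> K) : R -> G := vcomb p d_ (fun n => x n *: v_ n).
Definition mode n (t : R) : G := d_ n t *: v_ n.

Lemma L2_comb p x : L2 T (comb p x).
Proof. by apply: L2_econt => //; exact: vcomb_continuous. Qed.

Lemma L2_mode n : L2 T (mode n).
Proof.
have -> : mode n = vcomb 1 (fun=> d_ n) (fun=> v_ n).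
  by apply/funext => t; rewrite /vcomb big_ord1.
by apply: L2_econt => //; exact: vcomb_continuous.
Qed.

Lemma combS p x t : comb p.+1 x t = comb p x t + x p *: mode p t.
Proof. by rewrite /comb /vcomb big_ord_recr /= /mode !scalerA [x p * _]mulrC. Qed.

Lemma L2_Zmode (a : K) n : L2 T (fun t => a *: mode n t).
Proof.
have -> : (fun t => a *: mode n t) = vcomb 1 (fun=> d_ n) (fun=> a *: v_ n).
  by apply/funext => t; rewrite /vcomb big_ord1 /mode !scalerA mulrC.
by apply: L2_econt => //; exact: vcomb_continuous.
Qed.

Lemma L2inner_comb p x h : L2 T h ->
  L2inner T (comb p x) h = \sum_(m < p) x m * L2inner T (mode m) h.
Proof.
move=> lh; elim: p => [|p ih].
  rewrite big_ord0; have l0 := L2_comb 0 x.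
  have -> : comb 0 x = (fun t => comb 0 x t - comb 0 x t).
    by apply/funext => t; rewrite subrr /comb /vcomb big_ord0.
  by rewrite L2innerBl// subrr.
rewrite big_ord_recr /= -ih -(L2innerZl _ (L2_mode p) lh).
rewrite -(L2innerDl (L2_comb p x) (L2_Zmode (x p) p) lh).
by congr L2inner; apply/funext => t; exact: combS.
Qed.

Lemma L2inner_combr p x g : L2 T g ->
  L2inner T g (comb p x) = \sum_(m < p) conjS R s (x m) * L2inner T g (mode m).
Proof.
move=> lg; rewrite (L2innerC lg (L2_comb p x)) (L2inner_comb p x lg) rmorph_sum.
by apply: eq_bigr => m _; rewrite rmorphM (L2innerC lg (L2_mode m)).
Qed.

Variables (a b : R).
Hypothesis a0 : 0 < a.
Hypothesis riesz : forall p (x : nat -> K), a * \sum_(n < p) absS (x n) ^+ 2 <=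
    \int[leb]_(t in `[0, T]) (rnorm (comb p x t) ^+ 2) <= b * \sum_(n < p) absS (x n) ^+ 2.

Lemma galerkin n N : (n < N)%N -> exists x : nat -> K,
  forall m, (m < N)%N -> L2inner T (comb N x) (mode m) = (m == n)%:R.
Proof.
move=> nN; pose Gr : 'M[K]_N := \matrix_(i, j) L2inner T (mode i) (mode j).
pose xof (u : 'rV[K]_N) (k : nat) : K := oapp (u 0) 0 (insub k : option 'I_N).
have xofE u (i : 'I_N) : xof u i = u 0 i by rewrite /xof valK.
have combE u (j : 'I_N) : L2inner T (comb N (xof u)) (mode j) = (u *m Gr) 0 j.
  rewrite (L2inner_comb _ _ (L2_mode j)) mxE; apply: eq_bigr => i _.
  by rewrite xofE mxE.
have uG : Gr \in unitmx.
  rewrite -row_free_unit; apply: inj_row_free => u u0.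
  have : \int[leb]_(t in `[0, T]) (rnorm (comb N (xof u) t) ^+ 2) = 0.
    rewrite integral_rnorm2 (L2inner_combr _ _ (L2_comb _ _)) big1 ?raddf0// => i _.
    by rewrite combE u0 mxE mulr0.
  move=> I0; have /andP[] := riesz N (xof u); rewrite I0 => h _.
  have s0 : \sum_(k < N) absS (xof u k) ^+ 2 = 0.
    apply/eqP; rewrite eq_le sumr_ge0 ?andbT; last by move=> k _; exact: sqr_ge0.
    by rewrite -(ler_pM2l a0) mulr0.
  apply/rowP => i; rewrite mxE -xofE; apply/absS_eq0/eqP.
  rewrite -sqrf_eq0; move/eqP: s0; rewrite psumr_eq0; last by move=> k _; exact: sqr_ge0.
  by move=> /allP/(_ i); rewrite mem_index_enum => /(_ isT).
exists (xof (delta_mx 0 (Ordinal nN) *m invmx Gr)) => m mN.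
by rewrite (combE _ (Ordinal mN)) mulmxKV// mxE -val_eqE.
Qed.

(* The Galerkin approximations F_k of theta satisfy <F_k, F_j> = conj (x_j n) for
   j <= k, so that |F_k - F_j|^2 = r_k - r_j with r increasing and bounded by 1/a. *)
Lemma dual_vector n : exists2 theta : R -> G, L2 T theta &
  forall m, L2inner T (mode m) theta = (m == n)%:R.
Proof.
have H k : exists x : nat -> K, forall m, (m < n.+1 + k)%N ->
    L2inner T (comb (n.+1 + k) x) (mode m) = (m == n)%:R.
  by apply: galerkin; rewrite addSn ltnS leq_addr.
have [x_ hx] := choice H.
pose F_ k := comb (n.+1 + k) (x_ k).
pose r_ k := reS (x_ k n).
have lF k : L2 T (F_ k) by exact: L2_comb.
have FF k j : (j <= k)%N -> L2inner T (F_ k) (F_ j) = conjS R s (x_ j n).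
  move=> jk; rewrite (L2inner_combr _ _ (lF k)).
  have nj : (n < n.+1 + j)%N by rewrite addSn ltnS leq_addr.
  rewrite (bigD1 (Ordinal nj))//= [X in _ + X]big1 ?addr0; last first.
    move=> i; rewrite -val_eqE /= => /negbTE ni.
    by rewrite hx ?ni ?mulr0// (leq_trans (ltn_ord i))// leq_add2l.
  by rewrite hx ?eqxx ?mulr1// (leq_trans nj)// leq_add2l.
have dist N M : (N <= M)%N ->
    \int[leb]_(t in `[0, T]) (rnorm (F_ M t - F_ N t) ^+ 2) = r_ M - r_ N.
  by move=> NM; rewrite (L2_sqrB (lF M) (lF N)) !FF// !reS_conj /r_; ring.
have r_incr : nondecreasing_seq r_.
  move=> N M NM; rewrite -subr_ge0 -dist//.
  by apply: Rintegral_ge0 => t _; exact: sqr_ge0.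
have r_bnd k : r_ k <= a^-1.
  have /andP[h _] := riesz (n.+1 + k) (x_ k).
  rewrite -/(F_ k) integral_rnorm2 FF// reS_conj -/(r_ k) in h.
  have nk : (n < n.+1 + k)%N by rewrite addSn ltnS leq_addr.
  have hn : r_ k ^+ 2 <= \sum_(i < n.+1 + k) absS (x_ k i) ^+ 2.
    rewrite (bigD1 (Ordinal nk))//=.
    have h1 : 0 <= \sum_(i < n.+1 + k | i != Ordinal nk) absS (x_ k i) ^+ 2.
      by apply: sumr_ge0 => i _; exact: sqr_ge0.
    have h2 : r_ k ^+ 2 <= absS (x_ k n) ^+ 2.
      by rewrite -real_normK ?num_real// ler_sqr ?nnegrE ?absS_ge0// ler_reS.
    by apply: le_trans h2 _; rewrite lerDl.
  have h3 : a * r_ k ^+ 2 <= r_ k by apply: le_trans h; rewrite ler_pM2l.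
  have r0 : 0 <= r_ k by apply: le_trans h3; rewrite mulr_ge0 ?sqr_ge0 ?ltW.
  move: r0; rewrite le_eqVlt => /predU1P[<-|r0]; first by rewrite invr_ge0 ltW.
  by rewrite -(ler_pM2l a0) divff ?gt_eqF// -(ler_pM2r r0) mul1r -mulrA -expr2.
have r_cvg : cvgn r_.
  apply: nondecreasing_is_cvgn => //; exists a^-1 => _ [k _ <-]; exact: r_bnd.
pose e_ k := limn r_ - r_ k.
have e0 : e_ @ \oo --> 0.
  rewrite -(subrr (limn r_)); apply: cvgB => //; exact: cvg_cst.
have he N M : (N <= M)%N -> \int[leb]_(t in `[0, T]) (rnorm (F_ M t - F_ N t) ^+ 2) <= e_ N.
  by move=> NM; rewrite dist// /e_ lerD2r; exact: nondecreasing_cvgn_le.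
have cF k : econt (F_ k) by exact: vcomb_continuous.
have [g [nu [lg hg _ _]]] := riesz_fischer T0 cF e0 he.
exists g => // m; rewrite (L2innerC (L2_mode m) lg) -[RHS](rmorph_nat (conjS R s)); congr (conjS R s _).
apply: (L2inner_approx T0 lg (L2_mode m)) => e e1.
have /cvgrPdist_lt/(_ e e1)[N _ hN] := e0.
exists (F_ (maxn N m)); split => //; last by apply: hx; rewrite addSn ltnS (leq_trans (leq_maxr N m))// leq_addl.
apply: le_trans (hg _) _; have := hN _ (leq_maxl N m); rewrite /= sub0r normrN => /ltW.
exact: le_trans (ler_norm _).
Qed.

Lemma dual_sequence : exists2 theta : nat -> R -> G, (forall n, L2 T (theta n)) &
  forall x, cvgn (series (fun n => absS (x n) ^+ 2)) ->
    exists (g : R -> G) (nu : nat -> nat), [/\ L2 T g, forall k, (nu k < nu k.+1)%N,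
      {ae leb, forall t : R, 0 <= t <= T -> comb (nu k) x t @[k --> \oo] --> g t} &
      forall n, L2inner T g (theta n) = x n].
Proof.
have H n : exists theta : R -> G, L2 T theta /\
  forall m, L2inner T (mode m) theta = (m == n)%:R.
  by have [th h1 h2] := dual_vector n; exists th.
have [theta /all_and2[lth hth]] := choice H.
exists theta => // x cx.
pose S_ := series (fun n => absS (x n) ^+ 2).
pose e_ N := b * (limn S_ - S_ N).
have S_incr : nondecreasing_seq S_.
  by apply: nondecreasing_series => n _ _; exact: sqr_ge0.
have e0 : e_ @ \oo --> 0.
  rewrite -(mulr0 b) -(subrr (limn S_)); apply: cvgM; first exact: cvg_cst.
  apply: cvgB => //; exact: cvg_cst.
have b0 : 0 <= b.
  have /andP[h1 h2] := riesz 1 (fun=> 1); have := le_trans h1 h2.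
  by rewrite big_ord1 absS1 expr1n !mulr1; apply: le_trans; exact: ltW.
have he N M : (N <= M)%N -> \int[leb]_(t in `[0, T]) (rnorm (comb M x t - comb N x t) ^+ 2) <= e_ N.
  move=> NM; pose y n := if (N <= n)%N then x n else 0.
  have -> : (fun t => rnorm (comb M x t - comb N x t) ^+ 2) = fun t => rnorm (comb M y t) ^+ 2.
    apply/funext => t; congr (rnorm _ ^+ 2).
    rewrite -(subnKC NM); elim: (M - N)%N => [|k ih].
      rewrite addn0 subrr; symmetry; apply: big1 => i _.
      by rewrite /y leqNgt ltn_ord /= scale0r scaler0.
    by rewrite addnS !combS addrAC ih /y leq_addr.
  have /andP[_ h] := riesz M y; apply: le_trans h _; apply: ler_wpM2l => //.
  have -> : \sum_(n < M) absS (y n) ^+ 2 = S_ M - S_ N.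
    rewrite -(subnKC NM); elim: (M - N)%N => [|k ih].
      rewrite addn0 subrr; apply: big1 => i _.
      by rewrite /y leqNgt ltn_ord /= absS0 expr0n.
    rewrite addnS big_ord_recr /= ih /S_ seriesSr /y leq_addr.
    by rewrite addrAC.
  by rewrite lerD2r; exact: nondecreasing_cvgn_le.
have cF k : econt (comb k x) by exact: vcomb_continuous.
have [g [nu [lg hg nuS aeg]]] := riesz_fischer T0 cF e0 he.
exists g, nu; split => // n.
apply: (L2inner_approx T0 lg (lth n)) => e e1.
have /cvgrPdist_lt/(_ e e1)[N _ hN] := e0.
exists (comb (maxn N n.+1) x); split; first exact: L2_comb.
  apply: le_trans (hg _) _; have := hN _ (leq_maxl N n.+1); rewrite /= sub0r normrN => /ltW.
  exact: le_trans (ler_norm _).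
rewrite (L2inner_comb _ _ (lth n)) (bigD1 (Ordinal (leq_maxr N n.+1)))//=.
rewrite hth eqxx mulr1 big1 ?addr0// => i; rewrite -val_eqE /= => /negbTE ni.
by rewrite hth ni mulr0.
Qed.

End DualSequence.

(** * The du Bois-Reymond lemma *)

Section DuBoisReymond.
Variable R : realType.
Local Notation leb := (@lebesgue_measure R).
Implicit Types f g h : R -> R.

Definition quad f f' := exists c : R, forall t h : R, `|f (t + h) - f t - f' t * h| <= c * h ^+ 2.

Lemma quad_derive f f' (t : R) : quad f f' -> is_derive t 1 f (f' t).
Proof.
move=> [c hc].
have cv : (fun z : R => z^-1 *: ((f \o shift t) (z *: (1:R)) - f t)) @ (0:R)^' --> f' t.
  apply/cvgrPdist_lt => e e0.
  have c0 : 0 <= `|c| := normr_ge0 c.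
  apply/nbhs_ballP; exists (e / (`|c| + 1)); first by rewrite /= divr_gt0//; lra.
  move=> h /=; rewrite /ball /= sub0r normrN => hd h0.
  rewrite /GRing.scale /= mulr1 [h + t]addrC distrC.
  have -> : h^-1 * (f (t + h) - f t) - f' t = h^-1 * (f (t + h) - f t - f' t * h).
    by field.
  have hp : 0 < `|h| by rewrite normr_gt0.
  rewrite normrM normfV; apply: (@le_lt_trans _ _ (`|h|^-1 * (`|c| * h ^+ 2))).
    apply: ler_wpM2l; first by rewrite invr_ge0.
    apply: le_trans (hc t h) _; apply: ler_wpM2r; [exact: sqr_ge0|exact: ler_norm].
  have -> : `|h|^-1 * (`|c| * h ^+ 2) = `|c| * `|h|.
    by rewrite -[h ^+ 2]real_normK ?num_real//; field; rewrite normr_eq0.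
  have cp : 0 < `|c| + 1 by lra.
  have := hd; rewrite ltr_pdivlMr// => h1; apply: le_lt_trans h1.
  by rewrite mulrC; apply: ler_wpM2l => //; lra.
apply: DeriveDef; first by apply/cvg_ex; exists (f' t).
exact/cvg_lim.
Qed.

Lemma quadD f f' g g' : quad f f' -> quad g g' ->
  quad (fun t => f t + g t) (fun t => f' t + g' t).
Proof.
move=> [c hc] [d hd]; exists (c + d) => t h.
have -> : f (t + h) + g (t + h) - (f t + g t) - (f' t + g' t) * h =
  (f (t + h) - f t - f' t * h) + (g (t + h) - g t - g' t * h) by ring.
by apply: le_trans (ler_normD _ _) _; rewrite mulrDl; exact: lerD.
Qed.

Lemma quadZ (a : R) f f' : quad f f' -> quad (fun t => a * f t) (fun t => a * f' t).
Proof.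
move=> [c hc]; exists (`|a| * c) => t h.
have -> : a * f (t + h) - a * f t - a * f' t * h = a * (f (t + h) - f t - f' t * h) by ring.
by rewrite normrM -mulrA; apply: ler_wpM2l.
Qed.

Lemma quad_affine (a b : R) f f' : quad f f' ->
  quad (fun t => f (a * (t - b))) (fun t => a * f' (a * (t - b))).
Proof.
move=> [c hc]; exists (c * a ^+ 2) => t h.
have := hc (a * (t - b)) (a * h).
have -> : a * (t - b) + a * h = a * (t + h - b) by ring.
have -> : f' (a * (t - b)) * (a * h) = a * f' (a * (t - b)) * h by ring.
by have -> : c * (a * h) ^+ 2 = c * a ^+ 2 * h ^+ 2 by ring.
Qed.

(* step is the C^1 quadratic spline rising from 0 at -1 to 1 at 1, tent its
   derivative. *)
Definition posq (u : R) : R := Num.max u 0 ^+ 2.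

Lemma quad_posq : quad posq (fun u => 2 * Num.max u 0).
Proof.
exists 1 => t h; rewrite /posq /Num.max ler_norml mul1r.
by case: ifP => h1; case: ifP => h2; rewrite ?expr0n /= ?expr2;
  move/negbT: h1 || idtac; move/negbT: h2 || idtac; rewrite -?leNgt => *; apply/andP; split; nra.
Qed.

Definition step (u : R) : R := 2^-1 * (posq (u + 1) + (- 2 * posq u + posq (u - 1))).
Definition tent (u : R) : R := Num.max (u + 1) 0 + (- 2 * Num.max u 0 + Num.max (u - 1) 0).

Lemma quad_step : quad step tent.
Proof.
have h0 := quad_posq.
have hp (b : R) : quad (fun t => posq (t - b)) (fun t => 2 * Num.max (t - b) 0).
  have := quad_affine 1 b h0; congr quad; apply/funext => t; rewrite mul1r//.
  by rewrite mul1r.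
have := quadZ 2^-1 (quadD (hp (-1)) (quadD (quadZ (-2) h0) (hp 1))).
congr quad; apply/funext => t; rewrite /step /tent ?opprK//.
by field.
Qed.

Ltac max_cases := rewrite /Num.max; repeat case: ifPn; rewrite -?leNgt => *;
  rewrite ?expr2; try lra; try nra.

Lemma step_le u : u <= -1 -> step u = 0.
Proof. by rewrite /step /posq; max_cases. Qed.

Lemma step_ge u : 1 <= u -> step u = 1.
Proof. by rewrite /step /posq; max_cases. Qed.

Lemma step_bound u : 0 <= step u <= 1.
Proof. by rewrite /step /posq; max_cases; apply/andP; split; nra. Qed.

Lemma tent_out u : ~~ (`|u| < 1) -> tent u = 0.
Proof. by rewrite ltr_norml negb_and -!leNgt => /orP[]; rewrite /tent; max_cases. Qed.

Lemma tent_bound u : 0 <= tent u <= 1.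
Proof. by rewrite /tent; max_cases. Qed.

Lemma continuous_max0 : continuous (fun u : R => Num.max u 0).
Proof.
by move=> t; apply: continuous_max => //; exact: cst_continuous.
Qed.

Lemma continuous_tent : continuous tent.
Proof.
have cb (b : R) : continuous (fun u : R => Num.max (u + b) 0).
  apply: (@continuous_compf R (fun u => Num.max u 0) (fun u => u + b)); first exact: continuous_max0.
  by apply: continuous_addf; [move=> z; exact: cvg_id|exact: cst_continuous].
apply: continuous_addf; first exact: cb.
apply: continuous_addf; last exact: cb.
by apply: continuous_mulf; [exact: cst_continuous|exact: continuous_max0].
Qed.

(* ramp approximates the indicator function of [x, y], and dramp the difference of
   the Dirac masses at x and y. *)
Definition ramp (x y e t : R) := step (e^-1 * (t - x)) - step (e^-1 * (t - y)).
Definition dramp (x y e t : R) := e^-1 * tent (e^-1 * (t - x)) - e^-1 * tent (e^-1 * (t - y)).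

Lemma quad_ramp x y e : quad (ramp x y e) (dramp x y e).
Proof.
have := quadD (quad_affine e^-1 x quad_step) (quadZ (-1) (quad_affine e^-1 y quad_step)).
by congr quad; apply/funext => t; rewrite /ramp /dramp mulN1r.
Qed.

Lemma continuous_tente (x e : R) : continuous (fun t => e^-1 * tent (e^-1 * (t - x))).
Proof.
apply: continuous_mulf; first exact: cst_continuous.
apply: (@continuous_compf R tent (fun u => e^-1 * (u - x))); first exact: continuous_tent.
apply: continuous_mulf; first exact: cst_continuous.
by apply: continuous_subf; [move=> z; exact: cvg_id|exact: cst_continuous].
Qed.

Lemma ramp_test (T x y e : R) : 0 < e -> 0 < x - e -> y + e < T -> x <= y ->
  test_function T (ramp x y e) /\ derive1 (ramp x y e) = dramp x y e.
Proof.
move=> e0 xe ye xy; have q := quad_ramp x y e.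
have dE : derive1 (ramp x y e) = dramp x y e.
  by apply/funext => t; rewrite derive1E; have h := quad_derive t q; exact: derive_val.
split; last exact: dE.
split.
- by move=> t; have [] := quad_derive t q.
- by rewrite dE; apply: continuous_subf; exact: continuous_tente.
exists (x - e), (y + e); split => // t.
have ei : 0 < e^-1 by rewrite invr_gt0.
have ee : e^-1 * e = 1 by rewrite mulVf// gt_eqF.
rewrite negb_and -!ltNge => /orP[h|h]; rewrite /ramp.
  by rewrite !step_le ?subrr// -ee -mulrN ler_pM2l//; lra.
by rewrite !step_ge ?subrr// -ee ler_pM2l//; lra.
Qed.

Lemma ramp_values (x e t : R) : 0 < e ->
  [/\ t <= x - e -> step (e^-1 * (t - x)) = 0 & x + e <= t -> step (e^-1 * (t - x)) = 1].
Proof.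
move=> e0; have ei : 0 < e^-1 by rewrite invr_gt0.
have ee : e^-1 * e = 1 by rewrite mulVf// gt_eqF.
split=> h; first by apply: step_le; rewrite -ee -mulrN ler_pM2l//; lra.
by apply: step_ge; rewrite -ee ler_pM2l//; lra.
Qed.

Lemma ramp_bound (x y e t : R) : 0 < e -> x + e < y - e -> 0 <= ramp x y e t <= 1.
Proof.
move=> e0 xy; have [_ sx] := ramp_values x t e0; have [sy _] := ramp_values y t e0.
have := step_bound (e^-1 * (t - x)); have := step_bound (e^-1 * (t - y)); rewrite /ramp.
have [/sy->|h] := leP t (y - e); first by rewrite subr0.
rewrite sx; last by clear sx sy; lra.
by clear; lra.
Qed.

Lemma ramp_out (x y e t : R) : 0 < e -> x + e < y - e -> e <= `|x - t| -> e <= `|y - t| ->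
  ramp x y e t = (x <= t <= y)%R%:R.
Proof.
move=> e0 xy nx ny; have [sx1 sx2] := ramp_values x t e0; have [sy1 sy2] := ramp_values y t e0.
have xc : t <= x - e \/ x + e <= t.
  by clear sx1 sx2 sy1 sy2; move: nx; case: (ger0P (x - t)); [left|right]; lra.
have yc : t <= y - e \/ y + e <= t.
  by clear sx1 sx2 sy1 sy2; move: ny; case: (ger0P (y - t)); [left|right]; lra.
rewrite /ramp; case: xc => xc.
  have h1 : t <= y - e by clear sx1 sx2 sy1 sy2; lra.
  rewrite sx1// sy1// subrr; case: andP => [[]|]//.
  by clear sx1 sx2 sy1 sy2; lra.
case: yc => yc; rewrite sx2//.
  rewrite sy1// subr0 (_ : (x <= t <= y)%R = true)//.
  by clear sx1 sx2 sy1 sy2; apply/andP; split; lra.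
rewrite sy2// subrr; case: andP => [[]|]//.
by clear sx1 sx2 sy1 sy2; lra.
Qed.

Lemma lebesgue_ptP f (x eta : R) : lebesgue_pt f x -> 0 < eta ->
  exists2 d : R, 0 < d & forall r : R, 0 < r < d ->
    (\int[leb]_(y in ball x r) `|f y - f x|%:E <= (eta * (2 * r))%:E)%E.
Proof.
move=> /fine_cvgP[/= hfin hcv] eta0.
have /cvgrPdist_lt/(_ _ eta0) := hcv.
move: hfin => /[swap] h1 h2.
have [d /= d0 hd] := filterI h1 h2.
exists d => // r /andP[r0 rd].
have := hd r; rewrite /= sub0r normrN (gtr0_norm r0) => /(_ rd r0).
rewrite sub0r normrN => -[h fin].
have {}h : fine (davg f x r) <= eta by apply: le_trans (ler_norm _) (ltW h).
have : (davg f x r <= eta%:E)%E by rewrite -(fineK fin) lee_fin.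
rewrite /davg /iavg /= lebesgue_measure_ball; last exact: ltW.
have r2 : 0 < r *+ 2 by rewrite mulrn_wgt0.
rewrite inver gt_eqF// => h3.
have h4 : ((r *+ 2)%:E * ((r *+ 2)^-1%:E * \int[leb]_(y in ball x r) `|(f y - f x)%:E|) <= (r *+ 2)%:E * eta%:E)%E.
  by rewrite lee_pmul2l// lte_fin.
move: h4; rewrite muleA -EFinM divff ?gt_eqF// mul1e -EFinM.
by rewrite mulr_natl [eta * _]mulrC.
Qed.

Lemma integrable_patch (D P : set R) f : measurable D -> measurable P ->
  leb.-integrable D (EFin \o f) -> leb.-integrable D (EFin \o (f \_ P)).
Proof.
move=> mD mP fi; apply: (le_integrable _ _ _ fi) => //.
  apply/measurable_EFinP/measurable_restrict => //.
  have mf : measurable_fun D f by apply/measurable_EFinP; exact: measurable_int fi.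
  by apply: measurable_funS mf => //; exact: subIsetl.
move=> t _ /=; rewrite lee_fin patchE; case: ifP => // _.
by rewrite normr0.
Qed.

Lemma integrable_norm (D : set R) f :
  leb.-integrable D (EFin \o f) -> leb.-integrable D (EFin \o (fun t => `|f t|)).
Proof.
move=> fi; rewrite (_ : _ \o _ = abse \o (EFin \o f)); first exact: integrable_abse.
by apply/funext => t.
Qed.

Section Estimates.
Variable T : R.
Hypothesis T0 : 0 < T.
Local Notation I := (`[0, T]%classic : set R).

Lemma integrable_bounded_mul g f (c : R) : continuous g -> (forall t, `|g t| <= c) ->
  leb.-integrable I (EFin \o f) -> leb.-integrable I (EFin \o (fun t => g t * f t)).
Proof.
move=> cg gc fi; have mI : measurable I by exact: measurable_itv.
have c0 : 0 <= c by apply: le_trans (gc 0).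
have fi2 : leb.-integrable I (EFin \o (fun t => c * f t)).
  rewrite (_ : _ \o _ = fun t => (c%:E * (f t)%:E)%E); first exact: integrableZl.
  by apply/funext => t /=; rewrite EFinM.
apply: (le_integrable _ _ _ fi2) => //.
  apply/measurable_EFinP; apply: measurable_funM.
    by apply: measurable_funTS; exact: continuous_measurable_fun.
  by apply/measurable_EFinP; exact: measurable_int fi.
move=> t _ /=; rewrite lee_fin !normrM; apply: ler_wpM2r => //.
exact: le_trans (gc t) (ler_norm _).
Qed.

Lemma integrable_subcst f (c : R) : leb.-integrable I (EFin \o f) ->
  leb.-integrable I (EFin \o (fun t => f t - c)).
Proof.
move=> fi; rewrite (_ : _ \o _ = ((EFin \o f) \- (EFin \o fun=> c))%E).
  by apply: integrableB => //; apply: continuous_integrable; exact: cst_continuous.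
by apply/funext => t /=; rewrite EFinB.
Qed.

Lemma tent_average f (x e eta : R) : leb.-integrable I (EFin \o f) ->
  0 < e -> 0 < x - e -> x + e < T ->
  \int[leb]_(t in I `&` ball x e) `|f t - f x| <= eta * (2 * e) ->
  `|\int[leb]_(t in I) (e^-1 * tent (e^-1 * (t - x)) * f t) - f x| <= 2 * eta.
Proof.
move=> fi e0 xe xT h.
have mI : measurable I by exact: measurable_itv.
pose k t := e^-1 * tent (e^-1 * (t - x)).
have ei : 0 < e^-1 by rewrite invr_gt0.
have kb t : `|k t| <= e^-1.
  have /andP[h1 h2] := tent_bound (e^-1 * (t - x)).
  rewrite /k normrM (gtr0_norm ei) (ger0_norm h1) -[leRHS]mulr1; apply: ler_wpM2l => //.
  exact: ltW.
have ck : continuous k by exact: continuous_tente.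
have k1 : \int[leb]_(t in I) k t = 1.
  pose F t := step (e^-1 * (t - x)).
  have q := quad_affine e^-1 x quad_step.
  have cF : continuous F.
    move=> t; apply: differentiable_continuous; apply/derivable1_diffP.
    by have [] := quad_derive t q.
  have := primR_intro cF ck (fun t _ => quad_derive t q) (_ : 0 <= T <= T).
  rewrite lexx ltW// => /(_ isT).
  have ee : e^-1 * e = 1 by rewrite mulVf// gt_eqF.
  rewrite /F step_ge; last by rewrite -ee ler_pM2l//; lra.
  rewrite step_le ?add0r//; last by rewrite -ee -mulrN ler_pM2l//; lra.
have -> : \int[leb]_(t in I) (k t * f t) - f x = \int[leb]_(t in I) (k t * (f t - f x)).
  have -> : (fun t => k t * (f t - f x)) = fun t => k t * f t - f x * k t.
    by apply/funext => t; ring.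
  rewrite RintegralB//; last 2 first.
  - exact: (integrable_bounded_mul ck kb).
  - by apply: continuous_integrable; apply: continuous_mulf => //; exact: cst_continuous.
  have hz : \int[leb]_(t in I) (f x * k t) = f x * \int[leb]_(t in I) k t.
    by rewrite RintegralZl//; exact: continuous_integrable.
  by rewrite hz k1 mulr1.
have if1 := integrable_subcst (f x) fi.
apply: le_trans (le_normr_Rintegral _ _) _ => //.
  exact: (integrable_bounded_mul ck kb).
apply: (@le_trans _ _ (\int[leb]_(t in I) (e^-1 * ((fun t => `|f t - f x|) \_ (ball x e)) t))).
  have ip : leb.-integrable I (EFin \o ((fun t => `|f t - f x|) \_ (ball x e))).
    by apply: integrable_patch => //; [exact: measurable_ball|exact: integrable_norm].
  apply: le_Rintegral => //.
  - by apply: integrable_norm; exact: (integrable_bounded_mul ck kb).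
  - rewrite (_ : _ \o _ = fun t => (e^-1%:E * (((fun t => `|f t - f x|) \_ (ball x e)) t)%:E)%E); first exact: integrableZl.
    by apply/funext => t /=; rewrite EFinM.
  - move=> t _; rewrite normrM patchE; case: ifPn => [_|].
      by apply: ler_wpM2r.
    rewrite notin_setE /ball /= distrC => hb.
    rewrite /k tent_out ?mulr0 ?normr0 ?mul0r// normrM (gtr0_norm ei).
    by apply/negP => hh; apply: hb; rewrite -(ltr_pM2l ei) mulVf// gt_eqF.
rewrite RintegralZl//; last first.
  by apply: integrable_patch => //; [exact: measurable_ball|exact: integrable_norm].
rewrite -Rintegral_mkcondr mulrC ler_pdivrMr//.
by apply: le_trans h _; lra.
Qed.

Lemma ramp_integral f (x y e c : R) : leb.-integrable I (EFin \o f) ->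
  0 < e -> 0 < x -> y < T -> x + e < y - e ->
  \int[leb]_(t in I `&` ball x e) `|f t| <= c ->
  \int[leb]_(t in I `&` ball y e) `|f t| <= c ->
  `|\int[leb]_(t in I) (ramp x y e t * f t) - \int[leb]_(t in `[x, y]) f t| <= 2 * c.
Proof.
move=> fi e0 x0 yT xy hx hy.
have mI : measurable I by exact: measurable_itv.
have ei : 0 < e^-1 by rewrite invr_gt0.
have ee : e^-1 * e = 1 by rewrite mulVf// gt_eqF.
have cr : continuous (ramp x y e).
  move=> t; apply: differentiable_continuous; apply/derivable1_diffP.
  by have [] := quad_derive t (quad_ramp x y e).
have rb t : `|ramp x y e t| <= 1.
  by have /andP[h1 h2] := ramp_bound t e0 xy; rewrite ger0_norm.
have ir := integrable_bounded_mul cr rb fi.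
have ip (P : set R) : measurable P -> leb.-integrable I (EFin \o ((fun t => `|f t|) \_ P)).
  by move=> mP; apply: integrable_patch => //; exact: integrable_norm.
have ip0 (P : set R) : measurable P -> leb.-integrable I (EFin \o (f \_ P)).
  by move=> mP; apply: integrable_patch.
have -> : \int[leb]_(t in `[x, y]) f t = \int[leb]_(t in I) (f \_ `[x, y]%classic) t.
  rewrite -Rintegral_mkcondr; congr (Rintegral _ _ _); rewrite setIidr//.
  by move=> t /=; rewrite !in_itv /=; lra.
rewrite -RintegralB//; last exact: ip0.
apply: le_trans (le_normr_Rintegral _ _) _ => //.
  rewrite (_ : _ \o _ = (EFin \o (fun t => (ramp x y e t * f t)%R)) \- (EFin \o (f \_ `[x, y]%classic)))%E.
    by apply: integrableB => //; exact: ip0.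
  by apply/funext => t /=; rewrite EFinB.
apply: (@le_trans _ _ (\int[leb]_(t in I) (((fun t => `|f t|) \_ (ball x e)) t + ((fun t => `|f t|) \_ (ball y e)) t))).
  apply: le_Rintegral => //.
  - apply: integrable_norm.
    rewrite (_ : _ \o _ = (EFin \o (fun t => (ramp x y e t * f t)%R)) \- (EFin \o (f \_ `[x, y]%classic)))%E.
      by apply: integrableB => //; exact: ip0.
    by apply/funext => t /=; rewrite EFinB.
  - rewrite (_ : _ \o _ = (EFin \o ((fun t => `|f t|%R) \_ (ball x e))) \+ (EFin \o ((fun t => `|f t|%R) \_ (ball y e))))%E.
      by apply: integrableD => //; apply: ip; exact: measurable_ball.
    by apply/funext => t /=; rewrite EFinD.
  have p0 : (point : R) = 0 by [].
  move=> t _; rewrite !patchE p0.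
  have mb (z : R) : (t \in (ball z e : set R)) = (`|z - t| < e) by apply/idP/idP; rewrite inE.
  have mxy : (t \in `[x, y]%classic) = (x <= t <= y) by apply/idP/idP; rewrite inE /= in_itv.
  rewrite !mb mxy; set b := (x <= t <= y).
  have -> : (if b then f t else 0) = b%:R * f t by case: (b); rewrite ?mul1r ?mul0r.
  rewrite -mulrBl.
  have rb' : `|(ramp x y e t - b%:R) * f t| <= `|f t|.
    rewrite normrM ler_piMl//; have := ramp_bound t e0 xy.
    case: (b) => /andP[h1 h2]; last by rewrite subr0 ger0_norm.
    by rewrite distrC ger0_norm ?subr_ge0// gerBl.
  case: ifPn => [_|]; first by apply: le_trans rb' _; rewrite lerDl; case: ifP.
  rewrite -leNgt => nx; case: ifPn => [_|]; first by rewrite add0r.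
  rewrite -leNgt => ny; rewrite addr0 (ramp_out e0 xy nx ny) subrr mul0r normr0//.
rewrite RintegralD//; last 2 first.
- by apply: ip; exact: measurable_ball.
- by apply: ip; exact: measurable_ball.
by rewrite -!Rintegral_mkcondr mulr_natl mulr2n; exact: lerD.
Qed.

End Estimates.

End DuBoisReymond.

Section WeakPrimitive.
Variable R : realType.
Local Notation leb := (@lebesgue_measure R).
Variable T : R.
Hypothesis T0 : 0 < T.
Local Notation I := (`[0, T]%classic : set R).
Implicit Types f g h : R -> R.

Lemma ae_exists (P : set R) : {ae leb, forall t, P t} -> exists2 t : R, 0 < t < T & P t.
Proof.
move=> [A [mA A0 PA]]; apply: contrapT => H.
have sub : `]0, T[%classic `<=` A.
  by move=> t; rewrite /= in_itv /= => tT; apply: PA => /= Pt; apply: H; exists t.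
have : (leb `]0%R, T[%classic <= leb A)%E by apply: le_measure => //; rewrite inE.
by rewrite A0 lebesgue_measure_itv /= lte_fin T0 oppr0 addr0 lee_fin leNgt T0.
Qed.

Lemma ae_neq (a : R) : {ae leb, forall t : R, t != a}.
Proof.
exists [set a]; split => //; first exact: lebesgue_measure_set1.
by move=> t /= /negP; rewrite negbK => /eqP.
Qed.

Lemma integral_itv_split f (x y : R) : leb.-integrable I (EFin \o f) -> 0 <= x -> x <= y -> y <= T ->
  \int[leb]_(t in `[0, y]) f t = \int[leb]_(t in `[0, x]) f t + \int[leb]_(t in `[x, y]) f t.
Proof.
move=> fi x0 xy yT.
have fi' (a b : R) : 0 <= a -> b <= T -> leb.-integrable `[a, b]%classic (EFin \o f).
  move=> a0 bT; apply: integrableS fi => //.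
  by move=> t /=; rewrite !in_itv /=; lra.
rewrite -[X in _ + X]Rintegral_itv_obnd_cbnd; last first.
  by apply: integrableS (fi' x y x0 yT) => // t /=; rewrite !in_itv /=; lra.
have <- := @Rintegral_itvB _ f (BLeft 0) (BRight y) x (fi' 0 y (lexx _) yT).
- by rewrite addrC subrK.
- by rewrite bnd_simp.
- by rewrite bnd_simp.
Qed.

Lemma ball_average f (x e c : R) : 0 <= x - e -> x + e <= T -> 0 < e ->
  (\int[leb]_(y in ball x e) `|(f \_ I) y - (f \_ I) x|%:E <= c%:E)%E ->
  \int[leb]_(t in I `&` ball x e) `|f t - f x| <= c.
Proof.
move=> xe xT e0.
have bI : ball x e `<=` I.
  by move=> t; rewrite /ball /= ltr_norml in_itv /=; lra.
have xI : I x by rewrite /= in_itv /=; lra.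
rewrite setIidr//.
have -> : (\int[leb]_(y in ball x e) `|(f \_ I) y - (f \_ I) x|%:E =
    \int[leb]_(y in ball x e) `|f y - f x|%:E)%E.
  by apply: eq_integral => t; rewrite inE => /bI tI; rewrite !patchE !mem_set.
move=> h; rewrite -lee_fin /Rintegral fineK//.
rewrite ge0_fin_numE; first exact: le_lt_trans h (ltry _).
by apply: integral_ge0 => t _; rewrite lee_fin.
Qed.

Lemma ball_integral f (x e c : R) : leb.-integrable I (EFin \o f) ->
  0 <= x - e -> x + e <= T -> 0 < e ->
  \int[leb]_(t in I `&` ball x e) `|f t - f x| <= c ->
  \int[leb]_(t in I `&` ball x e) `|f t| <= c + `|f x| * (2 * e).
Proof.
move=> fi xe xT e0 h.
have bI : ball x e `<=` I.
  by move=> t; rewrite /ball /= ltr_norml in_itv /=; lra.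
move: h; rewrite setIidr// => h.
have mb : measurable (ball x e : set R) by exact: measurable_ball.
have sub g : leb.-integrable I (EFin \o g) -> leb.-integrable (ball x e) (EFin \o g).
  by move=> gi; apply: integrableS gi.
have i1 := sub _ (integrable_norm (integrable_subcst (f x) fi)).
have i2 : leb.-integrable (ball x e) (EFin \o (fun=> `|f x|)).
  by apply: sub; apply: continuous_integrable; exact: cst_continuous.
have <- : \int[leb]_(t in ball x e) `|f x| = `|f x| * (2 * e).
  rewrite Rintegral_cst//= lebesgue_measure_ball; last exact: ltW.
  by rewrite /= mulr_natl.
apply: le_trans (lerD h (lexx _)); rewrite -RintegralD//.
apply: le_Rintegral => //.
- by apply: sub; exact: integrable_norm.
- rewrite (_ : _ \o _ = (EFin \o (fun t => `|f t - f x|%R)) \+ (EFin \o fun=> `|f x|%R))%E; first exact: integrableD.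
  by apply/funext => t /=; rewrite EFinD.
- by move=> t _; rewrite -{1}[f t](subrK (f x)); exact: ler_normD.
Qed.

Lemma rate_bound (e u v c : R) : 0 <= e -> 0 <= u -> 0 <= v -> e * (2 + 2 * u + 2 * v) <= c ->
  1 * (2 * e) + u * (2 * e) <= c.
Proof. by move=> e0 u0 v0; have := mulr_ge0 e0 v0; clear; lra. Qed.

Lemma three_bound (X Y Z a b J q : R) : `|X - a| <= 2 * q -> `|Y - b| <= 2 * q ->
  `|Z - J| <= 2 * q -> X - Y = - Z -> 0 <= q -> `|b - a - J| <= 8 * q.
Proof. by rewrite !ler_norml; clear; lra. Qed.

Variables h dh : R -> R.
Hypothesis hi : leb.-integrable I (EFin \o h).
Hypothesis dhi : leb.-integrable I (EFin \o dh).
Hypothesis weak : forall psi, test_function T psi ->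
  \int[leb]_(t in I) (derive1 psi t * h t) = - \int[leb]_(t in I) (psi t * dh t).

Let good (x : R) := lebesgue_pt (h \_ I) x /\ lebesgue_pt (dh \_ I) x.

(* weak is tested against ramps whose width e shrinks to 0 *)
Lemma weak_increment (x y : R) : 0 < x -> x < y -> y < T -> good x -> good y ->
  h y - h x = \int[leb]_(t in `[x, y]) dh t.
Proof.
move=> x0 xy yT [hx dx] [hy dy].
set J := \int[leb]_(t in `[x, y]) dh t.
apply/eqP; rewrite -subr_eq0 -normr_eq0 eq_le normr_ge0 andbT.
apply/ler_addgt0Pr => eta eta0; rewrite add0r.
pose eta' := eta / 8; have e80 : 0 < eta' by rewrite divr_gt0.
have [d1 d10 hd1] := lebesgue_ptP hx e80.
have [d2 d20 hd2] := lebesgue_ptP hy e80.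
have [d3 d30 hd3] := lebesgue_ptP dx ltr01.
have [d4 d40 hd4] := lebesgue_ptP dy ltr01.
pose B := 2 + 2 * `|dh x| + 2 * `|dh y|.
have B0 : 0 < B by rewrite /B -addrA ltr_pwDl// addr_ge0// mulr_ge0.
pose m := Num.min (Num.min d1 d2) (Num.min (Num.min d3 d4)
   (Num.min (Num.min x (T - y)) (Num.min ((y - x) / 2) (eta' / B)))).
have m0 : 0 < m.
  by rewrite !lt_min d10 d20 d30 d40 x0 divr_gt0 ?subr_gt0 ?yT ?xy ?divr_gt0.
pose e := m / 2.
have e0 : 0 < e by rewrite divr_gt0.
have em : e < m by rewrite /e ltr_pdivrMr// ltr_pMr// ltr1n.
have [e1 e2 e3 e4 [e5 e6 e7 e8]] : [/\ e < d1, e < d2, e < d3, e < d4 &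
    [/\ e < x, e < T - y, e < (y - x) / 2 & e < eta' / B]].
  move: em; rewrite !lt_min -!andbA.
  by move=> /and4P[? ? ? /and5P[? ? ? ? ?]]; split.
have xe : 0 < x - e by rewrite subr_gt0.
have ye : y + e < T by rewrite addrC -ltrBrDr.
have xye : x + e < y - e by move: e7; rewrite ltr_pdivlMr//; clear -R; lra.
have xeT : x + e < T by apply: lt_trans xye _; apply: lt_trans ye; clear -e0; lra.
have ye0 : 0 < y - e by apply: lt_trans xye; rewrite addr_gt0.
have hd (d : R) : e < d -> 0 < e < d by rewrite e0.
have ax := ball_average (ltW xe) (ltW xeT) e0 (hd1 e (hd _ e1)).
have ay := ball_average (ltW ye0) (ltW ye) e0 (hd2 e (hd _ e2)).
have bx := ball_integral dhi (ltW xe) (ltW xeT) e0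
  (ball_average (ltW xe) (ltW xeT) e0 (hd3 e (hd _ e3))).
have byy := ball_integral dhi (ltW ye0) (ltW ye) e0
  (ball_average (ltW ye0) (ltW ye) e0 (hd4 e (hd _ e4))).
have eB : e * B < eta' by rewrite -ltr_pdivlMr.
have cx := rate_bound (ltW e0) (normr_ge0 (dh x)) (normr_ge0 (dh y)) (ltW eB).
have cy : 1 * (2 * e) + `|dh y| * (2 * e) <= eta'.
  by apply: (rate_bound (ltW e0) (normr_ge0 _) (normr_ge0 (dh x))); rewrite addrAC; exact: ltW eB.
have [tst dE] := ramp_test e0 xe ye (ltW xy).
have tx := tent_average T0 hi e0 xe xeT ax.
have ty := tent_average T0 hi e0 ye0 ye ay.
have rr := ramp_integral dhi e0 x0 yT xye (le_trans bx cx) (le_trans byy cy).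
have wk := weak tst; rewrite dE in wk.
have ei : 0 < e^-1 by rewrite invr_gt0.
have it (z : R) : leb.-integrable I (EFin \o (fun t => e^-1 * tent (e^-1 * (t - z)) * h t)).
  apply: (@integrable_bounded_mul _ _ (fun t => e^-1 * tent (e^-1 * (t - z))) h e^-1) => //.
    exact: continuous_tente.
  move=> t; have /andP[h1 h2] := tent_bound (e^-1 * (t - z)).
  rewrite normrM (gtr0_norm ei) (ger0_norm h1) -[leRHS]mulr1; apply: ler_wpM2l => //.
  exact: ltW.
have spl : \int[leb]_(t in I) (dramp x y e t * h t) =
    \int[leb]_(t in I) (e^-1 * tent (e^-1 * (t - x)) * h t) -
    \int[leb]_(t in I) (e^-1 * tent (e^-1 * (t - y)) * h t).
  by rewrite -RintegralB//; apply: eq_Rintegral => t _; rewrite /dramp mulrBl.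
rewrite spl in wk.
have -> : eta = 8 * eta' by rewrite /eta'; field.
exact: (three_bound tx ty rr wk (ltW e80)).
Qed.

Lemma du_bois_reymond : exists c : R, {ae leb, forall t : R, 0 <= t <= T ->
  h t = c + \int[leb]_(r in `[0, t]) dh r}.
Proof.
have aegood : {ae leb, forall t, good t}.
  have mI : measurable I by exact: measurable_itv.
  have l1 := lebesgue_differentiation (integrable_locally_restrict mI hi).
  have l2 := lebesgue_differentiation (integrable_locally_restrict mI dhi).
  by apply: (ae_imply2 l1 l2) => t h1 h2; split.
have [x0 /andP[x00 x0T] gx0] := ae_exists aegood.
exists (h x0 - \int[leb]_(r in `[0, x0]) dh r).
have ae0 : {ae leb, forall t : R, t != 0 /\ t != T}.
  by apply: (ae_imply2 (ae_neq 0) (ae_neq T)) => t h1 h2; split.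
apply: (ae_imply2 aegood ae0) => t gt [t0 tT] /andP[t0' tT'].
have {}t0 : 0 < t by rewrite lt_neqAle eq_sym t0.
have {}tT : t < T by rewrite lt_neqAle tT.
have [xt|tx|->] := ltgtP x0 t; last by rewrite subrK.
- have := weak_increment x00 xt tT gx0 gt.
  rewrite (integral_itv_split dhi (ltW x00) (ltW xt) (ltW tT)) => <-.
  by ring.
- have := weak_increment t0 tx x0T gt gx0.
  rewrite (integral_itv_split dhi (ltW t0) (ltW tx) (ltW x0T)) => <-.
  by ring.
Qed.

End WeakPrimitive.

Section Sobolev.
Variables (R : realType) (s : scalar_kind) (T : R).
Hypothesis T0 : 0 < T.
Local Notation K := (scalars R s).
Local Notation C := (cfun s T).
Local Notation leb := (@lebesgue_measure R).
Local Notation one := (@ccst R s T 1).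
Local Notation I := (`[0, T]%classic : set R).
Implicit Types M N : R -> K.

Definition measS (D : set R) M := measurable_fun D (reF M) /\ measurable_fun D (imF M).

Lemma measS_contS (D : set R) M : measurable D -> contS M -> measS D M.
Proof.
by move=> mD [cr ci]; split; apply: measurable_funTS; exact: continuous_measurable_fun.
Qed.

Lemma measSM (D : set R) M N : measS D M -> measS D N -> measS D (fun t => M t * N t).
Proof.
move=> [m1 m2] [n1 n2]; split; rewrite (reFM, imFM).
  by apply: measurable_funB; apply: measurable_funM.
by apply: measurable_funD; apply: measurable_funM.
Qed.

Lemma L2_measS M : @L2 R s K^o T M -> measS I M.
Proof.
move=> [mM _]; have h (p : K -> R) : (forall x y, `|p x - p y| <= absS (x - y)) ->
    measurable_fun I (fun t => p (M t)).
  move=> pl; apply: (@strongly_measurable2 _ _ _ K^o K^o M M (fun x _ => p x)) => //.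
  move=> v_ w_ v w /rnorm_dist0 hv _; apply: (cvg_squeeze0 _ hv) => k.
  by rewrite rnormE; exact: pl.
split; apply: h => x y; rewrite -raddfB; [exact: ler_reS|exact: ler_imS].
Qed.

Lemma L2_integrableS M : @L2 R s K^o T M ->
  leb.-integrable I (EFin \o reF M) /\ leb.-integrable I (EFin \o imF M).
Proof.
move=> lM; have [mr mi] := L2_measS lM.
have ib : leb.-integrable I (EFin \o (fun t => 1 + absS (M t) ^+ 2)).
  rewrite (_ : _ \o _ = (EFin \o fun=> 1%R) \+ (EFin \o (fun t => @rnorm R s K^o (M t) ^+ 2)%R))%E.
    apply: integrableD => //; last exact: (@L2_integrable _ _ _ T0 K^o).
    by apply: continuous_integrable; exact: cst_continuous.
  by apply/funext => t /=; rewrite EFinD rnormE.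
have key (x : R) : x <= 1 + x ^+ 2.
  have := sqr_ge0 (x - 2^-1); rewrite sqrrB; lra.
split; apply: (integrable_bound _ _ ib) => // t _.
  exact: le_trans (ler_reS _) (key _).
exact: le_trans (ler_imS _) (key _).
Qed.

Lemma weak_primitive M dM : @L2 R s K^o T M -> @L2 R s K^o T dM -> weak_deriv T M dM ->
  exists a : K, {ae leb, forall t : R, 0 <= t <= T -> M t = a + integralS `[0, t] dM}.
Proof.
move=> lM ldM w; have [iMr iMi] := L2_integrableS lM; have [idr idi] := L2_integrableS ldM.
have wr psi : test_function T psi -> \int[leb]_(t in I) (derive1 psi t * reF M t) =
    - \int[leb]_(t in I) (psi t * reF dM t).
  move=> /w /(congr1 (@reS R s)); rewrite reSN !reS_integralS.
  by under eq_Rintegral do rewrite reS_ofRM; under [in RHS]eq_Rintegral do rewrite reS_ofRM.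
have wi psi : test_function T psi -> \int[leb]_(t in I) (derive1 psi t * imF M t) =
    - \int[leb]_(t in I) (psi t * imF dM t).
  move=> /w /(congr1 (@imS R s)); rewrite imSN !imS_integralS.
  by under eq_Rintegral do rewrite imS_ofRM; under [in RHS]eq_Rintegral do rewrite imS_ofRM.
have [c hc] := du_bois_reymond T0 iMr idr wr.
have [d hd] := du_bois_reymond T0 iMi idi wi.
exists (mkS s c d); apply: (ae_imply2 hc hd) => t h1 h2 tT.
apply: scalars_ext.
  by rewrite reSD reS_mkS reS_integralS; exact: h1.
rewrite imSD imS_mkS imS_integralS; have [->|im0] := @imS_i R s.
  by rewrite mul1r; exact: h2.
rewrite !im0 mul0r add0r; symmetry; under eq_Rintegral do rewrite im0.
by rewrite Rintegral_cst ?mul0r.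
Qed.

Lemma within_clamp (a : R -> R) : {within I, continuous a} -> continuous (fun t => a (clamp T t)).
Proof.
move=> /subspace_continuousP H t; apply/cvgrPdist_lt => e e0.
have ct : I (clamp T t) by rewrite /= in_itv; exact: clamp_itv (ltW T0).
have /cvgrPdist_lt/(_ e e0)[d /= d0 hd] := H _ ct.
apply/nbhs_ballP; exists d => //= x; rewrite /ball /= => xt; apply: hd.
  by rewrite /ball /=; apply: le_lt_trans xt; exact: clamp_lip.
by rewrite /= in_itv; exact: clamp_itv (ltW T0).
Qed.

Lemma withinS_clamp (f : R -> K) : {within I, continuous (f : R -> K^o)} ->
  contS (fun t => f (clamp T t)).
Proof.
move=> /subspace_continuousP H; apply/contS_eps => t e e0.
have ct : I (clamp T t) by rewrite /= in_itv; exact: clamp_itv (ltW T0).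
have /rnorm_cvgP/(_ e e0)[d /= d0 hd] := H _ ct.
exists d => // x xt; rewrite -rnormE rdistC; apply: hd.
  by rewrite /ball /= distrC; apply: le_lt_trans xt; exact: clamp_lip.
by rewrite /= in_itv; exact: clamp_itv (ltW T0).
Qed.

Lemma integralS_contS M : @L2 R s K^o T M -> contS (fun t => integralS `[0, clamp T t] M).
Proof.
move=> lM; have [ir ii] := L2_integrableS lM.
have cc (f : R -> R) : leb.-integrable I (EFin \o f) ->
    continuous (fun t => \int[leb]_(r in `[0, clamp T t]) f r).
  move=> fi; apply: (@within_clamp (fun t => \int[leb]_(r in `[0, t]) f r)).
  exact: parameterized_integral_continuous (ltW T0) fi.
split.
  rewrite (_ : reF _ = fun t => \int[leb]_(r in `[0, clamp T t]) reF M r); first exact: cc.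
  by apply/funext => t; rewrite /reF reS_integralS.
rewrite (_ : imF _ = fun t => \int[leb]_(r in `[0, clamp T t]) imF M r); first exact: cc.
by apply/funext => t; rewrite /imF imS_integralS.
Qed.

Lemma ae_eq_integralS (D : set R) M N : measurable D -> measS D M -> measS D N ->
  {ae leb, forall t : R, D t -> M t = N t} -> integralS D M = integralS D N.
Proof.
move=> mD [m1 m2] [n1 n2] ae.
apply: scalars_ext; rewrite !(reS_integralS, imS_integralS) /Rintegral; congr fine.
  apply: ae_eq_integral => //; [exact/measurable_EFinP..|].
  by apply: (ae_imply ae) => t h Dt /=; rewrite h.
apply: ae_eq_integral => //; [exact/measurable_EFinP..|].
by apply: (ae_imply ae) => t h Dt /=; rewrite h.
Qed.

Lemma subitv (t : R) : 0 <= t <= T -> `[0, t]%classic `<=` I.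
Proof. by move=> tT r; rewrite /= !in_itv /= => rt; apply/andP; split; lra. Qed.

Lemma measS_sub (D D' : set R) M : measurable D' -> D `<=` D' -> measS D' M -> measS D M.
Proof. by move=> mD' DD' [m1 m2]; split; [exact: measurable_funS m1|exact: measurable_funS m2]. Qed.

Lemma Sobolev2_representative M : Sobolev2 T M -> exists N N1 : C, [/\ measS I M,
  {ae leb, forall t : R, 0 <= t <= T -> M t = N t} & cprim N N1].
Proof.
move=> [dM [ddM [lM ldM lddM w1 w2]]].
have [a1 h1] := weak_primitive ldM lddM w2; have [a0 h0] := weak_primitive lM ldM w1.
have c1 : contS (fun t => a1 + integralS `[0, clamp T t] ddM).
  by apply: contSD; [exact: contS_cst|exact: integralS_contS].
pose N1 : C := cfun_of T c1.
have N1E t : 0 <= t <= T -> N1 t = a1 + integralS `[0, t] ddM.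
  by move=> tT; rewrite /N1 /= !clamp_id.
exists (a0 *: one + cconv one N1), N1; split; first exact: L2_measS.
  apply: (ae_imply h0) => t h tT; rewrite h// cfunDE cfunZE oneE mulr1 cconv_oneE//.
  congr (_ + _); apply: ae_eq_integralS => //.
  - by apply: measS_sub (L2_measS ldM) => //; exact: subitv.
  - by apply: measS_contS => //; exact: cfun_contS.
  apply: (ae_imply h1) => r hr; rewrite /= in_itv /= => rt.
  have rT : 0 <= r <= T by lra.
  by rewrite hr// !clamp_id.
by rewrite /cprim cfunDE cfunZE cconv_at0 oneE mulr1 addr0.
Qed.

Lemma conv_representative M (N Y : C) (y : R -> K) : measS I M ->
  {ae leb, forall t : R, 0 <= t <= T -> M t = N t} ->
  (forall t : R, 0 <= t <= T -> y t = Y t) -> forall t : R, 0 <= t <= T ->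
  integralS `[0, t] (fun r => M (t - r) * y r) = cconv N Y t.
Proof.
move=> mM ae yY t tT.
have mt : measurable (`[0, t]%classic : set R) by [].
have -> : integralS `[0, t] (fun r => M (t - r) * y r) = integralS `[0, t] (fun r => M (t - r) * Y r).
  rewrite /integralS; congr mkS; apply: eq_Rintegral => r; rewrite inE /= in_itv /= => rt;
    by rewrite yY//; lra.
rewrite cconvE clamp_id// /conv; apply: ae_eq_integralS => //.
- apply: measSM; last by apply: measS_contS => //; exact: cfun_contS.
  have cr : measurable_fun `[0, t]%classic (fun r : R => t - r).
    apply: measurable_funTS; apply: continuous_measurable_fun.
    by apply: continuous_subf; [exact: cst_continuous|move=> z; exact: cvg_id].
  have im : [set t - r | r in `[0, t]%classic] `<=` I.
    by move=> _ [r + <-]; rewrite /= !in_itv /= => rt; apply/andP; split; lra.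
  have mc (p : R -> R) : measurable_fun I p -> measurable_fun `[0, t]%classic (fun r => p (t - r)).
    move=> mp; apply: (measurable_comp _ im mp cr) => //.
  by have [m1 m2] := mM; split; [exact: mc m1|exact: mc m2].
- by apply: measS_contS => //; apply: contS_reflectM; exact: cfun_contS.
apply: (ae_imply (ae_reflect t ae)) => r hr; rewrite /= in_itv /= => rt.
by rewrite hr//; lra.
Qed.

Lemma C1_on_cprim (f : R -> K) : C1_on T f -> exists F F1 : C,
  cprim F F1 /\ forall t, 0 <= t <= T -> f t = F t.
Proof.
move=> [df [hd cd]].
have c1 := withinS_clamp cd; have c0 := deriv_on_contS (ltW T0) hd.
have pr := deriv_on_prim (ltW T0) hd c1.
exists (cfun_of T c0), (cfun_of T c1); split; last by move=> t tT; rewrite /= !clamp_id.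
apply/(cprimP T0); move: pr; congr (prim T _ _); apply/funext => t /=; by rewrite clampK.
Qed.

End Sobolev.

(** * Eigenfunction expansions *)

Section Observability.
Variables (R : realType) (s : scalar_kind) (H G : hilbert R s).
Local Notation K := (scalars R s).
Local Notation leb := (@lebesgue_measure R).
Local Notation "<< x , y >>" := (inner H x y).
Variables (A : linop H H) (B : linop H G) (mu : nat -> K) (phi : nat -> H).
Hypothesis onb : orthonormal_basis phi.

Lemma onb_inner m n : << phi m, phi n >> = (m == n)%:R. Proof. by case: onb. Qed.

Lemma eigenvalues_real : semibounded A -> eigenpairs A mu phi ->
  exists (c : R) (m_ : nat -> R), 0 <= c /\ forall n, mu n = ofR s (m_ n) /\ - c <= m_ n.
Proof.
move=> [c c0 hc] ep; have [cE c0'] := ge0_ofR (ltW c0).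
exists (reS c), (fun n => reS (mu n + c) - reS c); split => // n.
have [dn An] := ep n; have := hc _ dn.
rewrite norm_inner An innerZl onb_inner eqxx !mulr1 -subr_ge0 opprK => h.
have [E h0] := ge0_ofR h; split; last by rewrite -subr_ge0 opprK subrK.
by rewrite raddfB /= -E -cE addrK.
Qed.

Lemma H1_norm0 : H1_norm A mu phi 0 0.
Proof.
have n0 : norm1 mu phi 0 = 0.
  rewrite /norm1 /abs_sqrt rnorm0 (_ : series _ = fun=> 0).
    by rewrite lim_cst// rnorm0 expr0n /= addr0 sqrtr0.
  by apply/funext => n; apply: big1 => i _; rewrite inner0l mulr0 scale0r.
exists (fun=> 0); split.
- by move=> _; exact: dom0.
- by move=> e e0; exists 0%N => k l _ _; rewrite subrr n0.
- exact: cvg_cst.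
- by rewrite n0; exact: cvg_cst.
Qed.

Lemma dom_scale (a : K) x : dom B x -> dom B (a *: x) /\ B (a *: x) = a *: B x.
Proof.
move=> dx; have d0 := dom0 B.
have B0 : B 0 = 0.
  have := op_lin (-1) d0 d0; rewrite scaler0 addr0 scaleN1r addrC subrr => ->//.
have := dom_lin a dx d0; have := op_lin a dx d0.
by rewrite !addr0 B0 addr0.
Qed.

Lemma dom_sum p (v_ : nat -> H) : (forall n, (n < p)%N -> dom B (v_ n)) ->
  dom B (\sum_(n < p) v_ n) /\ B (\sum_(n < p) v_ n) = \sum_(n < p) B (v_ n).
Proof.
elim: p => [|p ih] hv.
  rewrite !big_ord0; have [] := dom_scale 0 (dom0 B); rewrite scaler0 scale0r => d0 b0.
  by split.
have [d1 e1] := ih (fun n h => hv n (ltnW h)); have d2 := hv p (ltnSn p).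
rewrite !big_ord_recr /= -e1.
by have := dom_lin 1 d1 d2; have := op_lin 1 d1 d2; rewrite !scale1r.
Qed.

Variables (T : R).
Hypothesis T0 : 0 < T.
Local Notation C := (cfun s T).
Local Notation one := (@ccst R s T 1).

Lemma cprim_deriv_on (F f : C) : cprim F f -> forall t, 0 <= t <= T ->
  @is_deriv_on R s K^o T F t (f t).
Proof.
move=> /(cprimP T0) h; exact: prim_is_deriv_on (cfun_contS F) (cfun_contS f) h.
Qed.

Lemma cprim_cst (a : K) (f : C) : cprim (a *: one + cconv one f) f.
Proof. by rewrite /cprim cfunDE cfunZE cconv_at0 oneE mulr1 addr0. Qed.

Lemma onb_sum p (a_ : nat -> K) n :
  << \sum_(i < p) a_ i *: phi i, phi n >> = if (n < p)%N then a_ n else 0.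
Proof.
rewrite inner_suml; case: ifPn => [np|np].
  rewrite (bigD1 (Ordinal np))//= innerZl onb_inner eqxx mulr1 big1 ?addr0// => i.
  by rewrite -val_eqE /= => /negbTE ni; rewrite innerZl onb_inner ni mulr0.
apply: big1 => i _; rewrite innerZl onb_inner; case: eqP => [ni|]; last by rewrite mulr0.
by rewrite -ni ltn_ord in np.
Qed.

Lemma onb_sum_norm p (a_ : nat -> K) :
  rnorm (\sum_(i < p) a_ i *: phi i) ^+ 2 = \sum_(i < p) absS (a_ i) ^+ 2.
Proof.
rewrite -[LHS](@reS_ofR R s) -innerxx inner_sumr raddf_sum; apply: eq_bigr => i _.
by rewrite innerZr onb_sum ltn_ord /= mulrC mulS_conj reS_ofR.
Qed.

Variables (S_ S1_ : nat -> C).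
Hypothesis S_prim : forall n, S_ n = cconv one (S1_ n) /\
  S1_ n = one - mu n *: cconv one (S_ n).

Lemma wave_solution p (x : nat -> K) :
  solution mu phi T (fun=> 0) (fun=> 0) 0 0 (\sum_(i < p) x i *: phi i)
    (fun t => \sum_(i < p) (S_ i t * x i) *: phi i).
Proof.
move=> n; have [E1 E2] := S_prim n.
pose z := << \sum_(i < p) x i *: phi i, phi n >>.
have -> : (fun t => << \sum_(i < p) (S_ i t * x i) *: phi i, phi n >>) = (z *: S_ n : C).
  apply/funext => t; rewrite (onb_sum p (fun i => S_ i t * x i)) cfunZE /z onb_sum.
  by case: ifP => _; rewrite ?mul0r// mulrC.
have p1 : cprim (S_ n) (S1_ n) by rewrite /cprim {1 2}E1 cconv_at0 scale0r add0r.
have p2 : cprim (S1_ n) (- (mu n *: S_ n)).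
  have -> : S1_ n = 1 *: one + cconv one (- (mu n *: S_ n)).
    by rewrite E2 cconvNr cconvZr scale1r.
  exact: cprim_cst.
have pZ (F f : C) : cprim F f -> cprim (z *: F) (z *: f).
  by rewrite /cprim => {1}->; rewrite cfunZE scalerDr scalerA cconvZr.
exists (z *: S1_ n : C), (z *: - (mu n *: S_ n) : C); split.
- exact: cprim_deriv_on (pZ _ _ p1).
- exact: cprim_deriv_on (pZ _ _ p2).
- move=> t tT; rewrite inner0l !mulr0 !cfunZE cfunNE cfunZE.
  rewrite (_ : integralS _ _ = 0).
    by rewrite mulr0 addr0; ring.
  apply: scalars_ext; rewrite (reS_integralS, imS_integralS) raddf0.
    by under eq_Rintegral do rewrite mul0r raddf0; rewrite Rintegral_cst// mul0r.
  by under eq_Rintegral do rewrite mul0r raddf0; rewrite Rintegral_cst// mul0r.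
- by rewrite inner0l cfunZE E1 cconv_at0 mulr0.
- by rewrite cfunZE E2 cfunDE cfunNE cfunZE cconv_at0 mulr0 oppr0 addr0 oneE mulr1.
Qed.

Lemma oscillation_neq0 n : exists2 d : R, 0 < d & forall t, 0 < t < d -> t <= T -> S_ n t != 0.
Proof.
have [E1 E2] := S_prim n.
have p1 : cprim (S_ n) (S1_ n) by rewrite /cprim {1 2}E1 cconv_at0 scale0r add0r.
have S0 : S_ n 0 = 0 by rewrite E1 cconv_at0.
have S10 : S1_ n 0 = 1 by rewrite E2 cfunDE cfunNE cfunZE cconv_at0 mulr0 oppr0 addr0 oneE.
have h0 : 0 <= (0 : R) <= T by apply/andP; split => //; exact: ltW.
have /is_deriv_onP/(_ 1 ltr01)[d d0 hd] := cprim_deriv_on p1 h0.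
exists d => // t /andP[t0 td] tT; apply/eqP => St.
have tn : t != 0 by rewrite gt_eqF.
have tT' : 0 <= 0 + t <= T by rewrite add0r tT ltW.
have := hd t tn; rewrite gtr0_norm// => /(_ td tT'); rewrite add0r.
by rewrite St S0 S10 subrr scaler0 subr0 rnormE absS1 ltxx.
Qed.

Lemma observability (T1 : R) : condB A mu phi B T1 -> T1 < T ->
  (forall n, dom B (phi n)) /\
  exists2 c : R, 0 < c & forall p (x : nat -> K),
    c^-1 * \sum_(n < p) absS (x n) ^+ 2 <=
    \int[leb]_(t in `[0, T]) rnorm (vcomb p S_ (fun n => x n *: B (phi n)) t) ^+ 2
      <= c * \sum_(n < p) absS (x n) ^+ 2.
Proof.
move=> [_ _ hB] T1T; have [c c0 hc] := hB T T1T.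
have main p x := hc _ _ _ _ H1_norm0 (wave_solution p x).
have domphi n : dom B (phi n).
  have [Bw [_ ae] _] := main n.+1 (fun i => (i == n)%:R).
  have [d d0 hd] := oscillation_neq0 n.
  have d'0 : 0 < Num.min d T by rewrite lt_min d0.
  have [t /andP[t0]] := ae_exists d'0 ae; rewrite lt_min => /andP[td tT].
  have tT' : 0 <= t <= T by apply/andP; split; exact: ltW.
  move=> /(_ tT') [+ _].
  have -> : \sum_(i < n.+1) (S_ i t * (val i == n)%:R) *: phi i = S_ n t *: phi n.
    rewrite big_ord_recr /= eqxx mulr1 big1 ?add0r// => i _.
    by rewrite ltn_eqF// mulr0 scale0r.
  move=> /(dom_scale (S_ n t)^-1)[].
  by rewrite scalerA mulVf ?scale1r//; apply: hd => //; [rewrite t0|exact: ltW].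
split => //; exists (c ^+ 2); first by rewrite exprn_gt0.
move=> p x; have [Bw [lBw ae] hBw] := main p x.
have E t : B (\sum_(i < p) (S_ i t * x i) *: phi i) = vcomb p S_ (fun n => x n *: B (phi n)) t.
  have [_ ->] := @dom_sum p (fun i => (S_ i t * x i) *: phi i) (fun n _ => (dom_scale _ (domphi n)).1).
  by apply: eq_bigr => i _; rewrite (dom_scale _ (domphi i)).2 scalerA.
move: hBw; rewrite expr0n /= add0r sqrtr_sqr ger0_norm ?rnorm_ge0// => /andP[h1 h2].
set J := \int[leb]_(t in _) _.
have JE : L2norm T Bw ^+ 2 = J.
  rewrite /L2norm sqr_sqrtr; last by apply: Rintegral_ge0 => t _; exact: sqr_ge0.
  rewrite /J /Rintegral; congr fine; apply: ae_eq_integral => //.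
  - exact: measurable_int _ (L2_integrable T0 lBw).
  - apply: (measurable_int _ (L2_integrable T0 (L2_econt T0 _))); exact: vcomb_continuous.
  apply: (ae_imply ae) => t h; rewrite /= in_itv /= => tT.
  by have [_ ->] := h tT; rewrite E.
have L0 : 0 <= L2norm T Bw by exact: sqrtr_ge0.
have N0 := rnorm_ge0 (\sum_(i < p) x i *: phi i).
rewrite -JE -(onb_sum_norm p x); apply/andP; split.
  rewrite -exprVn -exprMn ler_sqr// nnegrE mulr_ge0// invr_ge0 ltW//.
by rewrite -exprMn ler_sqr// nnegrE mulr_ge0// ltW.
Qed.

End Observability.

Section ScalarEquation.
Variables (R : realType) (s : scalar_kind) (T : R).
Hypothesis T0 : 0 < T.
Local Notation K := (scalars R s).
Local Notation C := (cfun s T).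
Local Notation leb := (@lebesgue_measure R).
Local Notation one := (@ccst R s T 1).
Local Notation I := (`[0, T]%classic : set R).
Local Notation inC := (@inC R s T).

(* d = W^n * d for all n, and the powers W^n tend to 0 *)
Lemma volterra_zero (W d : C) : d = cconv W d -> d = 0.
Proof.
move=> dE; have [g [c [hg gb]]] := pow_bound T0 W d.
have e j : inC W ^+ j * inC d = inC d.
  by elim: j => [|j ih]; rewrite ?expr0 ?mul1r// exprSr -mulrA inCM -dE.
have gE j : g j = d by apply: (@inC_inj R s T); rewrite -hg e.
apply: (@inC_inj R s T); rewrite [RHS]raddf0; apply: vanish_cst => //.
by exists c => j; apply: nbA_inC => //; rewrite -(gE j).
Qed.

Variables (M sigma : R -> K) (N sg : C).
Hypothesis mM : measS I M.
Hypothesis aeM : {ae leb, forall t : R, 0 <= t <= T -> M t = N t}.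
Hypothesis sgE : forall t : R, 0 <= t <= T -> sigma t = sg t.

Definition volterra_solution (m : K) (Y D : C) :=
  Y = cconv one D /\ D = cconv one (sg - m *: Y + m *: cconv N Y).

Lemma cprim_one (F f : C) : F = cconv one f -> cprim F f.
Proof. by move=> E; rewrite /cprim {1 2}E cconv_at0 scale0r add0r. Qed.

Lemma scalar_solution_exists (m f : K) (Y D : C) : volterra_solution m Y D ->
  scalar_solution T m M (fun t => sigma t * f) 0 0 (f *: Y : C).
Proof.
move=> [YE DE]; have pZ (F g : C) : cprim F g -> cprim (f *: F) (f *: g).
  by rewrite /cprim => {1}->; rewrite cfunZE scalerDr scalerA cconvZr.
exists (f *: D : C), (f *: (sg - m *: Y + m *: cconv N Y) : C); split.
- exact: cprim_deriv_on (pZ _ _ (cprim_one YE)).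
- exact: cprim_deriv_on (pZ _ _ (cprim_one DE)).
- move=> t tT; rewrite (conv_representative mM aeM (fun t _ => erefl ((f *: Y : C) t)) tT).
  rewrite sgE// cconvZr !(cfunZE, cfunDE, cfunNE); ring.
- by rewrite cfunZE YE cconv_at0 mulr0.
- by rewrite cfunZE DE cconv_at0 mulr0.
Qed.

Lemma scalar_solution_unique (m f : K) (Y D : C) y : volterra_solution m Y D ->
  scalar_solution T m M (fun t => sigma t * f) 0 0 y ->
  forall t, 0 <= t <= T -> y t = f * Y t.
Proof.
move=> [YE DE] [dy [ddy [h1 h2 h3 y0 dy0]]].
have T0' := ltW T0.
have cy := deriv_on_contS T0' h1; have cdy := deriv_on_contS T0' h2.
pose Z : C := cfun_of T cy; pose Z1 : C := cfun_of T cdy.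
have ZE t : 0 <= t <= T -> y t = Z t by move=> tT; rewrite /= !clamp_id.
pose Z2 : C := f *: sg - m *: Z + m *: cconv N Z.
have ddyE t : 0 <= t <= T -> ddy t = Z2 t.
  move=> tT; apply: (addIr (m * y t)); rewrite h3//.
  rewrite (conv_representative mM aeM ZE tT) sgE// /Z2 !(cfunZE, cfunDE, cfunNE) (ZE t tT).
  ring.
have cddy : contS (fun t => ddy (clamp T t)).
  rewrite (_ : (fun t => _) = Z2); first exact: cfun_contS.
  by apply/funext => t; rewrite ddyE ?cfun_clamp//; exact: clamp_itv.
have p1 := deriv_on_prim T0' h1 cdy; have p2 := deriv_on_prim T0' h2 cddy.
have Z_prim : Z = cconv one Z1.
  have : cprim Z Z1.
    apply/(cprimP T0); move: p1; congr (prim T _ _); apply/funext => t /=; by rewrite clampK.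
  by rewrite /cprim /= clamp0 clamp0 y0 scale0r add0r.
have Z1_prim : Z1 = cconv one Z2.
  have : cprim Z1 Z2.
    apply/(cprimP T0); move: p2; congr (prim T _ _); apply/funext => t; first by rewrite /= clampK.
    by rewrite ddyE ?cfun_clamp//; exact: clamp_itv.
  by rewrite /cprim [Z1 0]/= clamp0 clamp0 dy0 scale0r add0r.
pose d := Z - f *: Y.
have dE : d = cconv (cconv (cconv one one) (m *: N) - m *: cconv one one) d.
  rewrite {1}/d Z_prim Z1_prim YE DE -cconvZr -cconvNr -cconvDr -cconvZr -cconvNr -cconvDr.
  have -> : Z2 - f *: (sg - m *: Y + m *: cconv N Y) = cconv (m *: N) d - m *: d.
    rewrite /Z2 /d cconvDr cconvNr !cconvZl cconvZr.
    by apply: cfun_ext => // t _; rewrite !(cfunZE, cfunDE, cfunNE); ring.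
  move: (d) => d'.
  by rewrite !(cconvDl, cconvNl, cconvZl, cconvDr, cconvNr, cconvZr) -!cconvA.
move=> t tT; rewrite ZE//; have := volterra_zero dE.
by rewrite /d => /eqP; rewrite subr_eq0 => /eqP->.
Qed.

End ScalarEquation.

Section EigenSeries.
Variables (R : realType) (s : scalar_kind) (H : hilbert R s).
Local Notation K := (scalars R s).
Local Notation leb := (@lebesgue_measure R).
Local Notation "<< x , y >>" := (inner H x y).
Variables (phi : nat -> H).
Hypothesis onb : orthonormal_basis phi.
Implicit Types (x y : H) (a : nat -> K).

Definition psum (a : nat -> K) p : H := \sum_(i < p) a i *: phi i.
Definition qsum (a : nat -> K) p : R := \sum_(i < p) absS (a i) ^+ 2.

Lemma psum_dist a N p : (N <= p)%N ->
  rnorm (psum a p - psum a N) ^+ 2 = qsum a p - qsum a N.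
Proof.
move=> Np; rewrite rnorm_sqrB !(onb_sum_norm onb).
have -> : reS << psum a p, psum a N >> = qsum a N.
  rewrite inner_sumr raddf_sum; apply: eq_bigr => i _.
  rewrite innerZr (onb_sum onb) (leq_trans (ltn_ord i) Np) /= mulrC mulS_conj.
  exact: reS_ofR.
by rewrite -/(qsum a p) -/(qsum a N); ring.
Qed.

Lemma bessel x p : qsum (fun n => << x, phi n >>) p <= rnorm x ^+ 2.
Proof.
rewrite -subr_ge0; set a := fun n => _.
have <- : rnorm (x - psum a p) ^+ 2 = rnorm x ^+ 2 - qsum a p; last exact: sqr_ge0.
rewrite rnorm_sqrB (onb_sum_norm onb) -/(qsum a p).
have -> : reS << x, psum a p >> = qsum a p.
  rewrite inner_sumr raddf_sum; apply: eq_bigr => i _.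
  by rewrite innerZr mulrC mulS_conj; exact: reS_ofR.
by ring.
Qed.

Lemma psum_cvg x : psum (fun n => << x, phi n >>) @ \oo --> x.
Proof.
have := onb.2 x; rewrite (_ : series _ = psum (fun n => << x, phi n >>))//.
by apply/funext => p; rewrite /series /= big_mkord.
Qed.

Lemma rnorm_le_qsum x (b : R) : 0 <= b ->
  (forall p, qsum (fun n => << x, phi n >>) p <= b ^+ 2) -> rnorm x <= b.
Proof.
move=> b0 h; apply/ler_addgt0Pr => e e0.
have /rnorm_cvgP/(_ e e0)[N _ /(_ N (leqnn N)) /= hN] := @psum_cvg x.
have h1 : rnorm (psum (fun n => << x, phi n >>) N) <= b.
  rewrite -(@ler_pXn2r _ 2) ?nnegrE ?rnorm_ge0// (onb_sum_norm onb); exact: h.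
rewrite -[X in rnorm X](subrK (psum (fun n => << x, phi n >>) N)).
by apply: le_trans (ler_rnormD _ _) _; rewrite addrC; apply: lerD => //; exact: ltW.
Qed.

Lemma qsum_incr a : nondecreasing_seq (qsum a).
Proof.
apply/nondecreasing_seqP => p; rewrite /qsum big_ord_recr /= lerDl; exact: sqr_ge0.
Qed.

Lemma qsum_cvg a (b : R) : (forall p, qsum a p <= b) -> cvgn (qsum a).
Proof.
move=> h; apply: nondecreasing_is_cvgn; first exact: qsum_incr.
by exists b => _ [p _ <-]; exact: h.
Qed.

Lemma riesz_fischer_onb a (b : R) : (forall p, qsum a p <= b) ->
  exists x, forall n, << x, phi n >> = a n.
Proof.
move=> hb; have cq := qsum_cvg hb.
have cp : cvg (psum a @ \oo).
  apply/cauchy_cvgP/cauchy_exP => e e0.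
  have [ee re0] := ge0_ofR (ltW e0).
  have {}re0 : 0 < reS e by rewrite -(@ofR_lt R s) -ee rmorph0.
  have re2 : 0 < reS e ^+ 2 by rewrite exprn_gt0.
  have /cvgrPdist_lt/(_ _ re2)[N _ hN] := cq.
  exists (psum a N); exists N => //= p Np.
  rewrite -ball_normE /ball_ /= ee ofR_rnorm ofR_lt rdistC.
  rewrite -(@ltr_pXn2r _ 2) ?nnegrE ?rnorm_ge0 ?ltW// psum_dist//.
  have := hN N (leqnn N); apply: le_lt_trans; apply: le_trans (ler_norm _).
  by rewrite lerD2r; exact: nondecreasing_cvgn_le (@qsum_incr a) cq p.
exists (lim (psum a @ \oo)) => n; set x := lim _.
apply/eqP; rewrite -subr_eq0; apply/eqP/absS_eq0/eqP.
rewrite eq_le absS_ge0 andbT; apply/ler_addgt0Pr => e e0; rewrite add0r.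
have /rnorm_cvgP/(_ e e0)[N _ hN] : psum a @ \oo --> x by [].
have := hN _ (leq_maxl N n.+1) => /= h; apply: le_trans (ltW h).
have -> : << x, phi n >> - a n = << x - psum a (maxn N n.+1), phi n >>.
  by rewrite innerBl (onb_sum onb) (leq_maxr N n.+1).
apply: le_trans (cauchy_schwarz _ _) _.
have -> : rnorm (phi n) = 1.
  have := innerxx (phi n); rewrite (onb_inner onb) eqxx -(rmorph1 (@ofR R s)).
  move=> /(congr1 (@reS R s)); rewrite !reS_ofR => /esym/eqP.
  by rewrite sqrp_eq1 ?rnorm_ge0// => /eqP.
by rewrite mulr1.
Qed.

Lemma qsum_bounded (f_ y_ : nat -> K) (k : R) p : 0 <= k -> (forall n, absS (y_ n) <= k) ->
  qsum (fun n => f_ n * y_ n) p <= k ^+ 2 * qsum f_ p.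
Proof.
move=> k0 h; rewrite /qsum mulr_sumr; apply: ler_sum => i _.
rewrite absSM exprMn mulrC; apply: ler_wpM2r; first exact: sqr_ge0.
by rewrite ler_sqr ?nnegrE ?absS_ge0.
Qed.

Lemma multiplier (f : H) (y_ : nat -> K) (k : R) : 0 <= k -> (forall n, absS (y_ n) <= k) ->
  exists x, forall n, << x, phi n >> = << f, phi n >> * y_ n.
Proof.
move=> k0 h; apply: (@riesz_fischer_onb (fun n => << f, phi n >> * y_ n) (k ^+ 2 * rnorm f ^+ 2)) => p.
apply: le_trans (qsum_bounded (fun n => << f, phi n >>) p k0 h) _.
by apply: ler_wpM2l; [exact: sqr_ge0|exact: bessel].
Qed.

Lemma tail_qsum a N p :
  \sum_(i < p) (if (N <= i)%N then absS (a i) ^+ 2 else 0) = qsum a (maxn N p) - qsum a N.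
Proof.
elim: p => [|p ih]; first by rewrite big_ord0 maxn0 subrr.
rewrite big_ord_recr /= ih; case: leqP => Np.
  rewrite (maxn_idPr (leqW Np)) /qsum [in RHS]big_ord_recr /=.
  by rewrite addrAC.
by rewrite addr0 (maxn_idPl Np).
Qed.

Variable T : R.
Hypothesis T0 : 0 < T.
Local Notation C := (cfun s T).
Local Notation one := (@ccst R s T 1).

Lemma cconv_one_lip (F f : C) (k : R) : F = cconv one f -> nb f k ->
  forall x y : R, 0 <= x <= T -> 0 <= y <= T -> absS (F y - F x) <= k * `|y - x|.
Proof.
move=> FE hf.
have main (x y : R) : 0 <= x -> x <= y -> y <= T -> absS (F y - F x) <= k * `|y - x|.
  move=> x0 xy yT; have xT : 0 <= x <= T by rewrite x0 (le_trans xy).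
  have yT' : 0 <= y <= T by rewrite yT (le_trans x0).
  have [ir ii] : leb.-integrable `[0, T]%classic (EFin \o reF f) /\
    leb.-integrable `[0, T]%classic (EFin \o imF f) by apply: contS_integrable; exact: cfun_contS.
  have -> : F y - F x = integralS `[x, y] f.
    rewrite FE !cconv_oneE//; apply: scalars_ext.
      rewrite reSD reSN !reS_integralS.
      by rewrite (integral_itv_split ir x0 xy yT) addrAC subrr add0r.
    rewrite imSD imSN !imS_integralS.
    by rewrite (integral_itv_split ii x0 xy yT) addrAC subrr add0r.
  apply: le_trans (absS_integralS _ _ (cfun_contS f)) _.
  move: (xy); rewrite le_eqVlt => /predU1P[<-|xy'].
    by rewrite set_itv1 Rintegral_set1 subrr normr0 mulr0.
  have -> : k * `|y - x| = \int[leb]_(t in `[x, y]) k.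
    rewrite Rintegral_cst//= lebesgue_measure_itv /= lte_fin xy' -EFinB /=.
    by rewrite ger0_norm// subr_ge0.
  apply: le_integral_continuous.
  - exact: contS_absS (cfun_contS f).
  - exact: cst_continuous.
  - by move=> t /andP[xt ty]; apply: hf; rewrite (le_trans x0 xt) (le_trans ty yT).
move=> x y /andP[x0 xT] /andP[y0 yT]; have [xy|yx] := leP x y; first exact: main.
by rewrite -absSN opprB distrC; apply: main => //; exact: ltW.
Qed.

Lemma series_deriv (f : H) (Y_ D_ : nat -> C) (k : R) (u du : R -> H) : 0 <= k ->
  (forall n, Y_ n = cconv one (D_ n)) -> (forall n, nb (D_ n) k) ->
  (forall t n, 0 <= t <= T -> << u t, phi n >> = << f, phi n >> * Y_ n t) ->
  (forall t n, 0 <= t <= T -> << du t, phi n >> = << f, phi n >> * D_ n t) ->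
  forall t, 0 <= t <= T -> is_deriv_on T u t (du t).
Proof.
move=> k0 YE Db uE duE t tT; apply/is_deriv_onP => e e0.
pose f_ n := << f, phi n >>.
have cq : cvgn (qsum f_) by apply: (@qsum_cvg _ (rnorm f ^+ 2)) => p; exact: bessel.
pose eta := (e / 2) ^+ 2.
have eta0 : 0 < eta by rewrite exprn_gt0// divr_gt0.
pose e1 := Num.sqrt (eta / 2 / (rnorm f ^+ 2 + 1)).
have F1 : 0 < rnorm f ^+ 2 + 1 by rewrite ltr_wpDl// sqr_ge0.
have e11 : 0 < eta / 2 / (rnorm f ^+ 2 + 1) by rewrite divr_gt0// divr_gt0.
have e10 : 0 < e1 by rewrite sqrtr_gt0.
pose k2 := (2 * k) ^+ 2.
have k20 : 0 <= k2 by exact: sqr_ge0.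
have k21 : 0 < k2 + 1 by rewrite ltr_wpDl.
have eta2 : 0 < eta / 2 / (k2 + 1) by rewrite divr_gt0// divr_gt0.
have /cvgrPdist_lt/(_ _ eta2)[N _ hN] := cq.
have tailN p : k2 * \sum_(i < p) (if (N <= i)%N then absS (f_ i) ^+ 2 else 0) <= eta / 2.
  rewrite tail_qsum; apply: (@le_trans _ _ (k2 * (eta / 2 / (k2 + 1)))).
    apply: ler_wpM2l => //; apply: le_trans (ltW (hN N (leqnn N))).
    apply: le_trans (ler_norm _); rewrite lerD2r.
    exact: nondecreasing_cvgn_le (@qsum_incr f_) cq _.
  by rewrite mulrA ler_pdivrMr// mulrC; apply: ler_wpM2l; [rewrite divr_ge0// ltW|rewrite lerDl].
pose q n h := D_ n t - ofR s h^-1 * (Y_ n (t + h) - Y_ n t).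
have fin M : exists2 d : R, 0 < d & forall h, h != 0 -> `|h| < d -> 0 <= t + h <= T ->
    forall n, (n < M)%N -> absS (q n h) < e1.
  elim: M => [|M [d d0 hd]]; first by exists 1.
  have := cprim_deriv_on T0 (cprim_one (YE M)) tT.
  move=> /is_deriv_onP/(_ e1 e10)[d' d'0 hd'].
  exists (Num.min d d'); first by rewrite lt_min d0.
  move=> h h0; rewrite lt_min => /andP[h1 h2] thT n; rewrite ltnS leq_eqVlt => /predU1P[->|].
    by have := hd' h h0 h2 thT; rewrite rnormE.
  exact: hd.
have [d d0 hd] := fin N; exists d => // h h0 hhd thT.
have qb n : absS (q n h) <= 2 * k.
  have h1 := Db n t tT; have h2 := cconv_one_lip (YE n) (Db n) tT thT.
  apply: le_trans (absSD _ _) _; rewrite absSN absSM absS_ofR normfV mulr_natl mulr2n.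
  apply: lerD => //; have hp : 0 < `|h| by rewrite normr_gt0.
  by rewrite -ler_pdivlMl ?invr_gt0// invrK mulrC; move: h2; rewrite addrAC subrr add0r.
set x := du t - _.
have xE n : << x, phi n >> = f_ n * q n h.
  by rewrite innerBl innerZl innerBl !uE// duE// /q /f_; ring.
apply: (@le_lt_trans _ _ (e / 2)); last by rewrite ltr_pdivrMr// ltr_pMr// ltr1n.
apply: rnorm_le_qsum; first by rewrite divr_ge0// ltW.
move=> p; rewrite -/eta /qsum; under eq_bigr do rewrite xE.
apply: (@le_trans _ _ (\sum_(i < p) (e1 ^+ 2 * absS (f_ i) ^+ 2 +
   k2 * (if (N <= i)%N then absS (f_ i) ^+ 2 else 0)))).
  apply: ler_sum => i _; rewrite absSM exprMn mulrC.
  have f0 : 0 <= absS (f_ i) ^+ 2 by exact: sqr_ge0.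
  case: leqP => Ni.
    apply: (@le_trans _ _ (k2 * absS (f_ i) ^+ 2)).
      by apply: ler_wpM2r => //; rewrite ler_sqr ?nnegrE ?absS_ge0// mulr_ge0.
    by rewrite lerDr mulr_ge0// sqr_ge0.
  rewrite mulr0 addr0; apply: ler_wpM2r => //.
  rewrite ler_sqr ?nnegrE ?absS_ge0 ?sqrtr_ge0//; apply: ltW; exact: hd.
rewrite big_split /= -!mulr_sumr.
have h1 : e1 ^+ 2 * \sum_(i < p) absS (f_ i) ^+ 2 <= eta / 2.
  rewrite sqr_sqrtr; last exact: ltW.
  rewrite mulrAC ler_pdivrMr//; apply: ler_wpM2l; first by rewrite divr_ge0// ltW.
  by apply: le_trans (bessel f p) _; rewrite lerDl.
by apply: le_trans (lerD h1 (tailN p)) _; rewrite -splitr.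
Qed.

End EigenSeries.

Lemma closed_graph (K : numFieldType) (H G : normedModType K) (B : linop H G)
    (x_ : nat -> H) (x : H) (y : G) : closed_op B -> (forall k, dom B (x_ k)) ->
  x_ @ \oo --> x -> B (x_ k) @[k --> \oo] --> y -> dom B x /\ B x = y.
Proof.
move=> cB dx hx hy; apply: (@closed_cvg _ _ \oo _ (fun k => (x_ k, B (x_ k))) _ cB _ (x, y)).
  by apply: nearW => k /=; split.
exact: cvg_pair.
Qed.

Theorem theorem1p3 (R : realType) (s : scalar_kind) (H G : hilbert R s)
    (A : linop H H) (B : linop H G)
    (mu : nat -> scalars R s) (phi : nat -> H) (T0 T : R)
    (M sigma : R -> scalars R s)
    (hA : condA A)
    (phi_onb : orthonormal_basis phi) (phi_eig : eigenpairs A mu phi)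
    (T0_ge0 : 0 <= T0) (hB : condB A mu phi B T0)
    (T_gt : T0 < T)
    (hM : Sobolev2 T M) (hsigma : C1_on T sigma) (sigma0 : sigma 0 <> 0) :
  exists theta : nat -> R -> G,
    (forall n, L2 T (theta n)) /\
    forall f : H,
      (exists u : R -> H, solution mu phi T M sigma f 0 0 u) /\
      forall u : R -> H, solution mu phi T M sigma f 0 0 u ->
        exists (du : R -> H) (Bdu : R -> G),
          [/\ forall t : R, 0 <= t <= T -> is_deriv_on T u t (du t),
              L2_image B T du Bdu
            & series (fun n => L2inner T Bdu (theta n) *: phi n) @ \oo --> f].
Proof.
have T_gt0 : 0 < T by exact: le_lt_trans T_gt.
have [N [N1 [mM aeM hN]]] := Sobolev2_representative T_gt0 hM.
have [sg [sg1 [hs sgE]]] := C1_on_cprim T_gt0 hsigma.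
have sg0 : sg 0 != 0.
  rewrite -sgE; last by rewrite lexx ltW.
  exact/eqP.
have [al [k [w [e [c [e0 hal hk hw rep]]]]]] := volterra_representation T_gt0 hN hs sg0.
have [_ _ _ _ sb] := hA.
have [c1 [m_ [c10 hm]]] := eigenvalues_real phi_onb sb phi_eig.
have [kS kS0 osc] := @exists_oscillation R s T T_gt0 c1 c10.
have [S_ [S1_ hS]] : exists S_ S1_ : nat -> cfun s T, forall n,
    [/\ S_ n = cconv (ccst T 1) (S1_ n),
        S1_ n = ccst T 1 - mu n *: cconv (ccst T 1) (S_ n) & nb (S_ n) kS].
  have Hn n : exists p : cfun s T * cfun s T, [/\ p.1 = cconv (ccst T 1) p.2,
        p.2 = ccst T 1 - mu n *: cconv (ccst T 1) p.1 & nb p.1 kS].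
    have [mE mc] := hm n; have [S [S' [h1 h2 h3]]] := osc _ mc.
    by exists (S, S'); split; rewrite /= ?mE.
  by have [p hp] := choice Hn; exists (fun n => (p n).1), (fun n => (p n).2).
have [Y_ [D_ hYD]] : exists Y_ D_ : nat -> cfun s T, forall n,
    volterra_solution N sg (mu n) (Y_ n) (D_ n) /\ volterra_image al k w (S_ n) (D_ n).
  have Hn n : exists p : cfun s T * cfun s T,
      volterra_solution N sg (mu n) p.1 p.2 /\ volterra_image al k w (S_ n) p.2.
    have [h1 h2 _] := hS n; have [Y [D [h3 h4 h5]]] := rep _ _ _ h1 h2.
    by exists (Y, D).
  by have [p hp] := choice Hn; exists (fun n => (p n).1), (fun n => (p n).2).
have S_prim n : S_ n = cconv (ccst T 1) (S1_ n) /\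
    S1_ n = ccst T 1 - mu n *: cconv (ccst T 1) (S_ n) by have [] := hS n.
have [domphi [c2 c20 obs]] := observability phi_onb T_gt0 S_prim hB T_gt.
have [b b0 equiv] := volterra_equivalence G T_gt0 e0 hal hk hw.
have riesz p (x : nat -> scalars R s) : (c2 * b)^-1 * \sum_(n < p) absS (x n) ^+ 2 <=
    \int[@lebesgue_measure R]_(t in `[0, T]) (rnorm (comb D_ (fun n => B (phi n)) p x t) ^+ 2)
    <= b * c2 * \sum_(n < p) absS (x n) ^+ 2.
  have /andP[lo up] := obs p x.
  have [v1 v2] := equiv p S_ D_ (fun n => x n *: B (phi n)) (fun n => (hYD n).2).
  apply/andP; split.
    rewrite invfM mulrAC ler_pdivrMr// [leRHS]mulrC; exact: le_trans lo v2.
  by apply: le_trans v1 _; rewrite -mulrA ler_pM2l.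
have cb0 : 0 < (c2 * b)^-1 by rewrite invr_gt0 mulr_gt0.
have [theta ltheta htheta] := dual_sequence T_gt0 cb0 riesz.
have [A0 _ hA0] := nb_exists al.
pose kD := A0 * kS + 2 * (T * c * (c * kS)).
have hD n : nb (D_ n) kD.
  have [_ _ h3] := hS n; exact: (nb_volterra_image T_gt0 hA0 hk hw h3 (hYD n).2).
have YE n : Y_ n = cconv (ccst T 1) (D_ n) by have [[]] := hYD n.
have hY n : nb (Y_ n) (T * 1 * kD).
  by rewrite YE; apply: nb_conv => // t _; rewrite /= absS1.
have nbT (F : cfun s T) d t : nb F d -> absS (F t) <= d.
  by move=> hF; rewrite -cfun_clamp; apply: hF; exact/clamp_itv/ltW.
exists theta; split=> // f.
pose f_ n := inner H f (phi n).
have kD0 : 0 <= kD := nb_ge0 T_gt0 (hD 0%N).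
have kY0 : 0 <= T * 1 * kD := nb_ge0 T_gt0 (hY 0%N).
split.
  have Hu t := multiplier phi_onb f kY0 (fun n => nbT (Y_ n) _ t (hY n)).
  have [u hu] := choice Hu.
  exists u => n; rewrite !inner0l.
  have -> : (fun t => inner H (u t) (phi n)) = (f_ n *: Y_ n : cfun s T).
    by apply/funext => t; rewrite hu.
  exact: (scalar_solution_exists T_gt0 mM aeM sgE (f_ n) (hYD n).1).
move=> u hu.
have uE t n : 0 <= t <= T -> inner H (u t) (phi n) = f_ n * Y_ n t.
  have := hu n; rewrite !inner0l => hun tT.
  exact: (scalar_solution_unique T_gt0 mM aeM sgE (hYD n).1 hun tT).
have Hdu t := multiplier phi_onb f kD0 (fun n => nbT (D_ n) _ t (hD n)).
have [du hdu] := choice Hdu.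
have cvf : cvgn (series (fun n => absS (f_ n) ^+ 2)).
  rewrite (_ : series _ = qsum f_); first exact: qsum_cvg (bessel phi_onb f).
  by apply/funext => p; rewrite /series /= big_mkord.
have [Bdu [nu [lBdu nuS aeB hBdu]]] := htheta f_ cvf.
exists du, Bdu; split.
- by apply: (series_deriv phi_onb T_gt0 kD0 YE hD uE) => t n _; exact: hdu.
- split => //; apply: (ae_imply aeB) => t ht tT.
  pose x_ p := psum phi (fun n => inner H (du t) (phi n)) p.
  have xE p : dom B (x_ p) /\ B (x_ p) = comb D_ (fun n => B (phi n)) p f_ t.
    have [h1 h2] := @dom_sum _ _ _ _ B p (fun i => inner H (du t) (phi i) *: phi i)
      (fun n _ => (dom_scale _ (domphi n)).1).
    split; first exact: h1.
    rewrite /x_ /psum h2; apply: eq_bigr => i _.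
    by rewrite (dom_scale _ (domphi i)).2 hdu scalerA [D_ i t * _]mulrC.
  have nu_ge j : (j <= nu j)%N by elim: j => // j ih; exact: leq_ltn_trans (nuS j).
  have [cB _ _] := hB.
  have [] := @closed_graph _ _ _ B (fun j => x_ (nu j)) (du t) (Bdu t) cB.
  + by move=> j; have [] := xE (nu j).
  + have h := @psum_cvg _ _ _ _ phi_onb (du t).
    apply: (cvg_comp _ _ _ h).
    apply/cvgnyPge => M0; exists M0 => // j /= Mj; exact: leq_trans Mj (nu_ge j).
  + rewrite (_ : (fun j => B (x_ (nu j))) = fun j => comb D_ (fun n => B (phi n)) (nu j) f_ t).
      exact: ht.
    by apply/funext => j; have [_] := xE (nu j).
  + by [].
- rewrite (_ : (fun n => _) = fun n => f_ n *: phi n); first exact: phi_onb.2.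
  by apply/funext => n; rewrite hBdu.
Qed.
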